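(* Let $\sigma>0$, $\beta>0$, $s\in\mathbb R$ with $\lambda:=\frac{\sigma+1}{\beta+2}>\frac23$, and consider the rescaled Lorenz–Stenflo system $$\dot\xi=\eta-\varepsilon(\sigma\xi-s\chi),\quad \dot\eta=-\xi\zeta-\varepsilon\eta,\quad \dot\zeta=\xi\eta-\varepsilon\beta(\zeta+\sigma),\quad \dot\chi=-\varepsilon(\xi+\sigma\chi).$$ Let $(M_1,M_3,M_4)$ be its Melnikov vector along the periodic orbits $L_1^{A,B}\times\{\chi_0\}$ ($|A|<B$) of the $\varepsilon=0$ system, as defined in the context. Then: (i) $\tilde M_1$ and $M_3$ do not depend on $\chi_0$ or $s$ and coincide with the corresponding Melnikov integrals of the Lorenz system (the case without $\chi$), and $M_4=0$ if and only if $\chi_0=0$; hence $(M_1,M_3,M_4)=0$ if and only if $\chi_0=0$ and $\tilde M_1=M_3=0$. (ii) At the zero of $(M_1,M_3,M_4)$ the non-degeneracy condition $\det\frac{\partial(M_1,M_3,M_4)}{\partial(I,B,\chi_0)}\neq0$ holds. Consequently, for all sufficiently small $\varepsilon>0$ the system has a periodic orbit in an order-$\varepsilon$ neighborhood of $L_1^{A,B}\times\{0\}$, where $(A,B)$ is the unique solution of $\tilde M_1=M_3=0$ with $|A|<B$.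
   Context: The Lorenz–Stenflo system is $X'=\sigma(Y-X)+sV$, $Y'=\rho X-Y-XZ$, $Z'=-\beta Z+XY$, $V'=-X-\sigma V$; the rescaled form follows from $\varepsilon=\rho^{-1/2}$, $X=\varepsilon^{-1}\xi$, $Y=\varepsilon^{-2}\sigma^{-1}\eta$, $Z=\varepsilon^{-2}(\sigma^{-1}\zeta+1)$, $V=\varepsilon^{-1}\chi$, $t=\varepsilon\tau$. For $0<k<1$, $K(k)=\int_0^1\frac{dt}{\sqrt{(1-t^2)(1-k^2t^2)}}$ and $E(k)=\int_0^1\sqrt{\frac{1-k^2t^2}{1-t^2}}\,dt$ are the complete elliptic integrals; $\mathrm{sn},\mathrm{cn},\mathrm{dn}$ are the Jacobi elliptic functions with modulus $k$. At $\varepsilon=0$ the quantities $A=\frac12\xi^2-\zeta$, $B=(\eta^2+\zeta^2)^{1/2}$ and $\chi$ are conserved. For $|A|<B$ put $k_1^2=\frac{A+B}{2B}$; $L_1^{A,B}$ is the periodic orbit $\xi=2k_1\sqrt B\,\mathrm{cn}(u,k_1)$, $\eta=-2k_1B\,\mathrm{dn}(u,k_1)\mathrm{sn}(u,k_1)$, $\zeta=B(1-2k_1^2\mathrm{sn}^2(u,k_1))$, $u=\sqrt B\tau$, of period $T=4K(k_1)/\sqrt B$. With the polar angle $\phi$ defined by $\zeta=B\cos\phi$, $\eta=B\sin\phi$, set, integrating along $L_1^{A,B}$ over one period with $\chi\equiv\chi_0$, $$\tilde M_1=\int_0^T\big[-\sigma\xi^2+s\xi\chi_0+B\beta\cos\phi+\beta\sigma\big]d\tau,$$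 $$M_3=-\int_0^T\big[B+(\beta-1)B\cos^2\phi+\sigma\beta\cos\phi\big]d\tau,$$ $$M_4=-\int_0^T(\xi+\sigma\chi_0)\,d\tau.$$ The action variable is $I=16\sqrt B\,\big(E(k_1)-(1-k_1^2)K(k_1)\big)$, the frequency $\Omega$ is given by $1/\Omega=\partial I/\partial A|_B=T$, and $M_1=\frac1\Omega\tilde M_1+\frac{\partial I}{\partial B}\big|_AM_3$, where $|_A$ (resp. $|_B$) means that $A$ (resp. $B$) is held fixed. In the determinant, $(M_1,M_3,M_4)$ is regarded as a function of $(I,B,\chi_0)$. The equations $\tilde M_1=M_3=0$ have exactly one solution $(A,B)$ with $|A|<B$ when $\lambda>2/3$. The corresponding Melnikov integrals of the Lorenz system are $\tilde M_1$ (without the term $s\xi\chi_0$) and $M_3$ for the system $\dot\xi=\eta-\varepsilon\sigma\xi$, $\dot\eta=-\xi\zeta-\varepsilon\eta$, $\dot\zeta=\xi\eta-\varepsilon\beta(\zeta+\sigma)$. ''Sufficiently small $\varepsilon$'' means $0<\varepsilon<\varepsilon_0$ with $\varepsilon_0$ possibly depending on $\sigma,\beta,s$. *)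

(* Defs.v *)
From Stdlib Require Import Reals.
From Coquelicot Require Import Coquelicot.
Open Scope R_scope.

(* [iota P] is Coquelicot's definite description: the unique real satisfying
   [P] when there is exactly one. *)

(** Elliptic integrals and Jacobi elliptic functions, modulus [k], 0 < k < 1.
    Both integrands below are singular at t = 1: the integrals are improper. *)

Definition ellipticK (k : R) : R :=
  RInt_gen (fun t => / sqrt ((1 - t ^ 2) * (1 - k ^ 2 * t ^ 2)))
    (at_point 0) (at_left 1).

Definition ellipticE (k : R) : R :=
  RInt_gen (fun t => sqrt ((1 - k ^ 2 * t ^ 2) / (1 - t ^ 2)))
    (at_point 0) (at_left 1).

Definition ellipticF (theta k : R) : R :=
  RInt (fun x => / sqrt (1 - k ^ 2 * sin x ^ 2)) 0 theta.

(* Jacobi amplitude: the inverse of [ellipticF] in its first argument. *)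
Definition am (u k : R) : R := iota (fun theta : R => ellipticF theta k = u).

Definition sn (u k : R) : R := sin (am u k).
Definition cn (u k : R) : R := cos (am u k).
Definition dn (u k : R) : R := sqrt (1 - k ^ 2 * sn u k ^ 2).

(** The periodic orbits [L1 A B], |A| < B, of the eps = 0 system. *)

Definition k1 (A B : R) : R := sqrt ((A + B) / (2 * B)).

Definition period (A B : R) : R := 4 * ellipticK (k1 A B) / sqrt B.

Definition xi1 (A B tau : R) : R :=
  2 * k1 A B * sqrt B * cn (sqrt B * tau) (k1 A B).

Definition eta1 (A B tau : R) : R :=
  - 2 * k1 A B * B * dn (sqrt B * tau) (k1 A B) * sn (sqrt B * tau) (k1 A B).

Definition zeta1 (A B tau : R) : R :=
  B * (1 - 2 * k1 A B ^ 2 * sn (sqrt B * tau) (k1 A B) ^ 2).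

(* Polar angle: zeta = B cos phi, eta = B sin phi.  Only cos phi is used, so
   the choice of the branch (-PI, PI] is immaterial. *)
Definition phi1 (A B tau : R) : R :=
  iota (fun phi : R => - PI < phi <= PI /\
    zeta1 A B tau = B * cos phi /\ eta1 A B tau = B * sin phi).

(** Melnikov integrals along [L1 A B] x {chi0}. *)

Definition Mt1 (sigma beta s A B chi0 : R) : R :=
  RInt (fun tau => - sigma * xi1 A B tau ^ 2 + s * xi1 A B tau * chi0
                   + B * beta * cos (phi1 A B tau) + beta * sigma)
    0 (period A B).

Definition M3 (sigma beta A B : R) : R :=
  - RInt (fun tau => B + (beta - 1) * B * cos (phi1 A B tau) ^ 2
                     + sigma * beta * cos (phi1 A B tau))
      0 (period A B).

Definition M4 (sigma A B chi0 : R) : R :=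
  - RInt (fun tau => xi1 A B tau + sigma * chi0) 0 (period A B).

(* The Lorenz system: no variable chi. *)
Definition lorenz_Mt1 (sigma beta A B : R) : R :=
  RInt (fun tau => - sigma * xi1 A B tau ^ 2
                   + B * beta * cos (phi1 A B tau) + beta * sigma)
    0 (period A B).

Definition lorenz_M3 (sigma beta A B : R) : R :=
  - RInt (fun tau => B + (beta - 1) * B * cos (phi1 A B tau) ^ 2
                     + sigma * beta * cos (phi1 A B tau))
      0 (period A B).

Definition action (A B : R) : R :=
  16 * sqrt B *
    (ellipticE (k1 A B) - (1 - k1 A B ^ 2) * ellipticK (k1 A B)).

(* 1 / Omega = dI/dA at fixed B, which equals [period A B]. *)
Definition Omega (A B : R) : R := / Derive (fun a => action a B) A.

Definition M1 (sigma beta s A B chi0 : R) : R :=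
  / Omega A B * Mt1 sigma beta s A B chi0
  + Derive (fun b => action A b) B * M3 sigma beta A B.

Definition melnikov (sigma beta s A B chi0 : R) : R * R * R :=
  (M1 sigma beta s A B chi0, M3 sigma beta A B, M4 sigma A B chi0).

(** The Melnikov vector as a function of (I, B, chi0). *)

Definition A_of_action (I B : R) : R :=
  iota (fun A : R => Rabs A < B /\ action A B = I).

Definition melnikov_IB (sigma beta s I B chi0 : R) : R * R * R :=
  melnikov sigma beta s (A_of_action I B) B chi0.

Definition det3 (a11 a12 a13 a21 a22 a23 a31 a32 a33 : R) : R :=
  a11 * (a22 * a33 - a23 * a32)
  - a12 * (a21 * a33 - a23 * a31)
  + a13 * (a21 * a32 - a22 * a31).

Definition partials_exist (F : R -> R -> R -> R) (x y z : R) : Prop :=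
  ex_derive (fun t => F t y z) x /\
  ex_derive (fun t => F x t z) y /\
  ex_derive (fun t => F x y t) z.

(* [Derive] is total, so the existence of the nine partial derivatives is
   required explicitly. *)
Definition jacobian_nondegenerate
    (F : R -> R -> R -> R * R * R) (x y z : R) : Prop :=
  let F1 a b c := fst (fst (F a b c)) in
  let F2 a b c := snd (fst (F a b c)) in
  let F3 a b c := snd (F a b c) in
  let d1 (G : R -> R -> R -> R) := Derive (fun t => G t y z) x in
  let d2 (G : R -> R -> R -> R) := Derive (fun t => G x t z) y in
  let d3 (G : R -> R -> R -> R) := Derive (fun t => G x y t) z in
  partials_exist F1 x y z /\ partials_exist F2 x y z /\
  partials_exist F3 x y z /\
  det3 (d1 F1) (d2 F1) (d3 F1)
       (d1 F2) (d2 F2) (d3 F2)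
       (d1 F3) (d2 F3) (d3 F3) <> 0.

(** The rescaled Lorenz-Stenflo system. *)

(* (xi, eta, zeta, chi); the Coquelicot norm on this product is Euclidean. *)
Definition state : Type := (R * R * R * R)%type.

Definition lorenz_stenflo (sigma beta s eps : R) (p : state) : state :=
  let '(xi, eta, zeta, chi) := p in
  (eta - eps * (sigma * xi - s * chi),
   - xi * zeta - eps * eta,
   xi * eta - eps * beta * (zeta + sigma),
   - eps * (xi + sigma * chi)).

Definition is_solution (f : state -> state) (x : R -> state) : Prop :=
  forall tau : R, is_derive x tau (f (x tau)).

(* A parametrized periodic orbit; equilibria are excluded. *)
Definition is_periodic_orbit (f : state -> state) (x : R -> state) : Prop :=
  is_solution f x /\
  (exists P : R, 0 < P /\ forall tau : R, x (tau + P) = x tau) /\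
  (exists tau1 tau2 : R, x tau1 <> x tau2).

Definition L1 (A B chi0 tau : R) : state :=
  (xi1 A B tau, eta1 A B tau, zeta1 A B tau, chi0).

Definition orbit_within (r : R) (x y : R -> state) : Prop :=
  forall tau : R, exists tau' : R, norm (minus (x tau) (y tau')) <= r.

(* Main.v *)
Require Import Defs.
From Stdlib Require Import ZArith Reals Lra Lia Psatz.
From Coquelicot Require Import Coquelicot.
Open Scope R_scope.

(** With psi the amplitude am u, the orbits L1 have elementary coordinates:
    xi = 2 r cos psi, eta = - 2 r w sin psi, zeta = B - 2 r^2 sin^2 psi, where
    r^2 = (A + B) / 2 and w = sqrt (B - r^2 sin^2 psi), and psi' = w when
    eps = 0.  Hence the Melnikov integrals are combinations of K and E at
    m = k1^2 = (A + B) / (2 B).  Eliminating B from Mt1 = M3 = 0 leaves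
    3 lambda - 2 = W / Q with W and Q quadratic forms in (K, E), and W / Q is
    strictly decreasing where Q > 0, which gives uniqueness and
    non-degeneracy.

    For eps > 0 the system in the coordinates (A, B, chi, psi) reads
    dy/dpsi = eps F(y, psi, eps), y = (A, B, chi), with F periodic in psi and
    mean at eps = 0 equal to the Melnikov vector.  Writing
    y = c + (eps / mu) V(psi), a periodic solution near a simple zero is a
    fixed point of a contraction in (c, V).  The inverse of
    tau(psi) = int dpsi / psi' turns it into a periodic orbit of the flow. *)

(** No flow map and no Poincaré section is built. The unknown is the whole periodic curve,
    parametrized by psi, whose period 2 PI does not move with eps; the fixed-point equation is an
    integral equation, and the ODE is recovered by differentiating it. The scale mu settles a
    conflict: the update of V depends on (c, V) with a Lipschitz constant of order mu, while the
    update of c depends on V with one of order eps / mu. So mu is fixed small first, and eps is then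
    taken small against mu. Non-degeneracy enters twice: in (I, B, chi0) for the determinant and in
    (A, B, chi) for the contraction. Both reduce to one computation in (m, B). At fixed m, Mt1 and
    M3 are affine in B up to a nonzero factor, so eliminating B is a 2x2 resultant; at a zero its
    m-derivative is, up to nonzero factors, the Jacobian determinant of (Mt1, M3) along any two
    independent directions of the (m, B) plane. Passing from Mt1 to M1 is a row operation, and chi0
    splits off because only M4 depends on it. *)

(** * Continuity, mean value arguments and inverse functions *)

Lemma cont_plus (f g : R -> R) x :
  continuous f x -> continuous g x -> continuous (fun t => f t + g t) x.
Proof. exact (continuous_plus f g x). Qed.

Lemma cont_opp (f : R -> R) x : continuous f x -> continuous (fun t => - f t) x.
Proof. exact (continuous_opp f x). Qed.

Lemma cont_minus (f g : R -> R) x :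
  continuous f x -> continuous g x -> continuous (fun t => f t - g t) x.
Proof. exact (continuous_minus f g x). Qed.

Lemma cont_mult (f g : R -> R) x :
  continuous f x -> continuous g x -> continuous (fun t => f t * g t) x.
Proof. exact (continuous_mult f g x). Qed.

Lemma cont_const (c x : R) : continuous (fun _ : R => c) x.
Proof. apply continuous_const. Qed.

Lemma cont_id (x : R) : continuous (fun t : R => t) x.
Proof. apply continuous_id. Qed.

Lemma cont_pow (f : R -> R) n x :
  continuous f x -> continuous (fun t => f t ^ n) x.
Proof.
  intros Hf; induction n as [|n IH]; simpl.
  - apply cont_const.
  - now apply cont_mult.
Qed.

Lemma cont_inv (f : R -> R) x :
  continuous f x -> f x <> 0 -> continuous (fun t => / f t) x.
Proof.
  intros Hf H0; apply (continuous_comp f Rinv); [exact Hf|].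
  now apply continuous_Rinv.
Qed.

Lemma cont_div (f g : R -> R) x :
  continuous f x -> continuous g x -> g x <> 0 ->
  continuous (fun t => f t / g t) x.
Proof. intros; apply cont_mult; [assumption|now apply cont_inv]. Qed.

Lemma cont_sqrt (f : R -> R) x :
  continuous f x -> continuous (fun t => sqrt (f t)) x.
Proof.
  intros Hf; apply (continuous_comp f sqrt); [exact Hf|].
  apply continuous_sqrt.
Qed.

Lemma cont_sin x : continuous sin x.
Proof. apply continuity_pt_filterlim, continuity_sin. Qed.

Lemma cont_cos x : continuous cos x.
Proof. apply continuity_pt_filterlim, continuity_cos. Qed.

Ltac rmin :=
  repeat first [apply Rmin_l | apply Rle_refl | eapply Rle_trans; [apply Rmin_r|]].

Ltac abs_tri := eapply Rle_trans; [apply Rabs_triang|].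

Ltac mul_mono := apply Rmult_le_compat_l; [lra|].

Ltac pos := repeat first [apply Rmult_lt_0_compat | apply Rdiv_lt_0_compat
  | apply pow_lt | apply Rinv_0_lt_compat | assumption | lra].

Ltac cont :=
  repeat (first [assumption | lazymatch goal with
  | |- continuous (fun _ => ?c) _ => apply cont_const
  | |- continuous (fun t => t) _ => apply cont_id
  | |- continuous sin _ => apply cont_sin
  | |- continuous cos _ => apply cont_cos
  | |- continuous (fun t => sin t) _ => apply cont_sin
  | |- continuous (fun t => cos t) _ => apply cont_cos
  | |- continuous (fun t => @?f t + @?g t) _ => apply (cont_plus f g)
  | |- continuous (fun t => @?f t - @?g t) _ => apply (cont_minus f g)
  | |- continuous (fun t => @?f t * @?g t) _ => apply (cont_mult f g)
  | |- continuous (fun t => @?f t / @?g t) _ => apply (cont_div f g)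
  | |- continuous (fun t => - @?f t) _ => apply (cont_opp f)
  | |- continuous (fun t => / @?f t) _ => apply (cont_inv f)
  | |- continuous (fun t => @?f t ^ ?n) _ => apply (cont_pow f n)
  | |- continuous (fun t => sqrt (@?f t)) _ => apply (cont_sqrt f)
  end]; cbv beta).

Lemma cont_pt (f : R -> R) x : continuous f x -> continuity_pt f x.
Proof. apply continuity_pt_filterlim. Qed.

Lemma cont_of_derive (f : R -> R) x l : is_derive f x l -> continuous f x.
Proof.
  intros H; apply (ex_derive_continuous f); now exists l.
Qed.

Lemma ex_RInt_cont (f : R -> R) a b :
  (forall x, continuous f x) -> ex_RInt f a b.
Proof. intros H; apply (ex_RInt_continuous f); intros; apply H. Qed.

Lemma MVT_R (f df : R -> R) (a b : R) :
  (forall x, Rmin a b <= x <= Rmax a b -> is_derive f x (df x)) ->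
  exists c, Rmin a b <= c <= Rmax a b /\ f b - f a = df c * (b - a).
Proof.
  intros H; apply (MVT_gen f a b df).
  - intros x Hx; apply H; lra.
  - intros x Hx; apply cont_pt.
    apply (cont_of_derive _ _ _ (H x Hx)).
Qed.

Lemma incr_of_derive_pos (f df : R -> R) (a b : R) :
  a < b ->
  (forall x, a <= x <= b -> is_derive f x (df x)) ->
  (forall x, a <= x <= b -> 0 < df x) -> f a < f b.
Proof.
  intros Hab Hd Hp.
  destruct (MVT_R f df a b) as [c [Hc E]].
  - intros x Hx; apply Hd; rewrite Rmin_left, Rmax_right in Hx; lra.
  - rewrite Rmin_left, Rmax_right in Hc by lra.
    specialize (Hp c Hc); nra.
Qed.

Lemma IVT_cont (f : R -> R) (a b : R) :
  a < b -> (forall x, a <= x <= b -> continuous f x) ->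
  f a <= 0 <= f b -> exists x, a <= x <= b /\ f x = 0.
Proof.
  intros Hab Hc [Ha Hb].
  destruct (Req_dec (f a) 0) as [E|Na]; [exists a; lra|].
  destruct (Req_dec (f b) 0) as [E|Nb]; [exists b; lra|].
  destruct (Ranalysis5.IVT_interv f a b) as [z Hz]; try lra.
  - intros x Hx; apply cont_pt, Hc; lra.
  - exists z; exact Hz.
Qed.

(** On the interval of radius |y - f x0| / c around [x0], a slope of at least [c] brings [f] below
    [y] on the left and above it on the right. The distance bound is kept because it later gives the
    continuity of a local inverse. *)
Lemma surjective_near (f df : R -> R) (x0 d c y : R) :
  0 < c ->
  (forall x, Rabs (x - x0) <= d -> is_derive f x (df x)) ->
  (forall x, Rabs (x - x0) <= d -> c <= df x) ->
  Rabs (y - f x0) <= c * d ->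
  exists x, Rabs (x - x0) <= Rabs (y - f x0) / c /\ f x = y.
Proof.
  intros Hc Hd Hp Hy.
  set (r := Rabs (y - f x0) / c).
  assert (Hr : 0 <= r)
    by (apply Rdiv_le_0_compat; [apply Rabs_pos|exact Hc]).
  assert (Hrd : r <= d) by (apply Rle_div_l; [exact Hc|]; lra).
  assert (Erc : c * r = Rabs (y - f x0)) by (unfold r; field; lra).
  (* For r = 0 the interval degenerates and [x0] itself is the preimage; the intermediate value
     lemma wants a proper interval. *)
  destruct (Req_dec r 0) as [E0|N0].
  { exists x0; split.
    - unfold Rminus; rewrite Rplus_opp_r, Rabs_R0; lra.
    - rewrite E0, Rmult_0_r in Erc; symmetry in Erc.
      apply Rabs_eq_0 in Erc; lra. }
  assert (HI : forall x, x0 - r <= x <= x0 + r -> Rabs (x - x0) <= d)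
    by (intros x Hx; apply Rabs_le; lra).
  assert (Hinc : forall u v, x0 - r <= u -> u <= v -> v <= x0 + r ->
    c * (v - u) <= f v - f u).
  { intros u v H1 H2 H3.
    destruct (MVT_R f df u v) as [z [Hz E]].
    - intros x Hx; rewrite Rmin_left, Rmax_right in Hx by lra.
      apply Hd, HI; lra.
    - rewrite Rmin_left, Rmax_right in Hz by lra.
      rewrite E; apply Rmult_le_compat_r; [lra|].
      apply Hp, HI; lra. }
  destruct (IVT_cont (fun x => f x - y) (x0 - r) (x0 + r)) as [x [Hx E]].
  - lra.
  - intros x Hx; apply cont_minus; [|apply cont_const].
    apply (cont_of_derive _ _ _ (Hd x (HI x Hx))).
  - pose proof (Hinc (x0 - r) x0 ltac:(lra) ltac:(lra) ltac:(lra)).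
    pose proof (Hinc x0 (x0 + r) ltac:(lra) ltac:(lra) ltac:(lra)).
    pose proof (Rle_abs (y - f x0)).
    pose proof (Rle_abs (- (y - f x0))) as H2; rewrite Rabs_Ropp in H2.
    lra.
  - exists x; split; [apply Rabs_le; lra|lra].
Qed.

Lemma surjective_of_derive_ge (f df : R -> R) (c y : R) :
  0 < c -> (forall x, is_derive f x (df x)) -> (forall x, c <= df x) ->
  exists x, f x = y.
Proof.
  intros Hc Hd Hp.
  destruct (surjective_near f df 0 (Rabs (y - f 0) / c) c y Hc) as [x [_ E]].
  - intros; apply Hd.
  - intros; apply Hp.
  - right; field; lra.
  - now exists x.
Qed.

(** The difference quotient of [g] is the reciprocal of that of [f] for the increment k = g (y0 + h)
    - g y0. Data at [y0] and a local right inverse suffice, so the lemma serves global inverses and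
    the local inverse of [Gf] alike. *)
Lemma is_derive_inverse (f g : R -> R) (y0 l : R) :
  is_derive f (g y0) l -> l <> 0 -> continuous g y0 ->
  locally y0 (fun y => f (g y) = y) -> is_derive g y0 (/ l).
Proof.
  intros Hf Hl Hg Hfg.
  assert (E0 : f (g y0) = y0) by exact (locally_singleton _ _ Hfg).
  apply is_derive_Reals; apply is_derive_Reals in Hf.
  intros eps Heps.
  set (al := Rabs l).
  assert (Hal : 0 < al) by now apply Rabs_pos_lt.
  (* |f x - f x0 - l (x - x0)| <= e |x - x0| with e <= |l|/2 gives
     |x - x0| <= 2 |f x - f x0| / |l|. *)
  set (e := Rmin (al / 2) (eps * al * al / 4)).
  assert (He : 0 < e) by (apply Rmin_pos; [lra|]; repeat apply Rmult_lt_0_compat; lra).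
  destruct (Hf e He) as [d Hd].
  apply continuity_pt_filterlim in Hg.
  destruct (Hg d (cond_pos d)) as [d1 [Hd1 Hg1]].
  destruct Hfg as [d2 Hd2].
  assert (Hdm : 0 < Rmin d1 d2) by (apply Rmin_pos; [lra|apply d2]).
  exists (mkposreal _ Hdm); intros h Hh0 Hh; simpl in Hh.
  assert (Hh1 : Rabs h < d1) by (eapply Rlt_le_trans; [exact Hh|apply Rmin_l]).
  assert (Hh2 : Rabs h < d2) by (eapply Rlt_le_trans; [exact Hh|apply Rmin_r]).
  assert (E1 : f (g (y0 + h)) = y0 + h).
  { apply Hd2; change (Rabs (y0 + h - y0) < d2).
    replace (y0 + h - y0) with h by ring; exact Hh2. }
  assert (Hg2 : Rabs (g (y0 + h) - g y0) < d).
  { apply (Hg1 (y0 + h)); split.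
    - split; [exact I|lra].
    - simpl; unfold Rdist; now replace (y0 + h - y0) with h by ring. }
  set (k := g (y0 + h) - g y0) in *.
  assert (Hk0 : k <> 0).
  { intros E; assert (Eg : g (y0 + h) = g y0) by (unfold k in E; lra).
    rewrite Eg, E0 in E1; lra. }
  specialize (Hd k Hk0 Hg2).
  replace (g y0 + k) with (g (y0 + h)) in Hd by (unfold k; ring).
  rewrite E1, E0 in Hd.
  replace ((y0 + h - y0) / k) with (h / k) in Hd by (field; exact Hk0).
  assert (Hq : Rabs (h / k) >= al / 2).
  { pose proof (Rabs_triang_inv l (h / k)) as Ht.
    rewrite Rabs_minus_sym in Hd.
    pose proof (Rmin_l (al / 2) (eps * al * al / 4)).
    fold e in H; fold al in Ht; lra. }
  replace (k / h - / l) with ((l - h / k) * / (l * (h / k)))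
    by (field; repeat split; assumption).
  rewrite Rabs_mult, Rabs_inv, Rabs_mult; fold al.
  rewrite Rabs_minus_sym in Hd.
  pose proof (Rmin_r (al / 2) (eps * al * al / 4)) as Hm; fold e in Hm.
  apply (Rmult_lt_reg_r (al * Rabs (h / k))); [nra|].
  rewrite Rmult_assoc, Rinv_l, Rmult_1_r by nra.
  assert (eps * al * al / 2 <= eps * (al * Rabs (h / k))).
  { replace (eps * al * al / 2) with (eps * (al * (al / 2))) by field.
    mul_mono; apply Rmult_le_compat_l; lra. }
  assert (0 < eps * al * al) by (repeat apply Rmult_lt_0_compat; lra).
  lra.
Qed.

(** A derivative of at least [c] makes [f] expand distances by [c]: it is injective and onto, and
    its inverse is Lipschitz with constant 1 / c, hence continuous as [is_derive_inverse] asks. This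
    yields both the amplitude [am] and the angle as a function of time. *)
Lemma global_inverse (f df : R -> R) (c : R) : 0 < c ->
  (forall x, is_derive f x (df x)) -> (forall x, c <= df x) ->
  exists g : R -> R, (forall y, f (g y) = y) /\ (forall x, g (f x) = x) /\
    forall y, is_derive g y (/ df (g y)).
Proof.
  intros Hc Hd Hp.
  assert (Hexp : forall x y, x <= y -> c * (y - x) <= f y - f x).
  { intros x y Hxy; destruct (MVT_R f df x y) as [z [_ E]]; [auto|].
    rewrite E; apply Rmult_le_compat_r; [lra|apply Hp]. }
  assert (Habs : forall x y, c * Rabs (x - y) <= Rabs (f x - f y)).
  { intros x y; destruct (Rle_or_lt x y) as [H|H].
    - pose proof (Hexp x y H).
      assert (0 <= c * (y - x)) by (apply Rmult_le_pos; lra).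
      rewrite (Rabs_minus_sym x), (Rabs_minus_sym (f x)), !Rabs_pos_eq; lra.
    - pose proof (Hexp y x ltac:(lra)).
      assert (0 <= c * (x - y)) by (apply Rmult_le_pos; lra).
      rewrite !Rabs_pos_eq; lra. }
  assert (Hinj : forall x y, f x = f y -> x = y).
  { intros x y E; pose proof (Habs x y) as H.
    rewrite E, Rminus_diag, Rabs_R0 in H.
    pose proof (Rabs_pos (x - y)).
    assert (E0 : Rabs (x - y) = 0) by nra; apply Rabs_eq_0 in E0; lra. }
  set (g := fun y => iota (fun x : R => f x = y)).
  assert (Hg : forall x, g (f x) = x).
  { intros x; apply (iota_unique (fun z : R => f z = f x)); [|easy].
    intros z; apply Hinj. }
  assert (Hfg : forall y, f (g y) = y).
  { intros y; destruct (surjective_of_derive_ge f df c y Hc Hd Hp) as [x <-].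
    now rewrite Hg. }
  exists g; split; [exact Hfg|split; [exact Hg|]].
  intros y; apply (is_derive_inverse f).
  - apply Hd.
  - specialize (Hp (g y)); lra.
  - apply continuity_pt_filterlim; intros e He.
    exists (c * e); split; [apply Rmult_lt_0_compat; lra|].
    intros z [_ Hz]; simpl in *; unfold Rdist in *.
    specialize (Habs (g z) (g y)); rewrite !Hfg in Habs.
    apply (Rmult_lt_reg_l c); lra.
  - apply filter_forall, Hfg.
Qed.

(** * Integrals of continuous and periodic functions *)

Ltac toR := match goal with |- @eq _ ?a ?b => change (@eq R a b) end.

Lemma RInt_ext_R (f g : R -> R) a b :
  (forall x, f x = g x) -> RInt f a b = RInt g a b.
Proof. intros H; apply RInt_ext; intros; apply H. Qed.

Lemma RInt_plus_R (f g : R -> R) a b :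
  (forall x, continuous f x) -> (forall x, continuous g x) ->
  RInt (fun x => f x + g x) a b = RInt f a b + RInt g a b.
Proof. intros Hf Hg; apply (RInt_plus f g); now apply ex_RInt_cont. Qed.

Lemma RInt_minus_R (f g : R -> R) a b :
  (forall x, continuous f x) -> (forall x, continuous g x) ->
  RInt (fun x => f x - g x) a b = RInt f a b - RInt g a b.
Proof. intros Hf Hg; apply (RInt_minus f g); now apply ex_RInt_cont. Qed.

Lemma RInt_scal_R (f : R -> R) k a b :
  (forall x, continuous f x) ->
  RInt (fun x => k * f x) a b = k * RInt f a b.
Proof. intros Hf; apply (RInt_scal f a b k); now apply ex_RInt_cont. Qed.

Lemma RInt_lin3 (f g h : R -> R) (k l r a b : R) :
  (forall x, continuous f x) -> (forall x, continuous g x) ->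
  (forall x, continuous h x) ->
  RInt (fun x => k * f x + l * g x + r * h x) a b
  = k * RInt f a b + l * RInt g a b + r * RInt h a b.
Proof.
  intros Hf Hg Hh.
  rewrite (RInt_plus_R (fun x => k * f x + l * g x) (fun x => r * h x)),
    (RInt_plus_R (fun x => k * f x) (fun x => l * g x)), !RInt_scal_R;
    auto; intros; cont; auto.
Qed.

Lemma RInt_const_R (c a b : R) : RInt (fun _ => c) a b = (b - a) * c.
Proof. rewrite RInt_const; reflexivity. Qed.

Lemma RInt_Chasles_R (f : R -> R) a b c :
  (forall x, continuous f x) -> RInt f a b + RInt f b c = RInt f a c.
Proof.
  intros Hf; apply (RInt_Chasles f a b c); now apply ex_RInt_cont.
Qed.

Lemma RInt_of_derive (F f : R -> R) (a b : R) :
  (forall x, is_derive F x (f x)) -> (forall x, continuous f x) ->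
  RInt f a b = F b - F a.
Proof.
  intros HF Hf; apply is_RInt_unique.
  apply (is_RInt_derive F f); intros; [apply HF|apply Hf].
Qed.

Lemma is_derive_RInt_cont (f : R -> R) (a x : R) :
  (forall t, continuous f t) -> is_derive (fun y => RInt f a y) x (f x).
Proof.
  intros Hf; apply (is_derive_RInt f (fun y => RInt f a y) a x); [|apply Hf].
  apply filter_forall; intros y.
  apply (RInt_correct f); now apply ex_RInt_cont.
Qed.

Lemma RInt_shift (f : R -> R) (v a b : R) :
  (forall x, continuous f x) ->
  RInt (fun t => f (t + v)) a b = RInt f (a + v) (b + v).
Proof.
  intros Hf.
  replace (a + v) with (1 * a + v) by ring.
  replace (b + v) with (1 * b + v) by ring.
  rewrite <- (RInt_comp_lin f 1 v a b) by now apply ex_RInt_cont.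
  apply RInt_ext; intros x _.
  unfold scal; simpl; unfold mult; simpl; rewrite Rmult_1_l; f_equal; ring.
Qed.

Lemma RInt_reflect (f : R -> R) (v a b : R) :
  (forall x, continuous f x) ->
  RInt (fun t => f (v - t)) a b = RInt f (v - b) (v - a).
Proof.
  intros Hf.
  rewrite <- (opp_RInt_swap f) by now apply ex_RInt_cont.
  replace (v - a) with (-1 * a + v) by ring.
  replace (v - b) with (-1 * b + v) by ring.
  rewrite <- (RInt_comp_lin f (-1) v a b) by now apply ex_RInt_cont.
  rewrite <- (RInt_opp (fun y => scal (-1) (f (-1 * y + v)))).
  - apply RInt_ext; intros x _.
    unfold scal, opp; simpl; unfold mult; simpl.
    replace (-1 * x + v) with (v - x) by ring; ring.
  - apply ex_RInt_cont; intros x; apply (cont_mult (fun _ => -1)); [cont|].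
    apply (continuous_comp (fun y => -1 * y + v) f); [cont|apply Hf].
Qed.

(** Translation folds [PI, 2 PI] onto [0, PI] and reflection folds [PI / 2, PI] onto [0, PI / 2]:
    this is the origin of the factor 4 in the period 4 K. *)
Lemma RInt_period_symmetric (g : R -> R) :
  (forall x, continuous g x) -> (forall t, g (PI - t) = g t) ->
  (forall t, g (t + PI) = g t) ->
  RInt g 0 (2 * PI) = 4 * RInt g 0 (PI / 2).
Proof.
  intros Hc Hr Hp.
  assert (E1 : RInt g PI (2 * PI) = RInt g 0 PI).
  { rewrite <- (RInt_ext_R _ _ 0 PI Hp).
    rewrite RInt_shift by exact Hc; f_equal; ring. }
  assert (E2 : RInt g (PI / 2) PI = RInt g 0 (PI / 2)).
  { rewrite <- (RInt_ext_R _ _ 0 (PI / 2) Hr).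
    rewrite RInt_reflect by exact Hc; f_equal; field. }
  rewrite <- (RInt_Chasles_R g 0 PI (2 * PI)), E1 by exact Hc.
  rewrite <- (RInt_Chasles_R g 0 (PI / 2) PI), E2 by exact Hc; toR; ring.
Qed.

Lemma RInt_period_antisymmetric (g : R -> R) :
  (forall x, continuous g x) -> (forall t, g (t + PI) = - g t) ->
  RInt g 0 (2 * PI) = 0.
Proof.
  intros Hc Hp.
  assert (E1 : RInt g PI (2 * PI) = - RInt g 0 PI).
  { replace (2 * PI) with (PI + PI) by ring.
    replace PI with (0 + PI) at 1 by ring.
    rewrite <- RInt_shift by exact Hc.
    rewrite (RInt_ext_R _ _ 0 PI Hp).
    apply (RInt_opp g); now apply ex_RInt_cont. }
  rewrite <- (RInt_Chasles_R g 0 PI (2 * PI)), E1 by exact Hc; toR; ring.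
Qed.

(** * Complete elliptic integrals as functions of the parameter m = k^2 *)

(** This is dn as a function of the amplitude [t] and of the parameter m = k^2: [dn u k] is
    [Dl (k ^ 2) (am u k)]. In this variable the complete integrals are proper. *)
Definition Dl (m t : R) : R := sqrt (1 - m * sin t ^ 2).
Definition Kc (m : R) : R := RInt (fun t => / Dl m t) 0 (PI / 2).
Definition Ec (m : R) : R := RInt (Dl m) 0 (PI / 2).

Lemma sin2_bound t : 0 <= sin t ^ 2 <= 1.
Proof.
  pose proof (SIN_bound t) as H; split; [apply pow2_ge_0|].
  rewrite <- (pow1 2); apply pow_maj_Rabs, Rabs_le; lra.
Qed.

Lemma cos2_sin2 t : cos t ^ 2 = 1 - sin t ^ 2.
Proof. pose proof (sin2_cos2 t); unfold Rsqr in *; lra. Qed.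

Lemma radicand_pos m t : m < 1 -> 0 < 1 - m * sin t ^ 2.
Proof.
  pose proof (sin2_bound t) as H; intros Hm.
  assert (0 <= (1 - m) * sin t ^ 2) by (apply Rmult_le_pos; lra).
  destruct (Rle_lt_or_eq_dec _ _ (proj2 H)) as [Hs|Hs]; [lra|rewrite Hs; lra].
Qed.

Lemma Dl_pos m t : m < 1 -> 0 < Dl m t.
Proof. intros; now apply sqrt_lt_R0, radicand_pos. Qed.

Lemma Dl_neq m t : m < 1 -> Dl m t <> 0.
Proof. intros H; pose proof (Dl_pos m t H); lra. Qed.

Lemma Dl_sqr m t : m < 1 -> Dl m t ^ 2 = 1 - m * sin t ^ 2.
Proof.
  intros H; unfold Dl; rewrite pow2_sqrt; [easy|].
  now apply Rlt_le, radicand_pos.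
Qed.

Lemma Dl_le_1 m t : 0 <= m -> Dl m t <= 1.
Proof.
  intros H; rewrite <- sqrt_1; apply sqrt_le_1_alt.
  pose proof (sin2_bound t); nra.
Qed.

Lemma inv_Dl_ge m t : 0 <= m < 1 -> 1 <= / Dl m t.
Proof.
  intros H; rewrite <- Rinv_1; apply Rinv_le_contravar; [apply Dl_pos; lra|].
  now apply Dl_le_1.
Qed.

Lemma cont_Dl m t : continuous (Dl m) t.
Proof. unfold Dl; cont. Qed.

Lemma cont_inv_Dl m t : m < 1 -> continuous (fun t => / Dl m t) t.
Proof. intros H; apply cont_inv; [apply cont_Dl|now apply Dl_neq]. Qed.

Ltac contD :=
  intros; cont;
  auto using cont_Dl, cont_inv_Dl, Dl_neq, pow_nonzero, Rgt_not_eq.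

Lemma is_derive_Dl m t : m < 1 ->
  is_derive (Dl m) t (- m * sin t * cos t / Dl m t).
Proof.
  intros H; unfold Dl; pose proof (radicand_pos m t H) as Hp.
  auto_derive; [replace (sin t * (sin t * 1)) with (sin t ^ 2) by ring; lra|].
  replace (sin t * (sin t * 1)) with (sin t ^ 2) by ring.
  fold (1 - m * sin t ^ 2); field.
  apply Rgt_not_eq, sqrt_lt_R0; exact Hp.
Qed.

(** The primitive vanishes at 0 and PI / 2, so integration trades the integral of 1 / Dl^3, which
    occurs in the derivative of K, for E. *)
Lemma is_derive_sincos_div m t : m < 1 ->
  is_derive (fun t => m * (sin t * cos t / Dl m t)) t
    (Dl m t - (1 - m) * / Dl m t ^ 3).
Proof.
  intros H; pose proof (Dl_pos m t H) as Hp.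
  auto_derive.
  - repeat split; [now exists (- m * sin t * cos t / Dl m t); apply is_derive_Dl|lra].
  - rewrite (is_derive_unique (fun x : R => Dl m x) _ _ (is_derive_Dl m t H)).
    pose proof (Dl_sqr m t H) as E; pose proof (cos2_sin2 t) as E'.
    set (d := Dl m t) in *; set (s := sin t) in *; set (c := cos t) in *.
    clearbody d s c.
    transitivity (m * ((c ^ 2 - s ^ 2) * d ^ 2 + m * s ^ 2 * c ^ 2) / d ^ 3);
      [field; lra|].
    transitivity (((d ^ 2) ^ 2 - (1 - m)) / d ^ 3); [|field; lra].
    rewrite E, E'; f_equal; ring.
Qed.

(** The primitive vanishes at both ends of a period, which expresses the integral of Dl^3 through
    those of Dl and 1 / Dl. The cube comes from cos^2 phi in [M3]. *)
Lemma is_derive_sincos_mul m t : m < 1 ->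
  is_derive (fun t => m * (sin t * cos t * Dl m t)) t
    (3 * Dl m t ^ 3 + - (2 * (2 - m)) * Dl m t + (1 - m) * / Dl m t).
Proof.
  intros H; pose proof (Dl_pos m t H) as Hp.
  auto_derive.
  - repeat split; now exists (- m * sin t * cos t / Dl m t); apply is_derive_Dl.
  - rewrite (is_derive_unique (fun x : R => Dl m x) _ _ (is_derive_Dl m t H)).
    pose proof (Dl_sqr m t H) as E; pose proof (cos2_sin2 t) as E'.
    set (d := Dl m t) in *; set (s := sin t) in *; set (c := cos t) in *.
    clearbody d s c.
    transitivity (m * ((c ^ 2 - s ^ 2) * d ^ 2 - m * s ^ 2 * c ^ 2) / d);
      [field; lra|].
    transitivity ((3 * (d ^ 2) ^ 2 - 2 * (2 - m) * d ^ 2 + (1 - m)) / d);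
      [|field; lra].
    rewrite E, E'; f_equal; ring.
Qed.

Lemma RInt_inv_Dl3 m : m < 1 ->
  (1 - m) * RInt (fun t => / Dl m t ^ 3) 0 (PI / 2) = Ec m.
Proof.
  intros H.
  assert (E := RInt_of_derive _ _ 0 (PI / 2)
    (fun t => is_derive_sincos_div m t H)).
  rewrite (RInt_minus_R (Dl m) (fun t => (1 - m) * / Dl m t ^ 3)),
    RInt_scal_R, cos_PI2, sin_0 in E.
  - fold (Ec m) in E.
    assert (E2 := E ltac:(contD)); unfold Rdiv in E2; lra.
  - contD.
  - contD.
  - contD.
Qed.

Lemma RInt_Dl3 m : m < 1 ->
  3 * RInt (fun t => Dl m t ^ 3) 0 (2 * PI)
  = 2 * (2 - m) * RInt (Dl m) 0 (2 * PI)
    - (1 - m) * RInt (fun t => / Dl m t) 0 (2 * PI).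
Proof.
  intros H.
  assert (E := RInt_of_derive _ _ 0 (2 * PI)
    (fun t => is_derive_sincos_mul m t H)).
  rewrite (RInt_lin3 (fun t => Dl m t ^ 3) (Dl m) (fun t => / Dl m t)),
    sin_2PI, sin_0 in E.
  - assert (E2 := E ltac:(contD)); lra.
  - contD.
  - contD.
  - contD.
Qed.

Lemma Dl_sub m t : Dl m (PI - t) = Dl m t.
Proof. unfold Dl; now rewrite sin_PI_x. Qed.

Lemma Dl_add m t : Dl m (t + PI) = Dl m t.
Proof.
  unfold Dl; rewrite neg_sin; f_equal; ring.
Qed.

Lemma RInt_inv_Dl_period m : m < 1 ->
  RInt (fun t => / Dl m t) 0 (2 * PI) = 4 * Kc m.
Proof.
  intros H; apply RInt_period_symmetric.
  - contD.
  - intros; now rewrite Dl_sub.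
  - intros; now rewrite Dl_add.
Qed.

Lemma RInt_Dl_period m : RInt (Dl m) 0 (2 * PI) = 4 * Ec m.
Proof.
  apply RInt_period_symmetric.
  - contD.
  - intros; now rewrite Dl_sub.
  - intros; now rewrite Dl_add.
Qed.

Lemma locally_lt1 m : m < 1 -> locally m (fun u => u < 1).
Proof. intros H; apply (open_lt 1 m H). Qed.

Lemma is_derive_Dl_param m t : m < 1 ->
  is_derive (fun u => Dl u t) m (- sin t ^ 2 / (2 * Dl m t)).
Proof.
  intros H; unfold Dl; pose proof (radicand_pos m t H) as Hp.
  auto_derive; [replace (sin t * (sin t * 1)) with (sin t ^ 2) by ring; lra|].
  replace (sin t * (sin t * 1)) with (sin t ^ 2) by ring.
  fold (1 - m * sin t ^ 2); field.
  apply Rgt_not_eq, sqrt_lt_R0; exact Hp.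
Qed.

Lemma is_derive_inv_Dl_param m t : m < 1 ->
  is_derive (fun u => / Dl u t) m (sin t ^ 2 / (2 * Dl m t ^ 3)).
Proof.
  intros H; pose proof (Dl_neq m t H) as Hp.
  evar (l : R).
  replace (sin t ^ 2 / (2 * Dl m t ^ 3)) with l.
  - apply (is_derive_inv (fun u => Dl u t) m); [|exact Hp].
    now apply is_derive_Dl_param.
  - unfold l; field; exact Hp.
Qed.

Lemma continuity_2d_sin2 m t : continuity_2d_pt (fun _ v => sin v ^ 2) m t.
Proof.
  apply (continuity_1d_2d_pt_comp (fun x => sin x ^ 2) (fun _ v => v)).
  - apply cont_pt; cont.
  - apply (continuity_2d_pt_id2 m t).
Qed.

Lemma continuity_2d_Dl m t : m < 1 -> continuity_2d_pt Dl m t.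
Proof.
  intros H; unfold Dl.
  apply (continuity_1d_2d_pt_comp sqrt (fun u v => 1 - u * sin v ^ 2)).
  - apply continuity_pt_sqrt, Rlt_le, radicand_pos, H.
  - apply continuity_2d_pt_minus; [apply continuity_2d_pt_const|].
    apply continuity_2d_pt_mult; [apply continuity_2d_pt_id1|].
    apply continuity_2d_sin2.
Qed.

Lemma is_derive_RInt_param_R (f df : R -> R -> R) a b m : m < 1 ->
  (forall u t, u < 1 -> is_derive (fun u => f u t) u (df u t)) ->
  (forall t, continuity_2d_pt df m t) ->
  (forall u t, u < 1 -> continuous (f u) t) ->
  is_derive (fun u => RInt (f u) a b) m (RInt (df m) a b).
Proof.
  intros H Hd Hc Hf.
  rewrite (RInt_ext_R (df m) (fun t => Derive (fun u => f u t) m)).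
  - apply is_derive_RInt_param.
    + apply (filter_imp (fun u => u < 1)); [|now apply locally_lt1].
      intros u Hu t _; exists (df u t); now apply Hd.
    + intros t _.
      apply (continuity_2d_pt_ext_loc df); [|apply Hc].
      destruct (locally_lt1 m H) as [d Hd1].
      exists d; intros u v Hu _; symmetry; apply is_derive_unique, Hd, Hd1, Hu.
    + apply (filter_imp (fun u => u < 1)); [|now apply locally_lt1].
      intros u Hu; apply ex_RInt_cont; intros; now apply Hf.
  - intros t; symmetry; now apply is_derive_unique, Hd.
Qed.

Lemma is_derive_Ec m : 0 < m < 1 ->
  is_derive Ec m ((Ec m - Kc m) / (2 * m)).
Proof.
  intros H; unfold Ec at 1.
  replace ((Ec m - Kc m) / (2 * m)) with
    (RInt (fun t => - sin t ^ 2 / (2 * Dl m t)) 0 (PI / 2)).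
  - apply (is_derive_RInt_param_R Dl (fun m t => - sin t ^ 2 / (2 * Dl m t)));
      [lra|intros; now apply is_derive_Dl_param| |contD].
    intros t; apply continuity_2d_pt_mult.
    + apply continuity_2d_pt_opp, continuity_2d_sin2.
    + apply continuity_2d_pt_inv.
      * apply continuity_2d_pt_mult; [apply continuity_2d_pt_const|].
        apply continuity_2d_Dl; lra.
      * pose proof (Dl_pos m t ltac:(lra)); lra.
  (* sin^2 = (1 - Dl^2) / m turns the differentiated integrand into a combination of Dl and 1 /
     Dl. *)
  - rewrite (RInt_ext_R _ (fun t => / (2 * m) * (Dl m t - / Dl m t))).
    + rewrite RInt_scal_R, (RInt_minus_R (Dl m) (fun t => / Dl m t)).
      * unfold Ec, Kc; toR; field; lra.
      * contD.
      * intros; apply cont_inv_Dl; lra.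
      * contD; apply Dl_neq; lra.
    + intros t; pose proof (Dl_sqr m t ltac:(lra)) as E.
      pose proof (Dl_pos m t ltac:(lra)) as Hp.
      replace (- sin t ^ 2) with ((Dl m t ^ 2 - 1) / m)
        by (rewrite E; field; lra).
      field; lra.
Qed.

Lemma is_derive_Kc m : 0 < m < 1 ->
  is_derive Kc m ((Ec m - (1 - m) * Kc m) / (2 * m * (1 - m))).
Proof.
  intros H; unfold Kc at 1.
  replace ((Ec m - (1 - m) * Kc m) / (2 * m * (1 - m))) with
    (RInt (fun t => sin t ^ 2 / (2 * Dl m t ^ 3)) 0 (PI / 2)).
  - apply (is_derive_RInt_param_R (fun m t => / Dl m t)
      (fun m t => sin t ^ 2 / (2 * Dl m t ^ 3)));
      [lra|intros; now apply is_derive_inv_Dl_param| |contD].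
    intros t; pose proof (Dl_pos m t ltac:(lra)).
    assert (H2 : continuity_2d_pt Dl m t) by (apply continuity_2d_Dl; lra).
    apply continuity_2d_pt_mult; [apply continuity_2d_sin2|].
    apply continuity_2d_pt_inv.
    + repeat apply continuity_2d_pt_mult;
        try apply continuity_2d_pt_const; exact H2.
    + apply Rgt_not_eq, Rmult_lt_0_compat; [lra|now apply pow_lt].
  (* Writing E as (1 - m) times the integral of 1 / Dl^3 brings both sides to the same two
     integrals. *)
  - rewrite <- (RInt_inv_Dl3 m) by lra.
    rewrite (RInt_ext_R _ (fun t => / (2 * m) * (/ Dl m t ^ 3 - / Dl m t))).
    + rewrite RInt_scal_R, (RInt_minus_R (fun t => / Dl m t ^ 3) (fun t => / Dl m t)).
      * unfold Ec, Kc; toR; field; lra.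
      * contD; apply pow_nonzero, Dl_neq; lra.
      * intros; apply cont_inv_Dl; lra.
      * contD; try apply pow_nonzero; apply Dl_neq; lra.
    + intros t; pose proof (Dl_sqr m t ltac:(lra)) as E.
      pose proof (Dl_pos m t ltac:(lra)) as Hp.
      replace (sin t ^ 2) with ((1 - Dl m t ^ 2) / m)
        by (rewrite E; field; lra).
      field; lra.
Qed.

(* Over a period, the integrals of m cn^2, cos phi and cos^2 phi with respect to
   u are 4 Gf, 4 cf and 4 Df. *)
Definition Gf (m : R) : R := Ec m - (1 - m) * Kc m.
Definition cf (m : R) : R := 2 * Ec m - Kc m.
Definition Df (m : R) : R :=
  ((4 * m - 1) * Kc m + (4 - 8 * m) * Ec m) / 3.
Definition Wf (m : R) : R :=
  Ec m ^ 2 - 2 * (1 - m) * Ec m * Kc m + (1 - m) * Kc m ^ 2.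
Definition Qf (m : R) : R := (Kc m - 2 * Ec m) * Gf m.

Definition dGf (m : R) : R := Kc m / 2.
Definition dWf (m : R) : R :=
  let K' := Gf m / (2 * m * (1 - m)) in
  let E' := (Ec m - Kc m) / (2 * m) in
  2 * Ec m * E' + 2 * Ec m * Kc m - 2 * (1 - m) * (E' * Kc m + Ec m * K')
  - Kc m ^ 2 + 2 * (1 - m) * Kc m * K'.
Definition dQf (m : R) : R :=
  let K' := Gf m / (2 * m * (1 - m)) in
  let E' := (Ec m - Kc m) / (2 * m) in
  (K' - 2 * E') * Gf m + (Kc m - 2 * Ec m) * dGf m.

Lemma Kc_derivable m : 0 < m < 1 -> ex_derive Kc m.
Proof. intros H; eexists; now apply is_derive_Kc. Qed.

Lemma Ec_derivable m : 0 < m < 1 -> ex_derive Ec m.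
Proof. intros H; eexists; now apply is_derive_Ec. Qed.

Ltac derive_KE H :=
  auto_derive;
  [ repeat split; first [now apply Kc_derivable|now apply Ec_derivable]
  | rewrite ?(is_derive_unique (fun x : R => Kc x) _ _ (is_derive_Kc _ H)),
      ?(is_derive_unique (fun x : R => Ec x) _ _ (is_derive_Ec _ H)) ].

Lemma is_derive_Gf m : 0 < m < 1 -> is_derive Gf m (dGf m).
Proof.
  intros H; unfold Gf, dGf; derive_KE H; field; lra.
Qed.

Lemma is_derive_Wf m : 0 < m < 1 -> is_derive Wf m (dWf m).
Proof.
  intros H; unfold Wf, dWf; derive_KE H; unfold Gf; field; lra.
Qed.

Lemma is_derive_Qf m : 0 < m < 1 -> is_derive Qf m (dQf m).
Proof.
  intros H; unfold Qf, dQf, dGf, Gf; derive_KE H; field; lra.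
Qed.

Lemma Kc_ge m : 0 <= m < 1 -> PI / 2 <= Kc m.
Proof.
  intros H; pose proof PI_RGT_0.
  replace (PI / 2) with (RInt (fun _ => 1) 0 (PI / 2)) at 1
    by (rewrite RInt_const_R; toR; field).
  apply RInt_le; [lra|apply ex_RInt_cont; contD|apply ex_RInt_cont|].
  - intros; apply cont_inv_Dl; lra.
  - intros t _; now apply inv_Dl_ge.
Qed.

Lemma Kc_pos m : 0 <= m < 1 -> 1 < Kc m.
Proof. intros H; pose proof (Kc_ge m H); pose proof PI2_1; lra. Qed.

Lemma Ec_le m : 0 <= m < 1 -> Ec m <= 2.
Proof.
  intros H; pose proof PI_RGT_0; pose proof PI_4.
  apply Rle_trans with (PI / 2); [|lra].
  replace (PI / 2) with (RInt (fun _ => 1) 0 (PI / 2)) at 1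
    by (rewrite RInt_const_R; toR; field).
  apply RInt_le; [lra|apply ex_RInt_cont; contD|apply ex_RInt_cont; contD|].
  intros t _; apply Dl_le_1; lra.
Qed.

Lemma Ec_ge m : 0 <= m < 1 -> 1 <= Ec m.
Proof.
  intros H; pose proof PI_RGT_0.
  replace 1 with (RInt cos 0 (PI / 2)).
  - apply RInt_le; [lra|apply ex_RInt_cont; contD|apply ex_RInt_cont; contD|].
    intros t Ht; assert (0 < cos t) by (apply cos_gt_0; lra).
    rewrite <- (sqrt_pow2 (cos t)) by lra; apply sqrt_le_1_alt.
    rewrite cos2_sin2; pose proof (sin2_bound t); nra.
  - rewrite (RInt_of_derive sin cos), sin_PI2, sin_0; [toR; ring| |intros; apply cont_cos].
    intros; auto_derive; [easy|ring].
Qed.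

Lemma RInt_KE (k l m : R) : m < 1 ->
  RInt (fun t => k * / Dl m t + l * Dl m t) 0 (PI / 2) = k * Kc m + l * Ec m.
Proof.
  intros H; rewrite (RInt_plus_R (fun t => k * / Dl m t)), !RInt_scal_R;
    [easy|contD..].
Qed.

Lemma Gf_pos m : 0 < m < 1 -> 0 < Gf m.
Proof.
  intros H; pose proof PI_RGT_0.
  replace (Gf m) with (RInt (fun t => -(1 - m) * / Dl m t + 1 * Dl m t) 0 (PI / 2))
    by (rewrite RInt_KE by lra; unfold Gf; toR; ring).
  apply RInt_gt_0; [lra| |intros; contD; apply Dl_neq; lra].
  intros t Ht; pose proof (Dl_pos m t ltac:(lra)) as Hp.
  pose proof (Dl_sqr m t ltac:(lra)) as E.
  replace (- (1 - m) * / Dl m t + 1 * Dl m t)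
    with ((Dl m t ^ 2 - (1 - m)) / Dl m t) by (field; lra).
  apply Rdiv_lt_0_compat; [|easy]; rewrite E.
  replace (1 - m * sin t ^ 2 - (1 - m)) with (m * cos t ^ 2)
    by (rewrite cos2_sin2; ring).
  apply Rmult_lt_0_compat; [lra|apply pow_lt, cos_gt_0; lra].
Qed.

Lemma cf_half_nonneg m : 0 <= m <= 1 / 2 -> 0 <= cf m.
Proof.
  intros H; pose proof PI_RGT_0.
  replace (cf m) with (RInt (fun t => -1 * / Dl m t + 2 * Dl m t) 0 (PI / 2))
    by (rewrite RInt_KE by lra; unfold cf; toR; ring).
  apply RInt_ge_0; [lra|apply ex_RInt_cont; contD; apply Dl_neq; lra|].
  intros t Ht; pose proof (Dl_pos m t ltac:(lra)) as Hp.
  pose proof (Dl_sqr m t ltac:(lra)) as E.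
  replace (-1 * / Dl m t + 2 * Dl m t)
    with ((2 * Dl m t ^ 2 - 1) / Dl m t) by (field; lra).
  apply Rdiv_le_0_compat; [|easy]; rewrite E.
  pose proof (sin2_bound t); nra.
Qed.

(** Dl >= r gives K <= PI / (2 r), and PI <= 4. With m = 1 - r^2 this bounds (1 - m) K by 2 r, so
    that product tends to 0 as m tends to 1 although K diverges. *)
Lemma Kc_upper r : 0 < r < 1 -> r ^ 2 * Kc (1 - r ^ 2) <= 2 * r.
Proof.
  intros Hr; pose proof PI_RGT_0; pose proof PI_4.
  assert (HK : Kc (1 - r ^ 2) <= PI / 2 * / r).
  { replace (PI / 2 * / r) with (RInt (fun _ => / r) 0 (PI / 2))
      by (rewrite RInt_const_R; toR; field; lra).
    apply RInt_le; [lra|apply ex_RInt_cont|apply ex_RInt_cont; contD|].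
    - intros; apply cont_inv_Dl; nra.
    - intros t _; apply Rinv_le_contravar; [lra|].
      rewrite <- (sqrt_pow2 r) at 1 by lra; apply sqrt_le_1_alt.
      pose proof (sin2_bound t).
      assert (0 <= (1 - sin t ^ 2) * (1 - r ^ 2)) by (apply Rmult_le_pos; nra).
      lra. }
  apply Rle_trans with (r ^ 2 * (PI / 2 * / r)).
  - apply Rmult_le_compat_l; [nra|easy].
  - replace (r ^ 2 * (PI / 2 * / r)) with (r * (PI / 2)) by (field; lra).
    nra.
Qed.

(* sqrt (cos^2 + r^2 sin^2) <= cos t + r <= PI/2 - t + r *)
Lemma Kc_lower r : 0 < r < 1 -> - ln r <= Kc (1 - r ^ 2).
Proof.
  intros Hr; pose proof PI_RGT_0; pose proof PI2_1.
  apply Rle_trans with (ln (PI / 2 + r) - ln r).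
  - assert (ln 1 <= ln (PI / 2 + r)) by (apply ln_le; lra).
    rewrite ln_1 in *; lra.
  - assert (HI : is_RInt (fun t => / (PI / 2 - t + r)) 0 (PI / 2)
      (minus (- ln (PI / 2 - PI / 2 + r)) (- ln (PI / 2 - 0 + r)))).
    { apply (is_RInt_derive (fun t => - ln (PI / 2 - t + r))).
      - intros t Ht; rewrite Rmin_left, Rmax_right in Ht by lra.
        auto_derive; [lra|field; lra].
      - intros t Ht; rewrite Rmin_left, Rmax_right in Ht by lra.
        cont; lra. }
    replace (ln (PI / 2 + r) - ln r) with
      (RInt (fun t => / (PI / 2 - t + r)) 0 (PI / 2)).
    + apply RInt_le; [lra|eexists; exact HI|apply ex_RInt_cont|].
      * intros; apply cont_inv_Dl; nra.
      * intros t Ht; apply Rinv_le_contravar; [apply Dl_pos; nra|].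
        assert (Hc : 0 < cos t) by (apply cos_gt_0; lra).
        assert (Hc2 : cos t <= PI / 2 - t).
        { rewrite <- sin_shift; left; apply sin_lt_x; lra. }
        apply Rle_trans with (cos t + r); [|lra].
        rewrite <- (sqrt_pow2 (cos t + r)) by lra; apply sqrt_le_1_alt.
        replace ((cos t + r) ^ 2) with (cos t ^ 2 + 2 * cos t * r + r ^ 2)
          by ring.
        pose proof (sin2_bound t); pose proof (cos2_sin2 t).
        assert (0 <= 2 * cos t * r) by nra.
        assert (0 <= r ^ 2 * (1 - sin t ^ 2)) by (apply Rmult_le_pos; nra).
        lra.
    + rewrite (is_RInt_unique _ _ _ _ HI); unfold minus, plus, opp; simpl.
      replace (PI / 2 - PI / 2 + r) with r by ring.
      rewrite Rminus_0_r; ring.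
Qed.

Lemma Wf_pos m : 0 < m < 1 -> 0 < Wf m.
Proof.
  intros H; pose proof (Kc_pos m ltac:(lra)).
  replace (Wf m) with (Gf m ^ 2 + m * (1 - m) * Kc m ^ 2)
    by (unfold Wf, Gf; ring).
  assert (0 < m * (1 - m)) by nra.
  pose proof (pow2_ge_0 (Gf m)).
  assert (0 < m * (1 - m) * Kc m ^ 2)
    by (apply Rmult_lt_0_compat; [easy|apply pow_lt; lra]).
  lra.
Qed.

(* The derivative of Wf / Qf has the sign of Wf' Qf - Wf Qf'.  Once E is
   eliminated, its opposite is a sum of positive terms. *)
Lemma WQ_wronskian_neg m : 0 < m < 1 -> cf m < 0 ->
  dWf m * Qf m - Wf m * dQf m < 0.
Proof.
  intros H Hc.
  pose proof (Kc_pos m ltac:(lra)) as HK.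
  pose proof (Gf_pos m H) as Hg.
  set (K := Kc m) in *; set (a := K - 2 * Ec m); set (g := Gf m) in *.
  assert (Ha : 0 < a) by (unfold a, K, cf in *; lra).
  set (P := m * (1 - m)).
  assert (HP : 0 < P) by (unfold P; nra).
  replace (dWf m * Qf m - Wf m * dQf m) with
    (- (K * a ^ 2 * g + K * a * g ^ 2 + K ^ 3 * a * P / 2
        + g ^ 4 * (a + 2 * g) / (2 * P * K) + 2 * K * g ^ 3 + K ^ 3 * g * P)).
  - assert (0 < K * a ^ 2 * g) by pos.
    assert (0 < K * a * g ^ 2) by pos.
    assert (0 < K ^ 3 * a * P / 2) by pos.
    assert (0 < g ^ 4 * (a + 2 * g) / (2 * P * K)) by pos.
    assert (0 < 2 * K * g ^ 3) by pos.
    assert (0 < K ^ 3 * g * P) by pos.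
    lra.
  - unfold P, a, dWf, dQf, dGf, Qf, Wf, g, Gf, K in *; field; lra.
Qed.

(** The equation W / Q = kap with its denominator cleared: [Qf] changes sign on (0, 1), and this
    form stays differentiable there. *)
Definition Hf (kap m : R) : R := Wf m - kap * Qf m.

Lemma is_derive_Hf kap m : 0 < m < 1 ->
  is_derive (Hf kap) m (dWf m - kap * dQf m).
Proof.
  intros H; unfold Hf.
  apply (is_derive_minus Wf (fun m => kap * Qf m)); [now apply is_derive_Wf|].
  apply (is_derive_scal Qf); now apply is_derive_Qf.
Qed.

(** W > 0 forces Q > 0 at a zero, and Q = - cf G with G > 0. *)
Lemma Hf_zero_region kap m : 0 < kap -> 0 < m < 1 -> Hf kap m = 0 -> cf m < 0.
Proof.
  intros Hk H E.
  pose proof (Wf_pos m H); pose proof (Gf_pos m H).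
  unfold Hf, Qf in E; unfold cf.
  assert (0 < (Kc m - 2 * Ec m) * Gf m) by nra.
  destruct (Rle_or_lt (Kc m - 2 * Ec m) 0); [nra|lra].
Qed.

(** At a zero W = kap Q, so Q times the derivative of [Hf kap] is the Wronskian W' Q - W Q',
    negative by [WQ_wronskian_neg]. *)
Lemma Hf_zero_simple kap m : 0 < kap -> 0 < m < 1 -> Hf kap m = 0 ->
  dWf m - kap * dQf m < 0.
Proof.
  intros Hk H E; pose proof (Hf_zero_region kap m Hk H E) as Hc.
  pose proof (WQ_wronskian_neg m H Hc) as HW.
  assert (HQ : 0 < Qf m).
  { unfold Qf; apply Rmult_lt_0_compat; [unfold cf in Hc; lra|now apply Gf_pos]. }
  unfold Hf in E.
  replace (Wf m) with (kap * Qf m) in HW by lra.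
  apply (Rmult_lt_reg_r (Qf m)); [easy|]; lra.
Qed.

Lemma is_derive_cf m : 0 < m < 1 ->
  is_derive cf m ((Ec m - Kc m) / m - Gf m / (2 * m * (1 - m))).
Proof.
  intros H; unfold cf; derive_KE H; unfold Gf; field; lra.
Qed.

(** Monotonicity carries the sign cf < 0 from one zero of [Hf] to all larger m, so Q > 0 and the
    quotient W / Q makes sense between two zeros. *)
Lemma cf_decr m1 m2 : 0 < m1 < m2 -> m2 < 1 -> cf m2 < cf m1.
Proof.
  intros H1 H2.
  assert (- cf m1 < - cf m2); [|lra].
  apply (incr_of_derive_pos (fun m => - cf m)
    (fun m => - ((Ec m - Kc m) / m - Gf m / (2 * m * (1 - m))))); [lra| |].
  - intros m Hm; apply (is_derive_opp cf), is_derive_cf; lra.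
  - intros m Hm; pose proof (Gf_pos m ltac:(lra)).
    assert (Ec m <= Kc m).
    { unfold Ec, Kc; pose proof PI_RGT_0; apply RInt_le; [lra|apply ex_RInt_cont; contD| |].
      - apply ex_RInt_cont; intros; apply cont_inv_Dl; lra.
      - intros t _; apply Rle_trans with 1; [apply Dl_le_1|apply inv_Dl_ge]; lra. }
    assert (0 < Gf m / (2 * m * (1 - m))).
    { apply Rdiv_lt_0_compat; [easy|nra]. }
    assert ((Ec m - Kc m) / m <= 0).
    { apply Rle_div_l; lra. }
    lra.
Qed.

Lemma Hf_zero_unique kap m1 m2 : 0 < kap -> 0 < m1 < 1 -> 0 < m2 < 1 ->
  Hf kap m1 = 0 -> Hf kap m2 = 0 -> m1 = m2.
Proof.
  assert (HH : forall m1 m2, 0 < kap -> 0 < m1 -> m1 < m2 -> m2 < 1 ->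
    Hf kap m1 = 0 -> Hf kap m2 = 0 -> False).
  { clear m1 m2; intros m1 m2 Hk H1 H12 H2 E1 E2.
    pose proof (Hf_zero_region kap m1 Hk ltac:(lra) E1) as Hc1.
    assert (Hr : forall m, m1 <= m <= m2 -> cf m < 0 /\ 0 < Qf m).
    { intros m Hm; assert (Hc : cf m < 0).
      { destruct (Req_dec m m1) as [->|Hne]; [easy|].
        pose proof (cf_decr m1 m ltac:(lra) ltac:(lra)); lra. }
      split; [easy|]; unfold Qf; apply Rmult_lt_0_compat;
        [unfold cf in Hc; lra|apply Gf_pos; lra]. }
    (* W / Q would take the value [kap] at both zeros, against its negative derivative. *)
    destruct (MVT_R (fun m => Wf m / Qf m)
      (fun m => (dWf m * Qf m - Wf m * dQf m) / Qf m ^ 2) m1 m2) as [c [Hc E]].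
    - intros m Hm; rewrite Rmin_left, Rmax_right in Hm by lra.
      destruct (Hr m Hm).
      apply (is_derive_div Wf Qf); [apply is_derive_Wf; lra|apply is_derive_Qf; lra|lra].
    - rewrite Rmin_left, Rmax_right in Hc by lra; destruct (Hr c Hc) as [Hcc HQ].
      pose proof (WQ_wronskian_neg c ltac:(lra) Hcc) as HW.
      destruct (Hr m1 ltac:(lra)) as [_ Q1]; destruct (Hr m2 ltac:(lra)) as [_ Q2].
      unfold Hf in E1, E2.
      replace (Wf m1) with (kap * Qf m1) in E by lra.
      replace (Wf m2) with (kap * Qf m2) in E by lra.
      replace (kap * Qf m2 / Qf m2 - kap * Qf m1 / Qf m1) with 0 in E
        by (field; lra).
      assert (0 < - (dWf c * Qf c - Wf c * dQf c) / Qf c ^ 2 * (m2 - m1)).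
      { apply Rmult_lt_0_compat; [apply Rdiv_lt_0_compat; [lra|now apply pow_lt]|lra]. }
      unfold Rdiv in *; lra. }
  intros Hk H1 H2 E1 E2.
  destruct (Rtotal_order m1 m2) as [Hl|[He|Hg]]; [|easy|].
  - exfalso; apply (HH m1 m2); lra.
  - exfalso; apply (HH m2 m1); lra.
Qed.

(** At m = 1/2 one has Q <= 0, hence Hf > 0. Near m = 1 the logarithmic growth of K makes kap Q win
    over W, since E stays in [1, 2] and (1 - m) K tends to 0. *)
Lemma Hf_zero_exists kap : 0 < kap -> exists m, 0 < m < 1 /\ Hf kap m = 0.
Proof.
  intros Hk.
  (* With x = (1 - m) K: r <= 1/4 gives E - x >= 1/2, r <= kap / 16 gives x <= kap / 8, and the
     exponential gives K >= 16 / kap + 8. Then kap Q >= kap (K - 4) / 2 exceeds W <= 4 + kap K /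
     8. *)
  set (r := Rmin (Rmin (1 / 4) (kap / 16)) (exp (- (16 / kap + 8)))).
  assert (Hr1 : r <= 1 / 4) by (eapply Rle_trans; apply Rmin_l).
  assert (Hr2 : r <= kap / 16)
    by (eapply Rle_trans; [apply Rmin_l|apply Rmin_r]).
  assert (Hr3 : r <= exp (- (16 / kap + 8))) by apply Rmin_r.
  assert (Hr0 : 0 < r)
    by (repeat apply Rmin_pos; try lra; apply exp_pos).
  set (m := 1 - r ^ 2).
  assert (Hm : 3 / 4 <= m < 1) by (unfold m; nra).
  assert (HK : 16 / kap + 8 <= Kc m).
  { apply Rle_trans with (- ln r); [|apply Kc_lower; lra].
    assert (ln r <= ln (exp (- (16 / kap + 8)))) by (now apply ln_le).
    rewrite ln_exp in H; lra. }
  pose proof (Kc_upper r ltac:(lra)) as HU; fold m in HU.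
  assert (Hneg : Hf kap m <= 0).
  { pose proof (Ec_ge m ltac:(lra)); pose proof (Ec_le m ltac:(lra)).
    assert (Hx : (1 - m) * Kc m <= 2 * r)
      by (replace (1 - m) with (r ^ 2) by (unfold m; ring); exact HU).
    assert (HK0 : 0 < Kc m) by (apply Rlt_trans with 1; [lra|apply Kc_pos; lra]).
    assert (Hx0 : 0 <= (1 - m) * Kc m) by nra.
    assert (HkK : 16 + 8 * kap <= kap * Kc m).
    { apply Rle_trans with (kap * (16 / kap + 8)); [right; field; lra|].
      apply Rmult_le_compat_l; lra. }
    unfold Hf, Wf, Qf, Gf.
    set (x := (1 - m) * Kc m) in *.
    replace (2 * (1 - m) * Ec m * Kc m) with (2 * x * Ec m) by (unfold x; ring).
    replace ((1 - m) * Kc m ^ 2) with (x * Kc m) by (unfold x; ring).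
    assert (H1 : kap / 2 * (Kc m - 4) <= kap * ((Kc m - 2 * Ec m) * (Ec m - x))).
    { replace (kap / 2 * (Kc m - 4)) with (kap * ((Kc m - 4) * (1 / 2))) by field.
      assert (0 < 16 / kap) by (apply Rdiv_lt_0_compat; lra).
      mul_mono.
      apply Rmult_le_compat; lra. }
    assert (H2 : x * Kc m <= kap / 8 * Kc m) by (apply Rmult_le_compat_r; lra).
    assert (H3 : Ec m ^ 2 <= 4) by nra.
    assert (H4 : 0 <= 2 * x * Ec m) by nra.
    lra. }
  assert (Hpos : 0 <= Hf kap (1 / 2)).
  { pose proof (Wf_pos (1 / 2) ltac:(lra)); pose proof (Gf_pos (1 / 2) ltac:(lra)).
    pose proof (cf_half_nonneg (1 / 2) ltac:(lra)).
    unfold Hf, Qf; unfold cf in *.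
    assert (0 <= - (Kc (1 / 2) - 2 * Ec (1 / 2)) * Gf (1 / 2))
      by (apply Rmult_le_pos; lra).
    nra. }
  destruct (IVT_cont (fun x => - Hf kap x) (1 / 2) m) as [z [Hz E]]; [lra| |lra|].
  - intros x Hx; apply cont_opp.
    eapply cont_of_derive, is_derive_Hf; lra.
  - exists z; split; lra.
Qed.

(** * The amplitude function and the improper integrals in Legendre form *)

Lemma is_derive_ellipticF k theta : k ^ 2 < 1 ->
  is_derive (fun x => ellipticF x k) theta (/ Dl (k ^ 2) theta).
Proof.
  intros H; apply (is_derive_RInt_cont (fun x => / Dl (k ^ 2) x)).
  intros; now apply cont_inv_Dl.
Qed.

(** The integrand of [ellipticF] is at least 1, so [global_inverse] applies and the definite
    description in [am] denotes that inverse. Continuity is what the substitution along the orbit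
    asks for. *)
Lemma am_inverse k : k ^ 2 < 1 ->
  (forall theta, am (ellipticF theta k) k = theta) /\
  (forall u, continuous (fun u => am u k) u).
Proof.
  intros Hk; pose proof (pow2_ge_0 k).
  destruct (global_inverse (fun x => ellipticF x k) (fun x => / Dl (k ^ 2) x) 1)
    as [g [H1 [H2 H3]]].
  - lra.
  - intros; now apply is_derive_ellipticF.
  - intros; apply inv_Dl_ge; lra.
  - assert (E : forall u, am u k = g u).
    { intros u; apply (iota_unique (fun x : R => ellipticF x k = u));
        [intros x <-; symmetry; apply H2|apply H1]. }
    split; [intros; rewrite E; apply H2|intros u].
    apply (continuous_ext g); [intros; symmetry; apply E|].
    exact (cont_of_derive _ _ _ (H3 u)).
Qed.

Lemma is_derive_asin x : -1 < x < 1 -> is_derive asin x (/ sqrt (1 - x ^ 2)).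
Proof.
  intros H; apply is_derive_Reals.
  replace (/ sqrt (1 - x ^ 2)) with (1 / sqrt (1 - x²))
    by (unfold Rsqr; replace (1 - x ^ 2) with (1 - x * x) by ring; unfold Rdiv; ring).
  apply (derive_pt_eq_1 _ _ _ (derivable_pt_asin x H)), derive_pt_asin.
Qed.

Lemma asin_cont x : -1 < x < 1 -> continuous asin x.
Proof.
  intros H; exact (cont_of_derive _ _ _ (is_derive_asin x H)).
Qed.

(** The substitution t = sin x: on [0, b] with b < 1 the value is G (asin b) - G 0 by the
    fundamental theorem, and b is then sent to 1. *)
Lemma RInt_gen_asin (G g f : R -> R) :
  (forall x, is_derive G x (g x)) -> (forall x, continuous g x) ->
  (forall t, 0 <= t < 1 -> f t = g (asin t) * / sqrt (1 - t ^ 2)) ->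
  RInt_gen f (at_point 0) (at_left 1) = G (PI / 2) - G 0.
Proof.
  intros HG Hg Hf; apply is_RInt_gen_unique.
  apply (filterlimi_lim_ext_loc (fun ab : R * R => G (asin (snd ab)) - G 0)).
  - apply (Filter_prod _ _ _ (fun a => a = 0) (fun b => 0 <= b < 1)).
    + reflexivity.
    + exists (mkposreal 1 Rlt_0_1); intros b Hb Hb1; simpl in Hb.
      change (Rabs (b - 1) < 1) in Hb.
      apply Rabs_lt_between in Hb; lra.
    + intros a b -> Hb; simpl.
      apply (is_RInt_ext (fun t => g (asin t) * / sqrt (1 - t ^ 2))).
      { intros t Ht; rewrite Rmin_left, Rmax_right in Ht by lra.
        symmetry; apply Hf; lra. }
      replace (G (asin b) - G 0) with (minus (G (asin b)) (G (asin 0)))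
        by (rewrite asin_0; reflexivity).
      apply (is_RInt_derive (fun t => G (asin t))).
      * intros t Ht; rewrite Rmin_left, Rmax_right in Ht by lra.
        rewrite Rmult_comm.
        apply (is_derive_comp G asin); [apply HG|apply is_derive_asin; lra].
      * intros t Ht; rewrite Rmin_left, Rmax_right in Ht by lra.
        cont; [apply (continuous_comp asin g); [apply asin_cont; lra|apply Hg]|].
        apply Rgt_not_eq, sqrt_lt_R0; nra.
  - apply (filterlim_comp _ _ _ snd (fun b => G (asin b) - G 0) _ (at_left 1));
      [apply filterlim_snd|].
    apply (filterlim_comp _ _ _ asin (fun x => G x - G 0) _ (locally (PI / 2))).
    (* asin is not differentiable at 1; its left continuity there comes from the monotonicity of
       sin. The cap at 1 < PI / 2 keeps PI / 2 - d1 where sin increases. *)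
    + intros Q [d Hd]; pose proof PI2_1 as HP2.
      set (d1 := Rmin d 1).
      assert (Hd1 : 0 < d1 <= 1) by (split; [apply Rmin_pos; [apply d|lra]|apply Rmin_r]).
      assert (Hd2 : d1 <= d) by apply Rmin_l.
      assert (Hs : sin (PI / 2 - d1) < 1).
      { rewrite <- sin_PI2; apply sin_increasing_1; lra. }
      assert (Hs0 : 0 < 1 - sin (PI / 2 - d1)) by lra.
      assert (Hs1 : 0 <= sin (PI / 2 - d1)) by (apply sin_ge_0; lra).
      exists (mkposreal _ Hs0); intros b Hb Hb1.
      change (Rabs (b - 1) < 1 - sin (PI / 2 - d1)) in Hb.
      apply Rabs_lt_between in Hb.
      apply Hd; change (Rabs (asin b - PI / 2) < d).
      pose proof (asin_bound b) as Hab.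
      assert (PI / 2 - d1 < asin b).
      { apply Rnot_le_lt; intros Hle.
        assert (sin (asin b) <= sin (PI / 2 - d1)) by (apply sin_incr_1; lra).
        rewrite sin_asin in H by lra; lra. }
      apply Rabs_def1; lra.
    + apply (cont_minus G (fun _ => G 0)); [|apply cont_const].
      apply (cont_of_derive _ _ _ (HG _)).
Qed.

Lemma asin_radicand_pos m t : 0 <= m < 1 -> 0 <= t < 1 ->
  Dl m (asin t) = sqrt (1 - m * t ^ 2) /\ 0 < 1 - m * t ^ 2 /\ 0 < 1 - t ^ 2.
Proof.
  intros Hm Ht; split; [|split; nra].
  unfold Dl; rewrite sin_asin; [easy|lra].
Qed.

Lemma ellipticK_eq k : k ^ 2 < 1 -> ellipticK k = Kc (k ^ 2).
Proof.
  intros Hk; pose proof (pow2_ge_0 k) as Hk0.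
  unfold ellipticK.
  rewrite (RInt_gen_asin (fun x => ellipticF x k) (fun x => / Dl (k ^ 2) x)).
  - unfold ellipticF; rewrite RInt_point.
    unfold zero; simpl; rewrite Rminus_0_r; reflexivity.
  - intros; now apply is_derive_ellipticF.
  - intros; now apply cont_inv_Dl.
  - intros t Ht.
    destruct (asin_radicand_pos (k ^ 2) t ltac:(lra) Ht) as [-> [H1 H2]].
    rewrite sqrt_mult by lra.
    field; split; apply Rgt_not_eq, sqrt_lt_R0; lra.
Qed.

Lemma ellipticE_eq k : k ^ 2 < 1 -> ellipticE k = Ec (k ^ 2).
Proof.
  intros Hk; pose proof (pow2_ge_0 k) as Hk0.
  unfold ellipticE.
  rewrite (RInt_gen_asin (fun x => RInt (Dl (k ^ 2)) 0 x) (Dl (k ^ 2))).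
  - rewrite RInt_point; unfold zero; simpl; rewrite Rminus_0_r; reflexivity.
  - intros; apply is_derive_RInt_cont, cont_Dl.
  - intros; apply cont_Dl.
  - intros t Ht.
    destruct (asin_radicand_pos (k ^ 2) t ltac:(lra) Ht) as [-> [H1 H2]].
    rewrite sqrt_div by lra; easy.
Qed.

(** * The orbits L1 and the Melnikov integrals *)

Definition mm (A B : R) : R := (A + B) / (2 * B).

Lemma mm_bounds A B : Rabs A < B -> 0 < B /\ 0 < mm A B < 1.
Proof.
  intros H; apply Rabs_def2 in H; assert (HB : 0 < B) by lra.
  split; [easy|]; unfold mm; split.
  - apply Rdiv_lt_0_compat; lra.
  - apply Rlt_div_l; lra.
Qed.

Lemma k1_sqr A B : Rabs A < B -> k1 A B ^ 2 = mm A B.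
Proof.
  intros H; destruct (mm_bounds A B H) as [_ Hm].
  unfold k1; rewrite pow2_sqrt; [easy|unfold mm in Hm; lra].
Qed.

Lemma k1_sqr_lt A B : Rabs A < B -> k1 A B ^ 2 < 1.
Proof. intros H; rewrite k1_sqr by easy; apply (mm_bounds A B H). Qed.

Lemma period_eq A B : Rabs A < B -> period A B = 4 * Kc (mm A B) / sqrt B.
Proof.
  intros H; unfold period; rewrite ellipticK_eq, k1_sqr; auto using k1_sqr_lt.
Qed.

Lemma action_eq A B : Rabs A < B -> action A B = 16 * sqrt B * Gf (mm A B).
Proof.
  intros H; unfold action; rewrite ellipticK_eq, ellipticE_eq, k1_sqr;
    auto using k1_sqr_lt.
Qed.

(** Half the difference has sine 0 and lies strictly between -PI and PI. This gives the uniqueness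
    that the definite description in [phi1] rests on. *)
Lemma cos_sin_inj a b : - PI < a <= PI -> - PI < b <= PI ->
  cos a = cos b -> sin a = sin b -> a = b.
Proof.
  intros Ha Hb Hc Hs; pose proof PI_RGT_0.
  assert (E : cos (a - b) = 1).
  { rewrite cos_minus, Hc, Hs; pose proof (sin2_cos2 b); unfold Rsqr in *; lra. }
  assert (Es : sin ((a - b) / 2) = 0).
  { replace (a - b) with (2 * ((a - b) / 2)) in E by field.
    rewrite cos_2a_sin in E.
    assert (E2 : sin ((a - b) / 2) * sin ((a - b) / 2) = 0) by lra.
    apply Rmult_integral in E2; tauto. }
  destruct (Rtotal_order a b) as [Hl|[He|Hg]]; [|easy|].
  - assert (0 < sin (- ((a - b) / 2))) by (apply sin_gt_0; lra).
    rewrite sin_neg in *; lra.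
  - assert (0 < sin ((a - b) / 2)) by (apply sin_gt_0; lra); lra.
Qed.

Lemma cos_phi1 A B tau : Rabs A < B ->
  cos (phi1 A B tau) = 1 - 2 * mm A B * sin (am (sqrt B * tau) (k1 A B)) ^ 2.
Proof.
  intros H; destruct (mm_bounds A B H) as [HB Hm].
  set (u := am (sqrt B * tau) (k1 A B)).
  set (k := k1 A B).
  assert (Hk2 : k ^ 2 = mm A B) by now apply k1_sqr.
  set (x := k * sin u).
  assert (Hx2 : x ^ 2 = mm A B * sin u ^ 2)
    by (unfold x; rewrite <- Hk2; ring).
  assert (Hx : -1 < x < 1).
  { apply and_comm, (Rabs_def2 x 1); rewrite <- sqrt_Rsqr_abs; rewrite <- sqrt_1.
    apply sqrt_lt_1_alt; split; [apply Rle_0_sqr|].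
    pose proof (radicand_pos (mm A B) u ltac:(lra)); unfold Rsqr; lra. }
  pose proof (asin_bound_lt x Hx) as Hb.
  (* Half the polar angle has sine - k sn: by the duplication formulas cos phi = 1 - 2 k^2 sn^2 and
     sin phi = -2 k sn dn. Since |k sn| < 1 strictly, phi lies inside (-PI, PI). *)
  set (phi := - 2 * asin x).
  assert (Hcos : cos phi = 1 - 2 * mm A B * sin u ^ 2).
  { unfold phi; replace (-2 * asin x) with (- (2 * asin x)) by ring.
    rewrite cos_neg, cos_2a_sin, sin_asin by lra; lra. }
  assert (Hsin : B * sin phi = eta1 A B tau).
  { unfold phi; replace (-2 * asin x) with (- (2 * asin x)) by ring.
    rewrite sin_neg, sin_2a, sin_asin, cos_asin by lra.
    unfold eta1, dn, sn; fold u k.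
    replace (1 - x²) with (1 - k ^ 2 * sin u ^ 2) by (unfold Rsqr, x; ring).
    unfold x; ring. }
  assert (Hzeta : zeta1 A B tau = B * cos phi).
  { unfold zeta1, sn; fold u k; rewrite Hcos, Hk2; ring. }
  assert (E : phi1 A B tau = phi).
  { apply (iota_unique (fun p : R => - PI < p <= PI /\
      zeta1 A B tau = B * cos p /\ eta1 A B tau = B * sin p)).
    - intros p [Hp [Ec Es]].
      apply cos_sin_inj; [exact Hp|unfold phi; lra| |].
      + apply (Rmult_eq_reg_l B); lra.
      + apply (Rmult_eq_reg_l B); lra.
    - repeat split; try easy; unfold phi; lra. }
  now rewrite E, Hcos.
Qed.

Lemma sqrt_neq B : 0 < B -> sqrt B <> 0.
Proof. intros H; now apply Rgt_not_eq, sqrt_lt_R0. Qed.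

(** Substituting tau = F(x) / sqrt B, whose inverse is the amplitude, removes the elliptic
    functions: x runs over [0, 2 PI] and dtau becomes dx / (sqrt B Dl). *)
Lemma RInt_orbit (g : R -> R) A B : Rabs A < B -> (forall x, continuous g x) ->
  RInt (fun tau => g (am (sqrt B * tau) (k1 A B))) 0 (period A B)
  = RInt (fun x => g x * / (sqrt B * Dl (mm A B) x)) 0 (2 * PI).
Proof.
  intros H Hg; destruct (mm_bounds A B H) as [HB Hm].
  pose proof (sqrt_neq B HB) as HsB.
  pose proof (k1_sqr_lt A B H) as Hk.
  set (h := fun x => ellipticF x (k1 A B) / sqrt B).
  assert (Ham : forall x, am (sqrt B * h x) (k1 A B) = x).
  { intros x; unfold h.
    replace (sqrt B * (ellipticF x (k1 A B) / sqrt B)) with (ellipticF x (k1 A B))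
      by (field; exact HsB).
    now apply am_inverse. }
  assert (E0 : h 0 = 0).
  { unfold h, ellipticF; rewrite RInt_point; unfold zero; simpl; field; exact HsB. }
  assert (E1 : h (2 * PI) = period A B).
  { rewrite period_eq by easy; unfold h; f_equal.
    rewrite <- RInt_inv_Dl_period by lra.
    rewrite <- (k1_sqr A B H); reflexivity. }
  transitivity (RInt (fun tau => g (am (sqrt B * tau) (k1 A B))) (h 0) (h (2 * PI)));
    [now rewrite E0, E1|].
  rewrite <- (RInt_comp (fun tau => g (am (sqrt B * tau) (k1 A B))) h
    (fun x => / Dl (mm A B) x * / sqrt B) 0 (2 * PI)).
  - apply RInt_ext_R; intros x; unfold scal; simpl; unfold mult; simpl.
    rewrite Ham; field; split; [apply Dl_neq; lra|exact HsB].
  - intros x _; apply (continuous_comp (fun tau => am (sqrt B * tau) (k1 A B)) g);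
      [|apply Hg].
    apply (continuous_comp (fun tau => sqrt B * tau) (fun u => am u (k1 A B))).
    + cont.
    + now apply am_inverse.
  - intros x _; split.
    + unfold h, Rdiv; rewrite Rmult_comm.
      apply (is_derive_ext (fun y => / sqrt B * ellipticF y (k1 A B)));
        [intros; toR; ring|].
      apply (is_derive_scal (fun y => ellipticF y (k1 A B))).
      rewrite <- (k1_sqr A B H); now apply is_derive_ellipticF.
    + apply cont_mult; [apply cont_inv_Dl; lra|apply cont_const].
Qed.

Definition Mtc (sigma beta m B : R) : R :=
  4 / sqrt B * (B * (beta * cf m - 4 * sigma * Gf m) + beta * sigma * Kc m).

Definition M3c (sigma beta m B : R) : R :=
  - (4 / sqrt B) * (B * (Kc m + (beta - 1) * Df m) + sigma * beta * cf m).

(** [Dl] has period PI while cos changes sign, so terms linear in xi integrate to zero; this is how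
    [s] leaves [Mt1] and xi leaves [M4]. *)
Lemma RInt_cos_Dl m : m < 1 ->
  RInt (fun t => cos t * / Dl m t) 0 (2 * PI) = 0.
Proof.
  intros H; apply RInt_period_antisymmetric.
  - contD.
  - intros t; rewrite Dl_add, neg_cos; ring.
Qed.

(** [kappa] carries s, chi0 and the amplitude of xi, and drops out of the value. The rest reduces to
    Dl and 1 / Dl through m cos^2 = Dl^2 - (1 - m) and 1 - 2 m sin^2 = 2 Dl^2 - 1. *)
Lemma RInt_energy (sigma beta kappa m B : R) : 0 < B -> m < 1 ->
  RInt (fun t => (- sigma * (4 * m * B * cos t ^ 2) + kappa * cos t
    + B * beta * (1 - 2 * m * sin t ^ 2) + beta * sigma)
    * / (sqrt B * Dl m t)) 0 (2 * PI) = Mtc sigma beta m B.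
Proof.
  intros HB Hm; pose proof (sqrt_neq B HB) as HsB.
  rewrite (RInt_ext_R _ (fun t =>
    (4 * sigma * B * (1 - m) - B * beta + beta * sigma) / sqrt B * / Dl m t
    + (2 * B * beta - 4 * sigma * B) / sqrt B * Dl m t
    + kappa / sqrt B * (cos t * / Dl m t))).
  - rewrite (RInt_lin3 (fun t => / Dl m t) (Dl m) (fun t => cos t * / Dl m t)),
      RInt_cos_Dl, RInt_Dl_period, RInt_inv_Dl_period by contD.
    unfold Mtc, cf, Gf; toR; field; exact HsB.
  - intros t; pose proof (Dl_neq m t Hm) as HD; pose proof (Dl_sqr m t Hm) as E.
    replace (4 * m * B * cos t ^ 2) with (4 * B * (Dl m t ^ 2 - (1 - m)))
      by (rewrite E, cos2_sin2; ring).
    replace (1 - 2 * m * sin t ^ 2) with (2 * Dl m t ^ 2 - 1) by (rewrite E; ring).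
    field; split; assumption.
Qed.

(** The square (2 Dl^2 - 1)^2 brings in Dl^3, which [RInt_Dl3] removes. *)
Lemma RInt_Casimir (sigma beta m B : R) : 0 < B -> m < 1 ->
  RInt (fun t => (B + (beta - 1) * B * (1 - 2 * m * sin t ^ 2) ^ 2
    + sigma * beta * (1 - 2 * m * sin t ^ 2)) * / (sqrt B * Dl m t)) 0 (2 * PI)
  = - M3c sigma beta m B.
Proof.
  intros HB Hm; pose proof (sqrt_neq B HB) as HsB.
  rewrite (RInt_ext_R _ (fun t =>
    (B + (beta - 1) * B - sigma * beta) / sqrt B * / Dl m t
    + (2 * sigma * beta - 4 * (beta - 1) * B) / sqrt B * Dl m t
    + 4 * (beta - 1) * B / sqrt B * Dl m t ^ 3)).
  - rewrite (RInt_lin3 (fun t => / Dl m t) (Dl m) (fun t => Dl m t ^ 3)) by contD.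
    pose proof (RInt_Dl3 m Hm) as E3.
    rewrite RInt_Dl_period, RInt_inv_Dl_period in * by exact Hm.
    replace (RInt (fun t => Dl m t ^ 3) 0 (2 * PI)) with
      ((2 * (2 - m) * (4 * Ec m) - (1 - m) * (4 * Kc m)) / 3) by lra.
    unfold M3c, Df, cf; toR; field; exact HsB.
  - intros t; pose proof (Dl_neq m t Hm) as HD; pose proof (Dl_sqr m t Hm) as E.
    replace (1 - 2 * m * sin t ^ 2) with (2 * Dl m t ^ 2 - 1) by (rewrite E; ring).
    field; split; assumption.
Qed.

Lemma RInt_chi (sigma kappa chi m B : R) : 0 < B -> m < 1 ->
  RInt (fun t => (kappa * cos t + sigma * chi) * / (sqrt B * Dl m t)) 0 (2 * PI)
  = sigma * chi * (4 * Kc m / sqrt B).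
Proof.
  intros HB Hm; pose proof (sqrt_neq B HB) as HsB.
  rewrite (RInt_ext_R _ (fun t => sigma * chi / sqrt B * / Dl m t
    + 0 * Dl m t + kappa / sqrt B * (cos t * / Dl m t))).
  - rewrite (RInt_lin3 (fun t => / Dl m t) (Dl m) (fun t => cos t * / Dl m t)),
      RInt_cos_Dl, RInt_Dl_period, RInt_inv_Dl_period by contD.
    toR; field; exact HsB.
  - intros t; pose proof (Dl_neq m t Hm) as HD; field; split; assumption.
Qed.

Lemma xi1_sqr A B x : Rabs A < B ->
  (2 * k1 A B * sqrt B * cos x) ^ 2 = 4 * mm A B * B * cos x ^ 2.
Proof.
  intros H; destruct (mm_bounds A B H) as [HB _].
  rewrite <- (k1_sqr A B H).
  replace B with (sqrt B * sqrt B) at 4 by (apply sqrt_sqrt; lra); ring.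
Qed.

Lemma Mt1_eq sigma beta s A B chi : Rabs A < B ->
  Mt1 sigma beta s A B chi = Mtc sigma beta (mm A B) B.
Proof.
  intros H; destruct (mm_bounds A B H) as [HB Hm].
  rewrite <- (RInt_energy sigma beta (s * (2 * k1 A B * sqrt B) * chi)) by lra.
  rewrite <- (RInt_orbit (fun x => - sigma * (4 * mm A B * B * cos x ^ 2)
    + s * (2 * k1 A B * sqrt B) * chi * cos x
    + B * beta * (1 - 2 * mm A B * sin x ^ 2) + beta * sigma)) by (intros; cont; auto).
  apply RInt_ext_R; intros tau; unfold xi1, cn.
  rewrite cos_phi1, xi1_sqr by exact H; ring.
Qed.

Lemma lorenz_Mt1_eq sigma beta A B : Rabs A < B ->
  lorenz_Mt1 sigma beta A B = Mtc sigma beta (mm A B) B.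
Proof.
  intros H; rewrite <- (Mt1_eq sigma beta 0 A B 0 H).
  apply RInt_ext_R; intros tau; ring.
Qed.

Lemma M3_eq sigma beta A B : Rabs A < B ->
  M3 sigma beta A B = M3c sigma beta (mm A B) B.
Proof.
  intros H; destruct (mm_bounds A B H) as [HB Hm].
  unfold M3; rewrite <- (Ropp_involutive (M3c _ _ _ _)); f_equal.
  rewrite <- RInt_Casimir by lra.
  rewrite <- (RInt_orbit (fun x => B + (beta - 1) * B * (1 - 2 * mm A B * sin x ^ 2) ^ 2
    + sigma * beta * (1 - 2 * mm A B * sin x ^ 2))) by (intros; cont; auto).
  apply RInt_ext_R; intros tau; now rewrite cos_phi1.
Qed.

Lemma M4_eq sigma A B chi : Rabs A < B ->
  M4 sigma A B chi = - (sigma * chi * (4 * Kc (mm A B) / sqrt B)).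
Proof.
  intros H; destruct (mm_bounds A B H) as [HB Hm].
  rewrite <- (RInt_chi sigma (2 * k1 A B * sqrt B)) by lra.
  rewrite <- (RInt_orbit (fun x => 2 * k1 A B * sqrt B * cos x + sigma * chi))
    by (intros; cont; auto).
  reflexivity.
Qed.

Lemma locally_gt (x a : R) : a < x -> locally x (fun y => a < y).
Proof. apply (open_gt a x). Qed.

Lemma locally_lt (x b : R) : x < b -> locally x (fun y => y < b).
Proof. apply (open_lt b x). Qed.

Lemma locally_between (x a b : R) : a < x < b -> locally x (fun y => a < y < b).
Proof.
  intros H; apply (filter_and (fun y => a < y) (fun y => y < b));
    [now apply locally_gt|now apply locally_lt].
Qed.

Lemma locally_preimage (f : R -> R) (x : R) (Q : R -> Prop) :
  continuous f x -> locally (f x) Q -> locally x (fun y => Q (f y)).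
Proof. intros Hf HQ; exact (Hf Q HQ). Qed.

Definition Tc (m B : R) : R := 4 * Kc m / sqrt B.
(** The derivative of the action in B at fixed A, obtained with dm/dB = - A / (2 B^2) and A / B = 2
    m - 1. *)
Definition IBc (m B : R) : R := (8 * Gf m - 4 * (2 * m - 1) * Kc m) / sqrt B.

Lemma Rabs_lt_iff A B : Rabs A < B <-> - B < A < B.
Proof.
  split; intros H; [apply Rabs_def2 in H; lra|apply Rabs_def1; lra].
Qed.

(** The identity dG/dm = K / 2 is what turns the derivative of the action into the period. *)
Lemma is_derive_action_A A B : Rabs A < B ->
  is_derive (fun a => action a B) A (period A B).
Proof.
  intros H; destruct (mm_bounds A B H) as [HB Hm].
  apply (is_derive_ext_loc (fun a => 16 * sqrt B * Gf (mm a B))).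
  - apply (filter_imp (fun a => - B < a < B)).
    + intros a Ha; symmetry; apply action_eq, Rabs_lt_iff; exact Ha.
    + apply locally_between, Rabs_lt_iff; exact H.
  - rewrite period_eq by exact H.
    replace (4 * Kc (mm A B) / sqrt B) with
      (16 * sqrt B * (/ (2 * B) * dGf (mm A B))).
    + apply (is_derive_scal (fun a => Gf (mm a B))).
      apply (is_derive_comp Gf (fun a => mm a B)); [now apply is_derive_Gf|].
      unfold mm; auto_derive; [easy|field; lra].
    + unfold dGf; pose proof (sqrt_neq B HB).
      replace B with (sqrt B * sqrt B) at 2 by (apply sqrt_sqrt; lra).
      field; assumption.
Qed.

Lemma is_derive_action_B A B : Rabs A < B ->
  is_derive (fun b => action A b) B (IBc (mm A B) B).
Proof.
  intros H; destruct (mm_bounds A B H) as [HB Hm].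
  apply (is_derive_ext_loc (fun b => 16 * sqrt b * Gf (mm A b))).
  - apply (filter_imp (fun b => Rabs A < b)); [|now apply locally_gt].
    intros b Hb; symmetry; now apply action_eq.
  - pose proof (sqrt_neq B HB) as Hs.
    assert (HG : is_derive (fun b => Gf (mm A b)) B (- A / (2 * B ^ 2) * dGf (mm A B))).
    { apply (is_derive_comp Gf (fun b => mm A b)); [now apply is_derive_Gf|].
      unfold mm; auto_derive; [lra|field; lra]. }
    assert (Hgen : forall (g : R -> R) l, is_derive g B l ->
      is_derive (fun b => 16 * sqrt b * g b) B (8 / sqrt B * g B + 16 * sqrt B * l)).
    { intros g l Hg; auto_derive; [repeat split; [exact HB|now exists l]|].
      rewrite (is_derive_unique (fun b : R => g b) _ _ Hg); field; exact Hs. }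
    replace (IBc (mm A B) B) with
      (8 / sqrt B * Gf (mm A B) + 16 * sqrt B * (- A / (2 * B ^ 2) * dGf (mm A B))).
    + exact (Hgen _ _ HG).
    + unfold IBc, dGf; set (K := Kc (mm A B)); set (G := Gf (mm A B)).
      replace (2 * mm A B - 1) with (A / B) by (unfold mm; field; lra).
      clearbody K G.
      assert (E : B = sqrt B * sqrt B) by (symmetry; apply sqrt_sqrt; lra).
      set (b := sqrt B) in *; rewrite E; field; exact Hs.
Qed.

Lemma Omega_eq A B : Rabs A < B -> / Omega A B = Tc (mm A B) B.
Proof.
  intros H; unfold Omega.
  rewrite (is_derive_unique (fun a : R => action a B) _ _ (is_derive_action_A A B H)), Rinv_inv.
  now apply period_eq.
Qed.

Lemma M1_eq sigma beta s A B chi : Rabs A < B ->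
  M1 sigma beta s A B chi
  = Tc (mm A B) B * Mtc sigma beta (mm A B) B
    + IBc (mm A B) B * M3c sigma beta (mm A B) B.
Proof.
  intros H; unfold M1.
  rewrite Omega_eq, Mt1_eq, M3_eq by exact H.
  now rewrite (is_derive_unique (fun b : R => action A b) _ _ (is_derive_action_B A B H)).
Qed.

Lemma Tc_pos m B : 0 < m < 1 -> 0 < B -> 0 < Tc m B.
Proof.
  intros Hm HB; pose proof (Kc_pos m ltac:(lra)).
  apply Rdiv_lt_0_compat; [lra|now apply sqrt_lt_R0].
Qed.

Lemma M4_zero_iff sigma A B chi : 0 < sigma -> Rabs A < B ->
  M4 sigma A B chi = 0 <-> chi = 0.
Proof.
  intros Hs H; destruct (mm_bounds A B H) as [HB Hm].
  pose proof (Tc_pos _ _ Hm HB) as HT.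
  rewrite M4_eq by exact H; fold (Tc (mm A B) B); split; intros E.
  - assert (E2 : chi * (sigma * Tc (mm A B) B) = 0) by lra.
    apply Rmult_integral in E2; destruct E2 as [E2|E2]; [easy|].
    assert (0 < sigma * Tc (mm A B) B) by now apply Rmult_lt_0_compat.
    lra.
  - rewrite E; ring.
Qed.

(** The system is triangular: once [M3] vanishes, [M1] is the positive period times [Mt1]. *)
Lemma melnikov_zero_iff sigma beta s A B chi : 0 < sigma -> Rabs A < B ->
  melnikov sigma beta s A B chi = (0, 0, 0) <->
  chi = 0 /\ Mt1 sigma beta s A B chi = 0 /\ M3 sigma beta A B = 0.
Proof.
  intros Hs H; destruct (mm_bounds A B H) as [HB Hm].
  pose proof (Tc_pos _ _ Hm HB) as HT.
  unfold melnikov; rewrite M1_eq, Mt1_eq, M3_eq by exact H.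
  rewrite <- (M4_zero_iff sigma A B chi Hs H).
  set (x := Mtc sigma beta (mm A B) B); set (y := M3c sigma beta (mm A B) B).
  split.
  - intros E; injection E as E1 E3 E4.
    rewrite E3, Rmult_0_r, Rplus_0_r in E1.
    apply Rmult_integral in E1; repeat split; try assumption.
    destruct E1; lra.
  - intros [E4 [E1 E3]]; rewrite E1, E3, E4.
    f_equal; f_equal; ring.
Qed.

(** * The zero set *)

Section ZeroSet.

Variables sigma beta : R.
Hypothesis Hsigma : 0 < sigma.
Hypothesis Hbeta : 0 < beta.
Hypothesis Hlambda : (sigma + 1) / (beta + 2) > 2 / 3.

(** At fixed m both Melnikov integrals are, up to a nonzero factor, affine in B: B u + v and B p +
    q. They can share a root B only where the resultant u q - v p vanishes. *)
Definition uf (m : R) : R := beta * cf m - 4 * sigma * Gf m.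
Definition vf (m : R) : R := beta * sigma * Kc m.
Definition pf (m : R) : R := Kc m + (beta - 1) * Df m.
Definition qf (m : R) : R := sigma * beta * cf m.

Definition kap : R := 3 * ((sigma + 1) / (beta + 2)) - 2.

Lemma kap_gt0 : 0 < kap.
Proof. unfold kap; lra. Qed.

Lemma Mtc_uv m B : Mtc sigma beta m B = 4 / sqrt B * (B * uf m + vf m).
Proof. reflexivity. Qed.

Lemma M3c_pq m B : M3c sigma beta m B = - (4 / sqrt B) * (B * pf m + qf m).
Proof. reflexivity. Qed.

(* Both sides are quadratic forms in (Kc, Ec); that sigma and beta enter only
   through (sigma + 1, beta + 2) reflects the identity
   K (K - D) - 4 c G = 2 (K D - c^2). *)
Lemma resultant_eq m :
  uf m * qf m - vf m * pf m
  = - (sigma * beta * (4 / 3) * (beta + 2)) * Hf kap m.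
Proof.
  unfold uf, qf, vf, pf, Hf, kap, cf, Df, Wf, Qf, Gf; field; lra.
Qed.

(** For sigma = 0 and B = 1 the integral in [M3] equals 4 [pf]. Its integrand is (1 - X) + beta X
    over Dl with X = cos^2 phi in [0, 1], hence positive. So M3 = 0 can be solved for B. *)
Lemma pf_pos m : 0 < m < 1 -> 0 < pf m.
Proof.
  intros Hm; pose proof PI_RGT_0.
  pose proof (RInt_Casimir 0 beta m 1 Rlt_0_1 ltac:(lra)) as E.
  unfold M3c in E; rewrite sqrt_1 in E; fold (pf m) in E.
  assert (Hp : 0 < RInt (fun t => (1 + (beta - 1) * 1 * (1 - 2 * m * sin t ^ 2) ^ 2
    + 0 * beta * (1 - 2 * m * sin t ^ 2)) * / (1 * Dl m t)) 0 (2 * PI)).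
  { apply RInt_gt_0; [lra| |].
    - intros t _; pose proof (Dl_pos m t ltac:(lra)).
      apply Rmult_lt_0_compat; [|apply Rinv_0_lt_compat; lra].
      pose proof (sin2_bound t) as Hs; set (S := sin t ^ 2) in *.
      assert (HmS : 0 <= m * S <= m).
      { split; [apply Rmult_le_pos; lra|].
        assert (m * S <= m * 1) by (apply Rmult_le_compat_l; lra); lra. }
      set (X := (1 - 2 * m * S) ^ 2).
      assert (HX : 0 <= X) by apply pow2_ge_0.
      assert (HX1 : X <= 1).
      { assert (0 <= m * S * (1 - m * S)) by (apply Rmult_le_pos; lra).
        unfold X; replace ((1 - 2 * m * S) ^ 2) with (1 - 4 * (m * S * (1 - m * S)))
          by ring; lra. }
      assert (0 <= beta * X) by (apply Rmult_le_pos; lra).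
      destruct (Rle_lt_or_eq_dec _ _ HX1) as [Hl|He]; [lra|].
      rewrite He in *; lra.
    - intros; contD; pose proof (Dl_neq m x ltac:(lra)); lra. }
  lra.
Qed.

Lemma zeros_iff m B : 0 < m < 1 -> 0 < B ->
  Mtc sigma beta m B = 0 /\ M3c sigma beta m B = 0 <->
  Hf kap m = 0 /\ B = - qf m / pf m.
Proof.
  intros Hm HB; rewrite Mtc_uv, M3c_pq.
  pose proof (sqrt_neq B HB) as Hs; pose proof (pf_pos m Hm) as Hp.
  assert (Hs4 : 4 / sqrt B <> 0).
  { apply Rgt_not_eq, Rdiv_lt_0_compat; [lra|now apply sqrt_lt_R0]. }
  pose proof (resultant_eq m) as HR.
  assert (Hsb : 0 < sigma * beta) by now apply Rmult_lt_0_compat.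
  assert (Hk : sigma * beta * (4 / 3) * (beta + 2) <> 0)
    by (apply Rgt_not_eq; repeat apply Rmult_lt_0_compat; lra).
  split.
  - intros [E1 E2].
    apply Rmult_integral in E1; destruct E1 as [E1|E1]; [easy|].
    apply Rmult_integral in E2; destruct E2 as [E2|E2]; [lra|].
    split; [|apply (Rmult_eq_reg_r (pf m)); [field_simplify; lra|lra]].
    replace (qf m) with (- (B * pf m)) in HR by lra.
    replace (vf m) with (- (B * uf m)) in HR by lra.
    apply (Rmult_eq_reg_l (- (sigma * beta * (4 / 3) * (beta + 2)))); lra.
  - intros [E1 E2].
    assert (EB : B * pf m = - qf m) by (rewrite E2; field; lra).
    split; apply Rmult_eq_0_compat_l; [|lra].
    apply (Rmult_eq_reg_l (pf m)); [|lra].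
    rewrite E1, Rmult_0_r in HR.
    replace (qf m) with (- (B * pf m)) in HR by lra; lra.
Qed.

Lemma zero_exists_unique :
  exists A B, (Rabs A < B /\ Mtc sigma beta (mm A B) B = 0 /\
               M3c sigma beta (mm A B) B = 0) /\
    forall A' B', Rabs A' < B' -> Mtc sigma beta (mm A' B') B' = 0 ->
      M3c sigma beta (mm A' B') B' = 0 -> A' = A /\ B' = B.
Proof.
  destruct (Hf_zero_exists kap kap_gt0) as [m [Hm E]].
  pose proof (Hf_zero_region kap m kap_gt0 Hm E) as Hc.
  pose proof (pf_pos m Hm) as Hp.
  (* This root is positive: q has the sign of cf, which is negative at a zero of [Hf]. *)
  set (B := - qf m / pf m).
  assert (HB : 0 < B).
  { apply Rdiv_lt_0_compat; [|exact Hp].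
    assert (0 < sigma * beta) by now apply Rmult_lt_0_compat.
    unfold qf; nra. }
  assert (Emm : mm (B * (2 * m - 1)) B = m) by (unfold mm; field; lra).
  exists (B * (2 * m - 1)), B; rewrite Emm; split.
  - split; [apply Rabs_lt_iff; nra|].
    now apply zeros_iff.
  - intros A' B' HAB E1 E2; destruct (mm_bounds A' B' HAB) as [HB' Hm'].
    destruct (proj1 (zeros_iff _ _ Hm' HB') (conj E1 E2)) as [E3 E4].
    assert (Em : mm A' B' = m)
      by exact (Hf_zero_unique kap _ _ kap_gt0 Hm' Hm E3 E).
    rewrite Em in E4; fold B in E4; split; [|exact E4].
    rewrite <- Em, <- E4; unfold mm; field; lra.
Qed.

Lemma ex_derive_cf m : 0 < m < 1 -> ex_derive cf m.
Proof. intros H; eexists; now apply is_derive_cf. Qed.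

Lemma ex_derive_Gf m : 0 < m < 1 -> ex_derive Gf m.
Proof. intros H; eexists; now apply is_derive_Gf. Qed.

Lemma ex_derive_uf m : 0 < m < 1 -> ex_derive uf m.
Proof.
  intros H; unfold uf; auto_derive; repeat split;
    [now apply ex_derive_cf|now apply ex_derive_Gf].
Qed.

Lemma ex_derive_vf m : 0 < m < 1 -> ex_derive vf m.
Proof. intros H; unfold vf; auto_derive; now apply Kc_derivable. Qed.

Lemma ex_derive_pf m : 0 < m < 1 -> ex_derive pf m.
Proof.
  intros H; unfold pf, Df; auto_derive; repeat split;
    first [now apply Kc_derivable|now apply Ec_derivable].
Qed.

Lemma ex_derive_qf m : 0 < m < 1 -> ex_derive qf m.
Proof. intros H; unfold qf; auto_derive; now apply ex_derive_cf. Qed.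

Definition dMt (m B m' B' : R) : R :=
  4 / sqrt B * ((B * Derive uf m + Derive vf m) * m' + uf m * B').

Definition dM3 (m B m' B' : R) : R :=
  - (4 / sqrt B) * ((B * Derive pf m + Derive qf m) * m' + pf m * B').

(* (m', B') is the velocity of a curve through the zero, where the variation of
   the prefactor 4 / sqrt B does not contribute. *)
Lemma dMt_dM3_independent m B m1 B1 m2 B2 : 0 < m < 1 -> 0 < B ->
  Mtc sigma beta m B = 0 -> M3c sigma beta m B = 0 ->
  m1 * B2 - m2 * B1 <> 0 ->
  dMt m B m1 B1 * dM3 m B m2 B2 - dMt m B m2 B2 * dM3 m B m1 B1 <> 0.
Proof.
  intros Hm HB E1 E2 Hv.
  pose proof (sqrt_neq B HB) as Hs; pose proof (pf_pos m Hm) as Hp.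
  destruct (proj1 (zeros_iff m B Hm HB) (conj E1 E2)) as [EH EB].
  assert (EBp : qf m = - (B * pf m)) by (rewrite EB; field; lra).
  assert (EBu : vf m = - (B * uf m)).
  { rewrite Mtc_uv in E1; apply Rmult_integral in E1; destruct E1 as [E1|E1]; [|lra].
    exfalso; assert (0 < 4 / sqrt B)
      by (apply Rdiv_lt_0_compat; [lra|now apply sqrt_lt_R0]); lra. }
  assert (Hsb : 0 < sigma * beta) by now apply Rmult_lt_0_compat.
  set (N := sigma * beta * (4 / 3) * (beta + 2)).
  assert (HN : 0 < N) by (unfold N; repeat apply Rmult_lt_0_compat; lra).
  (* The derivative of the resultant u q - v p, computed by the product rule and through [Hf]. With
     v = - B u and q = - B p it is, up to a nonzero factor, the coefficient of m1 B2 - m2 B1 in the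
     determinant. *)
  assert (HD : Derive uf m * qf m + uf m * Derive qf m
    - (Derive vf m * pf m + vf m * Derive pf m)
    = - N * (dWf m - kap * dQf m)).
  { assert (D1 : is_derive (fun m => uf m * qf m - vf m * pf m) m
      (Derive uf m * qf m + uf m * Derive qf m
       - (Derive vf m * pf m + vf m * Derive pf m))).
    { apply (is_derive_minus (fun m => uf m * qf m) (fun m => vf m * pf m));
      [apply (is_derive_mult uf qf)|apply (is_derive_mult vf pf)];
      try (intros; apply Rmult_comm); apply Derive_correct.
      - now apply ex_derive_uf.
      - now apply ex_derive_qf.
      - now apply ex_derive_vf.
      - now apply ex_derive_pf. }
    assert (D2 : is_derive (fun m => uf m * qf m - vf m * pf m) m
      (- N * (dWf m - kap * dQf m))).
    { apply (is_derive_ext (fun m => - N * Hf kap m));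
        [intros t; symmetry; apply resultant_eq|].
      apply (is_derive_scal (Hf kap)), is_derive_Hf; exact Hm. }
    rewrite <- (is_derive_unique _ _ _ D1); exact (is_derive_unique _ _ _ D2). }
  pose proof (Hf_zero_simple kap m kap_gt0 Hm EH) as Hsimple.
  rewrite EBp, EBu in HD.
  assert (HD2 : dMt m B m1 B1 * dM3 m B m2 B2 - dMt m B m2 B2 * dM3 m B m1 B1
    = 16 / (sqrt B * sqrt B) * (- N * (dWf m - kap * dQf m)) * (m1 * B2 - m2 * B1)).
  { rewrite <- HD; unfold dMt, dM3; field; exact Hs. }
  rewrite HD2; apply Rmult_integral_contrapositive_currified; [|exact Hv].
  apply Rgt_not_eq, Rmult_lt_0_compat.
  - apply Rdiv_lt_0_compat; [lra|]; rewrite sqrt_sqrt; lra.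
  - nra.
Qed.

Section Curve.

Variables (mt bt : R -> R) (t0 m' b' : R).
Hypothesis Hmt : is_derive mt t0 m'.
Hypothesis Hbt : is_derive bt t0 b'.
Hypothesis Hm : 0 < mt t0 < 1.
Hypothesis Hb : 0 < bt t0.
Hypothesis E1 : Mtc sigma beta (mt t0) (bt t0) = 0.
Hypothesis E3 : M3c sigma beta (mt t0) (bt t0) = 0.

Lemma ex_derive_prefactor : ex_derive (fun t => 4 / sqrt (bt t)) t0.
Proof.
  pose proof (sqrt_neq _ Hb).
  auto_derive; repeat split; try assumption; now exists b'.
Qed.

Lemma ex_derive_Tc_curve : ex_derive (fun t => Tc (mt t) (bt t)) t0.
Proof.
  pose proof (sqrt_neq _ Hb) as Hs; pose proof (Kc_derivable _ Hm) as DK.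
  assert (Dm : ex_derive (fun t => mt t) t0) by now exists m'.
  assert (Db : ex_derive (fun t => bt t) t0) by now exists b'.
  unfold Tc; auto_derive; repeat split; assumption.
Qed.

Lemma is_derive_prefactor_zero (h : R -> R) (l : R) :
  is_derive h t0 l -> h t0 = 0 ->
  is_derive (fun t => 4 / sqrt (bt t) * h t) t0 (4 / sqrt (bt t0) * l).
Proof.
  intros Hh H0.
  pose proof (Derive_correct _ _ ex_derive_prefactor) as Hd.
  set (c' := Derive _ _) in Hd.
  replace (4 / sqrt (bt t0) * l) with (c' * h t0 + 4 / sqrt (bt t0) * l)
    by (rewrite H0; ring).
  apply (is_derive_mult (fun t => 4 / sqrt (bt t)) h); [exact Hd|exact Hh|].
  intros; apply Rmult_comm.
Qed.

Lemma is_derive_affine (f g : R -> R) :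
  ex_derive f (mt t0) -> ex_derive g (mt t0) ->
  is_derive (fun t => bt t * f (mt t) + g (mt t)) t0
    ((bt t0 * Derive f (mt t0) + Derive g (mt t0)) * m' + f (mt t0) * b').
Proof.
  intros Hf Hg.
  assert (Df : is_derive (fun t => f (mt t)) t0 (m' * Derive f (mt t0)))
    by (apply (is_derive_comp f mt); [now apply Derive_correct|exact Hmt]).
  assert (Dg : is_derive (fun t => g (mt t)) t0 (m' * Derive g (mt t0)))
    by (apply (is_derive_comp g mt); [now apply Derive_correct|exact Hmt]).
  replace ((bt t0 * Derive f (mt t0) + Derive g (mt t0)) * m' + f (mt t0) * b')
    with ((b' * f (mt t0) + bt t0 * (m' * Derive f (mt t0))) + m' * Derive g (mt t0))
    by ring.
  apply (is_derive_plus (fun t => bt t * f (mt t)) (fun t => g (mt t))); [|exact Dg].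
  apply (is_derive_mult bt (fun t => f (mt t))); [exact Hbt|exact Df|].
  intros; apply Rmult_comm.
Qed.

Lemma prefactor_neq0 : 4 / sqrt (bt t0) <> 0.
Proof.
  apply Rgt_not_eq, Rdiv_lt_0_compat; [lra|now apply sqrt_lt_R0].
Qed.

(** Working along an arbitrary curve t -> (m, B) lets the partial derivatives in (I, B) and those in
    (A, B) come from the same computation. *)
Lemma is_derive_Mtc_curve :
  is_derive (fun t => Mtc sigma beta (mt t) (bt t)) t0 (dMt (mt t0) (bt t0) m' b').
Proof.
  apply (is_derive_prefactor_zero (fun t => bt t * uf (mt t) + vf (mt t))).
  - apply is_derive_affine; [now apply ex_derive_uf|now apply ex_derive_vf].
  - rewrite Mtc_uv in E1; apply Rmult_integral in E1; destruct E1; [|easy].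
    now destruct prefactor_neq0.
Qed.

Lemma is_derive_M3c_curve :
  is_derive (fun t => M3c sigma beta (mt t) (bt t)) t0 (dM3 (mt t0) (bt t0) m' b').
Proof.
  apply (is_derive_ext (fun t => - (4 / sqrt (bt t) * (bt t * pf (mt t) + qf (mt t))))).
  { intros t; rewrite M3c_pq; toR; ring. }
  unfold dM3; rewrite Ropp_mult_distr_l_reverse.
  apply (is_derive_opp (fun t => 4 / sqrt (bt t) * (bt t * pf (mt t) + qf (mt t)))).
  apply (is_derive_prefactor_zero (fun t => bt t * pf (mt t) + qf (mt t))).
  - apply is_derive_affine; [now apply ex_derive_pf|now apply ex_derive_qf].
  - rewrite M3c_pq in E3; apply Rmult_integral in E3; destruct E3; [|easy].
    destruct prefactor_neq0; lra.
Qed.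

Lemma is_derive_M1_curve :
  is_derive (fun t => Tc (mt t) (bt t) * Mtc sigma beta (mt t) (bt t)
     + IBc (mt t) (bt t) * M3c sigma beta (mt t) (bt t)) t0
    (Tc (mt t0) (bt t0) * dMt (mt t0) (bt t0) m' b'
     + IBc (mt t0) (bt t0) * dM3 (mt t0) (bt t0) m' b').
Proof.
  pose proof (sqrt_neq _ Hb) as Hs.
  pose proof (Kc_derivable _ Hm) as DK; pose proof (ex_derive_Gf _ Hm) as DG.
  assert (Dm : ex_derive (fun t => mt t) t0) by now exists m'.
  assert (Db : ex_derive (fun t => bt t) t0) by now exists b'.
  pose proof ex_derive_Tc_curve as DT.
  assert (DI : ex_derive (fun t => IBc (mt t) (bt t)) t0)
    by (unfold IBc; auto_derive; repeat split; assumption).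
  apply Derive_correct in DT; apply Derive_correct in DI.
  set (T' := Derive _ _) in DT; set (I' := Derive _ _) in DI.
  replace (Tc (mt t0) (bt t0) * dMt (mt t0) (bt t0) m' b'
     + IBc (mt t0) (bt t0) * dM3 (mt t0) (bt t0) m' b') with
    ((T' * Mtc sigma beta (mt t0) (bt t0) + Tc (mt t0) (bt t0) * dMt (mt t0) (bt t0) m' b')
     + (I' * M3c sigma beta (mt t0) (bt t0) + IBc (mt t0) (bt t0) * dM3 (mt t0) (bt t0) m' b'))
    by (rewrite E1, E3; ring).
  apply (is_derive_plus (fun t => Tc (mt t) (bt t) * Mtc sigma beta (mt t) (bt t))
    (fun t => IBc (mt t) (bt t) * M3c sigma beta (mt t) (bt t))).
  - apply (is_derive_mult (fun t => Tc (mt t) (bt t))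
      (fun t => Mtc sigma beta (mt t) (bt t)));
      [exact DT|exact is_derive_Mtc_curve|intros; apply Rmult_comm].
  - apply (is_derive_mult (fun t => IBc (mt t) (bt t))
      (fun t => M3c sigma beta (mt t) (bt t)));
      [exact DI|exact is_derive_M3c_curve|intros; apply Rmult_comm].
Qed.

End Curve.

End ZeroSet.

(** * Action coordinates *)

Lemma Gf_incr m1 m2 : 0 < m1 -> m1 < m2 -> m2 < 1 -> Gf m1 < Gf m2.
Proof.
  intros H1 H12 H2; apply (incr_of_derive_pos Gf dGf); [exact H12| |].
  - intros x Hx; apply is_derive_Gf; lra.
  - intros x Hx; unfold dGf; pose proof (Kc_pos x ltac:(lra)); lra.
Qed.

Lemma Gf_inj m1 m2 : 0 < m1 < 1 -> 0 < m2 < 1 -> Gf m1 = Gf m2 -> m1 = m2.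
Proof.
  intros H1 H2 E; destruct (Rtotal_order m1 m2) as [Hl|[He|Hg]]; [|easy|].
  - pose proof (Gf_incr m1 m2 ltac:(lra) Hl ltac:(lra)); lra.
  - pose proof (Gf_incr m2 m1 ltac:(lra) Hg ltac:(lra)); lra.
Qed.

Lemma mm_of_m b m : 0 < b -> mm (b * (2 * m - 1)) b = m.
Proof. intros Hb; unfold mm; field; lra. Qed.

Lemma A_of_m_lt b m : 0 < b -> 0 < m < 1 -> Rabs (b * (2 * m - 1)) < b.
Proof. intros Hb Hm; apply Rabs_lt_iff; nra. Qed.

(** At fixed B the action is 16 sqrt B G(m) with G strictly increasing, so the description in
    [A_of_action] has exactly one solution and I determines m. *)
Lemma A_of_action_eq b m I : 0 < b -> 0 < m < 1 -> I = 16 * sqrt b * Gf m ->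
  A_of_action I b = b * (2 * m - 1).
Proof.
  intros Hb Hm HI.
  assert (Huniq : forall A : R, Rabs A < b /\ action A b = I -> A = b * (2 * m - 1)).
  { intros A [HA EA]; destruct (mm_bounds A b HA) as [_ Hm'].
    rewrite action_eq, HI in EA by exact HA.
    assert (E : mm A b = m).
    { apply Gf_inj; [easy|easy|].
      apply (Rmult_eq_reg_l (16 * sqrt b)); [exact EA|].
      pose proof (sqrt_neq b Hb); lra. }
    rewrite <- E; unfold mm; field; lra. }
  apply (iota_unique (fun A : R => Rabs A < b /\ action A b = I)); [exact Huniq|].
  split; [now apply A_of_m_lt|].
  rewrite action_eq, mm_of_m by (try apply A_of_m_lt; easy); easy.
Qed.

Lemma Gf_local_inverse m0 : 0 < m0 < 1 -> exists g : R -> R,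
  g (Gf m0) = m0 /\ is_derive g (Gf m0) (/ dGf m0) /\
  locally (Gf m0) (fun y => 0 < g y < 1 /\ Gf (g y) = y).
Proof.
  intros Hm.
  set (g := fun y => iota (fun m : R => 0 < m < 1 /\ Gf m = y)).
  assert (Hg : forall m, 0 < m < 1 -> g (Gf m) = m).
  { intros m H; apply (iota_unique (fun x : R => 0 < x < 1 /\ Gf x = Gf m)); [|easy].
    intros x [Hx E]; now apply Gf_inj. }
  (* Half the distance to the nearer end keeps [m0 - d, m0 + d] inside (0, 1), where dG/dm = K / 2
     exceeds 1/2; this 1/2 is the slope given to [surjective_near]. *)
  set (d := Rmin m0 (1 - m0) / 2).
  assert (Hd : 0 < d /\ d < m0 /\ d < 1 - m0).
  { assert (0 < Rmin m0 (1 - m0)) by (apply Rmin_pos; lra).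
    pose proof (Rmin_l m0 (1 - m0)); pose proof (Rmin_r m0 (1 - m0)).
    unfold d; lra. }
  assert (Hnear : forall y, Rabs (y - Gf m0) <= / 2 * d ->
    0 < g y < 1 /\ Gf (g y) = y /\ Rabs (g y - m0) <= Rabs (y - Gf m0) / / 2).
  { intros y Hy.
    destruct (surjective_near Gf dGf m0 d (/ 2) y) as [x [Hx <-]]; try assumption.
    - lra.
    - intros x Hx; apply Rabs_le_between in Hx; apply is_derive_Gf; lra.
    - intros x Hx; apply Rabs_le_between in Hx; unfold dGf.
      pose proof (Kc_pos x ltac:(lra)); lra.
    - assert (Hx1 : Rabs (x - m0) <= d).
      { eapply Rle_trans; [exact Hx|]; lra. }
      apply Rabs_le_between in Hx1.
      rewrite Hg by lra; repeat split; try lra; exact Hx. }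
  assert (Hpos : 0 < / 2 * d) by lra.
  assert (Hloc : locally (Gf m0) (fun y => Rabs (y - Gf m0) <= / 2 * d)).
  { exists (mkposreal _ Hpos); intros y Hy; left; exact Hy. }
  assert (Hinv : locally (Gf m0) (fun y => 0 < g y < 1 /\ Gf (g y) = y)).
  { apply (filter_imp _ _ (fun y Hy => let H := Hnear y Hy in
      conj (proj1 H) (proj1 (proj2 H)))); exact Hloc. }
  exists g; split; [now apply Hg|split; [|exact Hinv]].
  apply (is_derive_inverse Gf).
  - rewrite Hg by exact Hm; now apply is_derive_Gf.
  - unfold dGf; pose proof (Kc_pos m0 ltac:(lra)); lra.
  - apply continuity_pt_filterlim; intros e He.
    exists (Rmin (/ 2 * d) (e / 4)); split; [apply Rmin_pos; lra|].
    intros y [_ Hy]; simpl in *; unfold Rdist in *; rewrite Hg by exact Hm.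
    pose proof (Rmin_l (/ 2 * d) (e / 4)); pose proof (Rmin_r (/ 2 * d) (e / 4)).
    destruct (Hnear y ltac:(lra)) as [_ [_ Hb]]; lra.
  - apply (filter_imp _ _ (fun y H => proj2 H) Hinv).
Qed.

Lemma M1_of_m sigma beta s b m chi : 0 < b -> 0 < m < 1 ->
  M1 sigma beta s (b * (2 * m - 1)) b chi
  = Tc m b * Mtc sigma beta m b + IBc m b * M3c sigma beta m b.
Proof.
  intros Hb Hm; rewrite M1_eq by now apply A_of_m_lt.
  now rewrite mm_of_m.
Qed.

Lemma M3_of_m sigma beta b m : 0 < b -> 0 < m < 1 ->
  M3 sigma beta (b * (2 * m - 1)) b = M3c sigma beta m b.
Proof.
  intros Hb Hm; rewrite M3_eq by now apply A_of_m_lt.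
  now rewrite mm_of_m.
Qed.

Lemma M4_of_m sigma b m chi : 0 < b -> 0 < m < 1 ->
  M4 sigma (b * (2 * m - 1)) b chi = - (sigma * chi * Tc m b).
Proof.
  intros Hb Hm; rewrite M4_eq by now apply A_of_m_lt.
  now rewrite mm_of_m.
Qed.

(** Here chi0 is frozen at 0, where [M4] vanishes identically in the other variables. The condition
    on the curve is local because the closed forms hold only for 0 < m < 1 and B > 0. *)
Lemma melnikov_derive_curve sigma beta s (mt bt act : R -> R) (t0 m' b' : R) :
  is_derive mt t0 m' -> is_derive bt t0 b' ->
  locally t0 (fun t => 0 < bt t /\ 0 < mt t < 1 /\
    A_of_action (act t) (bt t) = bt t * (2 * mt t - 1)) ->
  Mtc sigma beta (mt t0) (bt t0) = 0 -> M3c sigma beta (mt t0) (bt t0) = 0 ->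
  is_derive (fun t => M1 sigma beta s (A_of_action (act t) (bt t)) (bt t) 0) t0
    (Tc (mt t0) (bt t0) * dMt sigma beta (mt t0) (bt t0) m' b'
     + IBc (mt t0) (bt t0) * dM3 sigma beta (mt t0) (bt t0) m' b') /\
  is_derive (fun t => M3 sigma beta (A_of_action (act t) (bt t)) (bt t)) t0
    (dM3 sigma beta (mt t0) (bt t0) m' b') /\
  is_derive (fun t => M4 sigma (A_of_action (act t) (bt t)) (bt t) 0) t0 0.
Proof.
  intros Dm Db L E1 E3.
  destruct (locally_singleton _ _ L) as [Hb [Hm _]].
  split; [|split].
  - eapply is_derive_ext_loc; [|now apply (is_derive_M1_curve sigma beta mt bt)].
    revert L; apply filter_imp; intros t [H0 [H1 H2]].
    rewrite H2; symmetry; now apply M1_of_m.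
  - eapply is_derive_ext_loc; [|now apply (is_derive_M3c_curve sigma beta mt bt)].
    revert L; apply filter_imp; intros t [H0 [H1 H2]].
    rewrite H2; symmetry; now apply M3_of_m.
  - apply (is_derive_ext_loc (fun _ => 0)); [|apply (is_derive_const 0)].
    revert L; apply filter_imp; intros t [H0 [H1 H2]].
    rewrite H2, M4_of_m by assumption; toR; ring.
Qed.

Lemma melnikov_jacobian_nondegenerate sigma beta s A B chi :
  0 < sigma -> 0 < beta -> (sigma + 1) / (beta + 2) > 2 / 3 -> Rabs A < B ->
  melnikov sigma beta s A B chi = (0, 0, 0) ->
  jacobian_nondegenerate (melnikov_IB sigma beta s) (action A B) B chi.
Proof.
  intros Hs Hb Hl HAB E.
  apply melnikov_zero_iff in E; [|exact Hs|exact HAB]; destruct E as [-> [E1 E3]].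
  destruct (mm_bounds A B HAB) as [HB Hm].
  rewrite Mt1_eq in E1 by exact HAB; rewrite M3_eq in E3 by exact HAB.
  rewrite action_eq by exact HAB.
  set (m := mm A B) in *.
  set (I0 := 16 * sqrt B * Gf m).
  pose proof (sqrt_neq B HB) as HsB.
  destruct (Gf_local_inverse m Hm) as [g [Hg [Dg Lg]]].
  assert (HdG : dGf m <> 0)
    by (unfold dGf; pose proof (Kc_pos m ltac:(lra)); lra).
  (* m as a function of I at fixed B and, next, of B at fixed I, both read off I = 16 sqrt B
     G(m). *)
  set (mI := fun t => g (t / (16 * sqrt B))).
  set (mB := fun t => g (I0 / (16 * sqrt t))).
  assert (EI : I0 / (16 * sqrt B) = Gf m) by (unfold I0; field; exact HsB).
  assert (EmI : mI I0 = m) by (unfold mI; rewrite EI; exact Hg).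
  assert (EmB : mB B = m) by (unfold mB; rewrite EI; exact Hg).
  set (mI' := / (16 * sqrt B) * / dGf m).
  assert (DmI : is_derive mI I0 mI').
  { apply (is_derive_comp g (fun t => t / (16 * sqrt B))); [rewrite EI; exact Dg|].
    auto_derive; [easy|field; exact HsB]. }
  (* The value is left existential: in the cross product mI' * 1 - mB' * 0 below it is multiplied by
     zero. *)
  assert (DmB : exists mB', is_derive mB B mB').
  { eexists; apply (is_derive_comp g (fun t => I0 / (16 * sqrt t)));
      [rewrite EI; exact Dg|].
    apply Derive_correct; auto_derive; repeat split; try easy; lra. }
  destruct DmB as [mB' DmB].
  assert (LI : locally I0 (fun t => 0 < B /\ 0 < mI t < 1 /\
    A_of_action t B = B * (2 * mI t - 1))).
  { apply (filter_imp (fun t => 0 < g (t / (16 * sqrt B)) < 1 /\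
      Gf (g (t / (16 * sqrt B))) = t / (16 * sqrt B))).
    - intros t [H1 H2]; split; [exact HB|split; [exact H1|]].
      apply A_of_action_eq; try assumption.
      unfold mI; rewrite H2; field; exact HsB.
    - apply (locally_preimage (fun t => t / (16 * sqrt B)) I0
        (fun y => 0 < g y < 1 /\ Gf (g y) = y)); [cont; lra|].
      rewrite EI; exact Lg. }
  assert (LB : locally B (fun t => 0 < t /\ 0 < mB t < 1 /\
    A_of_action I0 t = t * (2 * mB t - 1))).
  { apply (filter_imp (fun t => 0 < t /\ (0 < g (I0 / (16 * sqrt t)) < 1 /\
      Gf (g (I0 / (16 * sqrt t))) = I0 / (16 * sqrt t)))).
    - intros t [H0 [H1 H2]]; split; [exact H0|split; [exact H1|]].
      apply A_of_action_eq; try assumption.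
      unfold mB; rewrite H2; field; now apply sqrt_neq.
    - apply filter_and; [now apply locally_gt|].
      apply (locally_preimage (fun t => I0 / (16 * sqrt t)) B
        (fun y => 0 < g y < 1 /\ Gf (g y) = y)); [cont; lra|].
      rewrite EI; exact Lg. }
  destruct (melnikov_derive_curve sigma beta s mI (fun _ => B) (fun t => t) I0 mI' 0)
    as [F11 [F21 F31]];
    [exact DmI|apply (is_derive_const B)|exact LI|now rewrite EmI..|].
  destruct (melnikov_derive_curve sigma beta s mB (fun t => t) (fun _ => I0) B mB' 1)
    as [F12 [F22 F32]];
    [exact DmB|apply (is_derive_id B)|exact LB|now rewrite EmB..|].
  cbv beta in F11, F12, F21, F22, F31, F32.
  rewrite EmI in F11, F21; rewrite EmB in F12, F22.
  set (a11 := Tc m B * _ + _) in F11; set (a21 := dM3 _ _ _ _ _ _) in F21.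
  set (a12 := Tc m B * _ + _) in F12; set (a22 := dM3 _ _ _ _ _ _) in F22.
  assert (EA : A_of_action I0 B = B * (2 * m - 1))
    by now apply A_of_action_eq.
  assert (F13 : is_derive (fun t => M1 sigma beta s (A_of_action I0 B) B t) 0 0).
  { apply (is_derive_ext (fun _ => Tc m B * Mtc sigma beta m B
      + IBc m B * M3c sigma beta m B)); [|apply (is_derive_const (_ : R))].
    intros t; rewrite EA, M1_of_m; easy. }
  assert (F23 : is_derive (fun _ : R => M3 sigma beta (A_of_action I0 B) B) 0 0)
    by apply (is_derive_const (_ : R)).
  assert (F33 : is_derive (fun t => M4 sigma (A_of_action I0 B) B t) 0
    (- (sigma * Tc m B))).
  { apply (is_derive_ext (fun t => - (sigma * t * Tc m B))).
    - intros t; rewrite EA, M4_of_m; easy.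
    - auto_derive; [easy|ring]. }
  unfold jacobian_nondegenerate, partials_exist, melnikov_IB, melnikov; simpl.
  repeat split; try (eexists; eassumption).
  rewrite (is_derive_unique (fun t : R => M1 sigma beta s (A_of_action t B) B 0) _ _ F11),
    (is_derive_unique (fun t : R => M3 sigma beta (A_of_action t B) B) _ _ F21),
    (is_derive_unique (fun t : R => M1 sigma beta s (A_of_action I0 t) t 0) _ _ F12),
    (is_derive_unique (fun t : R => M3 sigma beta (A_of_action I0 t) t) _ _ F22),
    (is_derive_unique (fun t : R => M4 sigma (A_of_action t B) B 0) _ _ F31),
    (is_derive_unique (fun t : R => M4 sigma (A_of_action I0 t) t 0) _ _ F32),
    (is_derive_unique (fun t : R => M1 sigma beta s (A_of_action I0 B) B t) _ _ F13),
    (is_derive_unique (fun _ : R => M3 sigma beta (A_of_action I0 B) B) _ _ F23),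
    (is_derive_unique (fun t : R => M4 sigma (A_of_action I0 B) B t) _ _ F33).
  pose proof (Tc_pos m B Hm HB) as HT.
  assert (Hdet := dMt_dM3_independent sigma beta Hs Hb Hl m B mI' 0 mB' 1 Hm HB E1 E3).
  assert (HmI' : mI' * 1 - mB' * 0 <> 0).
  { replace (mI' * 1 - mB' * 0) with mI' by ring; unfold mI'.
    apply Rmult_integral_contrapositive_currified; apply Rinv_neq_0_compat;
      [lra|exact HdG]. }
  specialize (Hdet HmI'); fold a21 a22 in Hdet.
  unfold det3.
  (* In the chi0 column only the last entry is nonzero, and the [M1] row is T times the [Mt1] row
     plus a multiple of the [M3] row: the determinant is that of (Mt1, M3) times - sigma T^2. *)
  replace (a11 * (a22 * - (sigma * Tc m B) - 0 * 0) - a12 * (a21 * - (sigma * Tc m B) - 0 * 0)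
    + 0 * (a21 * 0 - a22 * 0)) with
    (- (sigma * Tc m B * Tc m B) * (dMt sigma beta m B mI' 0 * a22 - dMt sigma beta m B mB' 1 * a21))
    by (unfold a11, a12; fold a21 a22; ring).
  apply Rmult_integral_contrapositive_currified; [|exact Hdet].
  assert (0 < sigma * Tc m B * Tc m B) by (apply Rmult_lt_0_compat; [now apply Rmult_lt_0_compat|exact HT]).
  lra.
Qed.

(** * Averaging *)

(** Distances are expressed by uniform bounds on differences, in place of a norm, and [P] is the
    closed set. The iterates are uniformly Cauchy with rate q^n D / (1 - q). *)
Lemma banach_fixed_point (X : Type) (P : (X -> R) -> Prop)
    (Phi : (X -> R) -> X -> R) (U0 : X -> R) (q D : R) :
  0 <= q < 1 -> P U0 -> (forall U, P U -> P (Phi U)) ->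
  (forall U U' d, P U -> P U' -> (forall x, Rabs (U x - U' x) <= d) ->
     forall x, Rabs (Phi U x - Phi U' x) <= q * d) ->
  (forall x, Rabs (Phi U0 x - U0 x) <= D) ->
  (forall (u : nat -> X -> R) U, (forall n, P (u n)) ->
     (forall e, 0 < e -> exists N, forall n x,
        (N <= n)%nat -> Rabs (u n x - U x) <= e) -> P U) ->
  exists U, P U /\ forall x, Phi U x = U x.
Proof.
  intros Hq HP0 HPP Hc H0 Hcl.
  destruct (Rle_or_lt 0 D) as [HD|HD].
  (* A negative bound [D] is possible only when [X] is empty, and then every function is fixed. *)
  2:{ exists U0; split; [exact HP0|intros x].
      specialize (H0 x); pose proof (Rabs_pos (Phi U0 x - U0 x)); lra. }
  set (u := fun n => Nat.iter n Phi U0).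
  assert (HPu : forall n, P (u n)) by (intros n; induction n; [easy|now apply HPP]).
  assert (H1 : forall n x, Rabs (u (S n) x - u n x) <= q ^ n * D).
  { intros n; induction n as [|n IH]; intros x.
    - simpl; rewrite Rmult_1_l; apply H0.
    - change (Rabs (Phi (u (S n)) x - Phi (u n) x) <= q ^ S n * D).
      replace (q ^ S n * D) with (q * (q ^ n * D)) by (simpl; ring).
      now apply Hc. }
  set (E := D / (1 - q)).
  assert (HE : 0 <= E) by (apply Rdiv_le_0_compat; lra).
  assert (H2 : forall k n x, Rabs (u (n + k)%nat x - u n x) <= (q ^ n - q ^ (n + k)) * E).
  { intros k; induction k as [|k IH]; intros n x.
    - rewrite Nat.add_0_r; unfold Rminus; rewrite !Rplus_opp_r, Rabs_R0; lra.
    - rewrite Nat.add_succ_r.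
      replace (u (S (n + k)) x - u n x) with
        ((u (S (n + k)) x - u (n + k)%nat x) + (u (n + k)%nat x - u n x)) by ring.
      abs_tri.
      specialize (H1 (n + k)%nat x); specialize (IH n x).
      replace ((q ^ n - q ^ S (n + k)) * E) with
        (q ^ (n + k) * D + (q ^ n - q ^ (n + k)) * E)
        by (unfold E; simpl; field; lra).
      lra. }
  assert (H3 : forall n m x, (n <= m)%nat -> Rabs (u m x - u n x) <= q ^ n * E).
  { intros n m x Hnm; replace m with (n + (m - n))%nat by lia.
    eapply Rle_trans; [apply H2|].
    apply Rmult_le_compat_r; [exact HE|].
    pose proof (pow_le q (n + (m - n)) (proj1 Hq)); lra. }
  assert (H4 : forall e, 0 < e -> exists N, forall n, (N <= n)%nat -> q ^ n * E < e).
  { intros e He.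
    destruct (pow_lt_1_zero q) with (y := e / (E + 1)) as [N HN].
    - rewrite Rabs_pos_eq; lra.
    - apply Rdiv_lt_0_compat; lra.
    - exists N; intros n Hn; specialize (HN n Hn).
      rewrite Rabs_pos_eq in HN by (apply pow_le; lra).
      apply Rle_lt_trans with (e / (E + 1) * E).
      + apply Rmult_le_compat_r; lra.
      + apply (Rmult_lt_reg_r (E + 1)); [lra|].
        replace (e / (E + 1) * E * (E + 1)) with (e * E) by (field; lra); nra. }
  assert (HCv : forall x, { l | Un_cv (fun n => u n x) l }).
  { intros x; apply Rcomplete.R_complete; intros e He.
    destruct (H4 (e / 2) ltac:(lra)) as [N HN].
    exists N; intros n m Hn Hm; unfold Rdist.
    pose proof (H3 N n x Hn) as Ha; pose proof (H3 N m x Hm) as Hb.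
    specialize (HN N (le_n N)).
    replace (u n x - u m x) with ((u n x - u N x) - (u m x - u N x)) by ring.
    eapply Rle_lt_trans; [apply Rabs_triang|]; rewrite Rabs_Ropp; lra. }
  set (U := fun x => proj1_sig (HCv x)).
  assert (HU : forall n x, Rabs (u n x - U x) <= q ^ n * E).
  { intros n x; unfold U; destruct (HCv x) as [l Hl]; simpl.
    apply Rnot_lt_le; intros Hlt.
    destruct (Hl (Rabs (u n x - l) - q ^ n * E) ltac:(lra)) as [N HN].
    specialize (HN (n + N)%nat ltac:(lia)); unfold Rdist in HN.
    pose proof (H3 n (n + N)%nat x ltac:(lia)) as Ha.
    replace (u n x - l) with (- (u (n + N)%nat x - u n x) + (u (n + N)%nat x - l))
      in HN by ring.
    pose proof (Rabs_triang (- (u (n + N)%nat x - u n x)) (u (n + N)%nat x - l)) as Ht.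
    rewrite Rabs_Ropp in Ht; lra. }
  assert (HPU : P U).
  { apply (Hcl u); [exact HPu|]; intros e He.
    destruct (H4 e He) as [N HN]; exists N; intros n x Hn.
    left; eapply Rle_lt_trans; [apply HU|now apply HN]. }
  exists U; split; [exact HPU|]; intros x.
  destruct (Req_dec (Phi U x - U x) 0) as [E0|N0]; [lra|exfalso].
  set (e := Rabs (Phi U x - U x)).
  assert (He : 0 < e) by now apply Rabs_pos_lt.
  destruct (H4 (e / 2) ltac:(lra)) as [N HN].
  pose proof (Hc U (u N) (q ^ N * E) HPU (HPu N)) as Ha.
  assert (Hb : forall x, Rabs (U x - u N x) <= q ^ N * E)
    by (intros y; rewrite Rabs_minus_sym; apply HU).
  specialize (Ha Hb x).
  pose proof (HU (S N) x) as Hd; change (u (S N) x) with (Phi (u N) x) in Hd.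
  specialize (HN N (le_n N)).
  assert (e <= Rabs (Phi U x - Phi (u N) x) + Rabs (Phi (u N) x - U x)).
  { unfold e; replace (Phi U x - U x) with
      ((Phi U x - Phi (u N) x) + (Phi (u N) x - U x)) by ring; apply Rabs_triang. }
  assert (0 <= q ^ N * E) by (apply Rmult_le_pos; [apply pow_le; lra|lra]).
  simpl in Hd.
  assert (q * (q ^ N * E) <= q ^ N * E) by nra.
  lra.
Qed.

Lemma continuous_uniform_limit (u : nat -> R -> R) (U : R -> R) :
  (forall n t, continuous (u n) t) ->
  (forall e, 0 < e -> exists N, forall n x,
     (N <= n)%nat -> Rabs (u n x - U x) <= e) ->
  forall t, continuous U t.
Proof.
  intros Hc Hu t.
  apply continuity_pt_filterlim; intros e He.
  destruct (Hu (e / 4) ltac:(lra)) as [N HN].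
  destruct (cont_pt _ _ (Hc N t) (e / 4) ltac:(lra)) as [d [Hd Hd2]].
  exists d; split; [exact Hd|]; intros x Hx; specialize (Hd2 x Hx).
  simpl in *; unfold Rdist in *.
  pose proof (HN N x (le_n N)) as Ha; pose proof (HN N t (le_n N)) as Hb.
  rewrite Rabs_minus_sym in Ha.
  replace (U x - U t) with ((U x - u N x) + ((u N x - u N t) + (u N t - U t))) by ring.
  eapply Rle_lt_trans; [apply Rabs_triang|].
  pose proof (Rabs_triang (u N x - u N t) (u N t - U t)); lra.
Qed.

Lemma period_reduce (g : R -> R) (T : R) :
  0 < T -> (forall t, g (t + T) = g t) ->
  forall t, exists t0, 0 <= t0 <= T /\ g t = g t0.
Proof.
  intros HT Hg.
  assert (HN : forall (n : nat) t, g (t + INR n * T) = g t).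
  { intros n; induction n as [|n IH]; intros t.
    - f_equal; simpl; ring.
    - rewrite S_INR, <- (IH t), <- (Hg (t + INR n * T)); f_equal; ring. }
  assert (HZ : forall (n : Z) t, g (t + IZR n * T) = g t).
  { intros n t; destruct n as [|p|p].
    - f_equal; simpl; ring.
    - rewrite <- (HN (Pos.to_nat p) t), INR_IZR_INZ, Znat.positive_nat_Z; reflexivity.
    - rewrite <- (HN (Pos.to_nat p) (t + IZR (Z.neg p) * T)).
      rewrite INR_IZR_INZ, Znat.positive_nat_Z; f_equal.
      change (IZR (Z.neg p)) with (- IZR (Z.pos p)); ring. }
  intros t; exists (t - IZR (Int_part (t / T)) * T).
  destruct (base_Int_part (t / T)) as [H1 H2].
  assert (E : t = t / T * T) by (field; lra).
  split.
  - split.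
    + assert (IZR (Int_part (t / T)) * T <= t / T * T)
        by (apply Rmult_le_compat_r; lra); lra.
    + assert ((t / T - 1) * T <= IZR (Int_part (t / T)) * T)
        by (apply Rmult_le_compat_r; lra); lra.
  - rewrite <- (HZ (Int_part (t / T)) (t - _)); f_equal; ring.
Qed.

Lemma RInt_periodic_shift (f : R -> R) (T t : R) :
  (forall x, continuous f x) -> (forall x, f (x + T) = f x) ->
  RInt f 0 (t + T) = RInt f 0 T + RInt f 0 t.
Proof.
  intros Hc Hp.
  rewrite <- (RInt_Chasles_R f 0 T (t + T) Hc); f_equal.
  replace T with (0 + T) at 1 by ring.
  rewrite <- RInt_shift by exact Hc; now apply RInt_ext_R.
Qed.

Lemma RInt_abs_le (f : R -> R) (a b B : R) :
  a <= b -> (forall x, continuous f x) ->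
  (forall t, Rabs (f t) <= B) -> Rabs (RInt f a b) <= (b - a) * B.
Proof.
  intros Hab Hc Hb; apply abs_RInt_le_const; [easy|now apply ex_RInt_cont|auto].
Qed.

Lemma oscillation_periodic (f : R -> R) (T t : R) :
  0 < T -> (forall x, continuous f x) -> (forall x, f (x + T) = f x) ->
  RInt f 0 (t + T) - (t + T) / T * RInt f 0 T
  = RInt f 0 t - t / T * RInt f 0 T.
Proof.
  intros HT Hc Hp; rewrite RInt_periodic_shift by assumption.
  toR; field; lra.
Qed.

(** Removing the linear growth makes the primitive periodic, so a bound over one period holds for
    all times. It applies whatever the mean, hence to iterates whose mean is not yet zero. *)
Lemma oscillation_bound (f : R -> R) (T t B : R) :
  0 < T -> (forall x, continuous f x) -> (forall x, f (x + T) = f x) ->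
  (forall x, Rabs (f x) <= B) ->
  Rabs (RInt f 0 t - t / T * RInt f 0 T) <= 2 * T * B.
Proof.
  intros HT Hc Hp HB.
  destruct (period_reduce (fun t => RInt f 0 t - t / T * RInt f 0 T) T HT
    (fun t => oscillation_periodic f T t HT Hc Hp) t) as [t0 [Ht ->]].
  assert (HB0 : 0 <= B) by (eapply Rle_trans; [apply Rabs_pos|apply (HB 0)]).
  assert (H1 : forall b, 0 <= b <= T -> Rabs (RInt f 0 b) <= T * B).
  { intros b Hb; eapply Rle_trans; [apply RInt_abs_le; [lra|exact Hc|exact HB]|].
    apply Rmult_le_compat_r; lra. }
  pose proof (H1 t0 Ht) as H2; pose proof (H1 T ltac:(lra)) as H3.
  unfold Rminus; abs_tri.
  rewrite Rabs_Ropp, Rabs_mult.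
  assert (H4 : Rabs (t0 / T) <= 1).
  { rewrite Rabs_pos_eq by (apply Rdiv_le_0_compat; lra).
    apply Rle_div_l; lra. }
  assert (Rabs (t0 / T) * Rabs (RInt f 0 T) <= 1 * (T * B))
    by (apply Rmult_le_compat; try apply Rabs_pos; easy).
  lra.
Qed.

(** * Uniform strict differentiability in the slow variables and eps *)

Inductive ax := XA | XB | XC.

(** [Some] indexes the slow variables A, B and chi, and [None] holds eps: as a coordinate, eps gets
    its Lipschitz control from the same notion as the others. *)
Definition point := option ax -> R.

Definition s3 (g : ax -> R) : R := g XA + g XB + g XC.
Definition s4 (g : point) : R := s3 (fun i => g (Some i)) + g None.

Definition dist4 (z z' : point) : R := s4 (fun o => Rabs (z o - z' o)).

(* Strict differentiability of [f _ t] at [z0] with partial derivatives [d],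
   uniformly in the 2 PI-periodic variable [t].  Unlike C^1 smoothness near
   [z0], it transfers through sums, products and compositions without any
   compactness argument. *)
Record C1at (z0 : point) (f : point -> R -> R) (d : option ax -> R -> R)
    (M : R) : Prop := {
  C1_periodic : forall z t, f z (t + 2 * PI) = f z t;
  C1_bound : forall t, Rabs (f z0 t) <= M;
  C1_d_bound : forall o t, Rabs (d o t) <= M;
  C1_d_cont : forall o t, continuous (d o) t;
  C1_strict : forall eta, 0 < eta -> exists delta, 0 < delta /\
    forall t z z', dist4 z z0 <= delta -> dist4 z' z0 <= delta ->
    Rabs (f z t - f z' t - s4 (fun o => d o t * (z o - z' o)))
      <= eta * dist4 z z';
  C1_cont : exists delta, 0 < delta /\ forall Z : R -> point,
    (forall o t, continuous (fun t => Z t o) t) ->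
    (forall t, dist4 (Z t) z0 <= delta) ->
    forall t, continuous (fun t => f (Z t) t) t }.

Lemma dist4_pos z z' : 0 <= dist4 z z'.
Proof.
  unfold dist4, s4, s3.
  repeat apply Rplus_le_le_0_compat; apply Rabs_pos.
Qed.

Lemma dist4_refl z : dist4 z z = 0.
Proof.
  unfold dist4, s4, s3; rewrite !Rminus_diag, Rabs_R0; ring.
Qed.

Lemma dist4_coord z z' o : Rabs (z o - z' o) <= dist4 z z'.
Proof.
  unfold dist4, s4, s3.
  pose proof (Rabs_pos (z (Some XA) - z' (Some XA))).
  pose proof (Rabs_pos (z (Some XB) - z' (Some XB))).
  pose proof (Rabs_pos (z (Some XC) - z' (Some XC))).
  pose proof (Rabs_pos (z None - z' None)).
  destruct o as [[]|]; lra.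
Qed.

Lemma s4_linear_bound (c : option ax -> R) (z z' : point) (M : R) :
  (forall o, Rabs (c o) <= M) ->
  Rabs (s4 (fun o => c o * (z o - z' o))) <= M * dist4 z z'.
Proof.
  intros H.
  assert (Hb : forall o, Rabs (c o * (z o - z' o)) <= M * Rabs (z o - z' o)).
  { intros o; rewrite Rabs_mult; apply Rmult_le_compat_r; [apply Rabs_pos|apply H]. }
  pose proof (Hb (Some XA)); pose proof (Hb (Some XB)).
  pose proof (Hb (Some XC)); pose proof (Hb None).
  unfold dist4, s4, s3.
  abs_tri.
  eapply Rle_trans; [apply Rplus_le_compat_r, Rabs_triang|].
  eapply Rle_trans; [apply Rplus_le_compat_r, Rplus_le_compat_r, Rabs_triang|].
  lra.
Qed.

Lemma prod3_le a b c k :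
  0 <= a <= k -> 0 <= b <= k -> 0 <= c <= k -> a * b * c <= k * k * k.
Proof.
  intros Ha Hb Hc; apply Rmult_le_compat; [apply Rmult_le_pos; lra|lra| |lra].
  apply Rmult_le_compat; lra.
Qed.

Section Closure.

Variable z0 : point.

Definition smooth (f : point -> R -> R) : Prop := exists d M, C1at z0 f d M.

Lemma C1_M_pos f d M : C1at z0 f d M -> 0 <= M.
Proof.
  intros H; eapply Rle_trans; [apply Rabs_pos|apply (C1_bound _ _ _ _ H 0)].
Qed.

Lemma C1_weaken f d M M' : C1at z0 f d M -> M <= M' -> C1at z0 f d M'.
Proof.
  intros [H1 H2 H3 H4 H5 H6] HM; split; auto.
  - intros t; specialize (H2 t); lra.
  - intros o t; specialize (H3 o t); lra.
Qed.

Lemma C1_lipschitz f d M : C1at z0 f d M ->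
  exists delta, 0 < delta /\ forall t z z',
    dist4 z z0 <= delta -> dist4 z' z0 <= delta ->
    Rabs (f z t - f z' t) <= (M + 1) * dist4 z z'.
Proof.
  intros H; destruct (C1_strict _ _ _ _ H 1 Rlt_0_1) as [de [Hd HS]].
  exists de; split; [exact Hd|]; intros t z z' Hz Hz'.
  specialize (HS t z z' Hz Hz').
  pose proof (s4_linear_bound (fun o => d o t) z z' M
    (fun o => C1_d_bound _ _ _ _ H o t)) as HL.
  replace (f z t - f z' t) with
    ((f z t - f z' t - s4 (fun o => d o t * (z o - z' o)))
     + s4 (fun o => d o t * (z o - z' o))) by ring.
  abs_tri; lra.
Qed.

Lemma smooth_time (h : R -> R) (M : R) :
  (forall t, continuous h t) -> (forall t, h (t + 2 * PI) = h t) ->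
  (forall t, Rabs (h t) <= M) -> smooth (fun _ t => h t).
Proof.
  intros Hc Hp Hb; exists (fun _ _ => 0), M; split.
  - intros _; exact Hp.
  - exact Hb.
  - intros _ t; rewrite Rabs_R0; eapply Rle_trans; [apply Rabs_pos|apply (Hb t)].
  - intros; apply cont_const.
  - intros eta He; exists 1; split; [lra|]; intros t z z' _ _.
    unfold s4, s3.
    replace (h t - h t - _) with 0 by ring.
    rewrite Rabs_R0; apply Rmult_le_pos; [lra|apply dist4_pos].
  - exists 1; split; [lra|]; intros; apply Hc.
Qed.

Lemma smooth_const (c : R) : smooth (fun _ _ => c).
Proof.
  apply (smooth_time (fun _ => c) (Rabs c)); intros; [apply cont_const|easy|lra].
Qed.

Lemma smooth_coord (o : option ax) : smooth (fun z _ => z o).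
Proof.
  set (e := fun o' : option ax => match o, o' with
    | None, None | Some XA, Some XA | Some XB, Some XB | Some XC, Some XC => 1
    | _, _ => 0 end).
  assert (Hb := Rle_abs (z0 o)); assert (Hb' := Rabs_pos (z0 o)).
  exists (fun o' _ => e o'), (Rabs (z0 o) + 1); split.
  - easy.
  - intros _; lra.
  - intros o' _; unfold e.
    destruct o as [[]|], o' as [[]|]; rewrite ?Rabs_R0, ?Rabs_R1; lra.
  - intros; apply cont_const.
  - intros eta He; exists 1; split; [lra|]; intros t z z' _ _.
    unfold s4, s3, e.
    replace (z o - z' o - _) with 0 by (destruct o as [[]|]; ring).
    rewrite Rabs_R0; apply Rmult_le_pos; [lra|apply dist4_pos].
  - exists 1; split; [lra|]; intros Z HZ _ t; apply HZ.
Qed.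

Lemma smooth_plus f g :
  smooth f -> smooth g -> smooth (fun z t => f z t + g z t).
Proof.
  intros [df [Mf Hf]] [dg [Mg Hg]].
  exists (fun o t => df o t + dg o t), (Mf + Mg).
  destruct Hf as [f1 f2 f3 f4 f5 f6], Hg as [g1 g2 g3 g4 g5 g6]; split.
  - intros z t; now rewrite f1, g1.
  - intros t; abs_tri.
    specialize (f2 t); specialize (g2 t); lra.
  - intros o t; abs_tri.
    specialize (f3 o t); specialize (g3 o t); lra.
  - intros o t; cont; auto.
  - intros eta He.
    destruct (f5 (eta / 2) ltac:(lra)) as [d1 [Hd1 F]].
    destruct (g5 (eta / 2) ltac:(lra)) as [d2 [Hd2 G]].
    exists (Rmin d1 d2); split; [now apply Rmin_pos|].
    intros t z z' Hz Hz'.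
    specialize (F t z z' (Rle_trans _ _ _ Hz (Rmin_l _ _))
      (Rle_trans _ _ _ Hz' (Rmin_l _ _))).
    specialize (G t z z' (Rle_trans _ _ _ Hz (Rmin_r _ _))
      (Rle_trans _ _ _ Hz' (Rmin_r _ _))).
    match goal with |- Rabs ?x <= _ => replace x with
      ((f z t - f z' t - s4 (fun o => df o t * (z o - z' o)))
       + (g z t - g z' t - s4 (fun o => dg o t * (z o - z' o))))
      by (unfold s4, s3; ring) end.
    abs_tri; lra.
  - destruct f6 as [d1 [Hd1 F]], g6 as [d2 [Hd2 G]].
    exists (Rmin d1 d2); split; [now apply Rmin_pos|].
    intros Z HZ Hd t; apply (cont_plus (fun t => f (Z t) t)).
    + apply F; [exact HZ|]; intros s; eapply Rle_trans; [apply Hd|apply Rmin_l].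
    + apply G; [exact HZ|]; intros s; eapply Rle_trans; [apply Hd|apply Rmin_r].
Qed.

Lemma smooth_scal k f : smooth f -> smooth (fun z t => k * f z t).
Proof.
  intros [d [M [f1 f2 f3 f4 f5 f6]]].
  pose proof (Rabs_pos k) as Hk.
  exists (fun o t => k * d o t), (Rabs k * M); split.
  - intros z t; now rewrite f1.
  - intros t; rewrite Rabs_mult; now apply Rmult_le_compat_l.
  - intros o t; rewrite Rabs_mult; now apply Rmult_le_compat_l.
  - intros o t; cont; auto.
  - intros eta He.
    destruct (f5 (eta / (Rabs k + 1))) as [de [Hde F]]; [apply Rdiv_lt_0_compat; lra|].
    exists de; split; [exact Hde|]; intros t z z' Hz Hz'.
    match goal with |- Rabs ?x <= _ => replace x with
      (k * (f z t - f z' t - s4 (fun o => d o t * (z o - z' o))))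
      by (unfold s4, s3; ring) end.
    rewrite Rabs_mult.
    replace (eta * dist4 z z') with
      ((Rabs k + 1) * (eta / (Rabs k + 1) * dist4 z z')) by (field; lra).
    apply Rmult_le_compat; [lra|apply Rabs_pos|lra|now apply F].
  - destruct f6 as [de [Hde F]]; exists de; split; [exact Hde|].
    intros Z HZ Hd t; apply (cont_mult (fun _ => k)); [apply cont_const|now apply F].
Qed.

(** The condition on [phi] is a quadratic Taylor estimate with the slope taken at a third point w,
    which is what strictness requires; [p] is the margin that keeps the values of [f] in [D] near
    [z0]. *)
Lemma smooth_comp (phi phi' : R -> R) (D : R -> Prop) (p C : R) f :
  0 < p ->
  (forall x y w, D x -> D y -> D w ->
     Rabs (phi x - phi y - phi' w * (x - y))
       <= C * (Rabs (x - w) + Rabs (y - w)) * Rabs (x - y)) ->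
  (forall x, D x -> Rabs (phi' x) <= C) ->
  (forall x, D x -> continuous phi x) ->
  (forall x, D x -> continuous phi' x) ->
  (forall t x, Rabs (x - f z0 t) <= p -> D x) ->
  smooth f -> smooth (fun z t => phi (f z t)).
Proof.
  intros Hp Hphi Hphi' Hc Hc' HD [df [M Hf]].
  pose proof (C1_M_pos _ _ _ Hf) as HM.
  assert (HD0 : forall t, D (f z0 t)).
  { intros t; apply (HD t); rewrite Rminus_diag, Rabs_R0; lra. }
  assert (HC : 0 <= C)
    by (eapply Rle_trans; [apply Rabs_pos|apply (Hphi' _ (HD0 0))]).
  destruct (C1_lipschitz _ _ _ Hf) as [l [Hl L]].
  pose proof (C1_cont _ _ _ _ Hf) as [cf' [Hcf CF]].
  set (x0 := f z0 0).
  (* The values phi (f z0 t) are bounded by expanding at the single value [x0], at distance at most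
     2 M; the term C M bounds the derivatives. *)
  set (N := Rabs (phi x0) + C * (2 * M) + C * (2 * M) * (2 * M) + C * M).
  exists (fun o t => phi' (f z0 t) * df o t), N.
  assert (HN : Rabs (phi x0) + C * (2 * M) + C * (2 * M) * (2 * M) <= N /\ C * M <= N).
  { pose proof (Rabs_pos (phi x0)).
    assert (0 <= C * M) by (apply Rmult_le_pos; lra).
    assert (0 <= C * (2 * M) * (2 * M)) by (repeat apply Rmult_le_pos; lra).
    unfold N; lra. }
  assert (Hfc : forall t, continuous (f z0) t).
  { apply (CF (fun _ => z0)); [intros; apply cont_const|].
    intros; rewrite dist4_refl; lra. }
  (* l2 keeps f within p of its values at z0 *)
  set (l2 := Rmin l (p / (M + 1))).
  assert (Hl2 : 0 < l2) by (apply Rmin_pos; [easy|apply Rdiv_lt_0_compat; lra]).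
  assert (Hfp : forall z t, dist4 z z0 <= l2 -> D (f z t)).
  { intros z t Hz; apply (HD t).
    assert (Hz1 := Rle_trans _ _ _ Hz (Rmin_l _ _)).
    assert (Hz2 := Rle_trans _ _ _ Hz (Rmin_r _ _)).
    eapply Rle_trans; [apply L; [exact Hz1|rewrite dist4_refl; lra]|].
    apply Rle_trans with ((M + 1) * (p / (M + 1)));
      [apply Rmult_le_compat_l; lra|right; field; lra]. }
  destruct Hf as [f1 f2 f3 f4 f5 f6]; split.
  - intros z t; now rewrite f1.
  - intros t.
    assert (Hq := Hphi (f z0 t) x0 x0 (HD0 t) (HD0 0) (HD0 0)).
    assert (Hq' := Hphi' x0 (HD0 0)).
    rewrite (Rminus_diag x0), Rabs_R0, Rplus_0_r in Hq.
    assert (Hx : Rabs (f z0 t - x0) <= 2 * M).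
    { pose proof (f2 t); pose proof (f2 0); unfold x0.
      abs_tri; rewrite Rabs_Ropp; lra. }
    replace (phi (f z0 t)) with
      (phi x0 + (phi' x0 * (f z0 t - x0)
       + (phi (f z0 t) - phi x0 - phi' x0 * (f z0 t - x0)))) by ring.
    abs_tri.
    eapply Rle_trans; [apply Rplus_le_compat_l, Rabs_triang|].
    rewrite Rabs_mult.
    assert (T1 := Rmult_le_compat _ _ _ _ (Rabs_pos _) (Rabs_pos _) Hq' Hx).
    assert (C * Rabs (f z0 t - x0) * Rabs (f z0 t - x0) <= C * (2 * M) * (2 * M)).
    { apply Rmult_le_compat; [| |apply Rmult_le_compat_l; easy|easy].
      - apply Rmult_le_pos; [easy|apply Rabs_pos].
      - apply Rabs_pos. }
    lra.
  - intros o t; rewrite Rabs_mult.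
    apply Rle_trans with (C * M); [|easy].
    apply Rmult_le_compat; try apply Rabs_pos; [|apply f3].
    apply Hphi', HD0.
  - intros o t; apply cont_mult; [|apply f4].
    apply (continuous_comp (f z0) phi'); [apply Hfc|].
    apply Hc', HD0.
  - intros eta He.
    (* Half of [eta] pays for the first-order error of [f], amplified by C, and half for the
       quadratic remainder of [phi], whose arguments stay within (M + 1) d2 of f z0 t. *)
    set (e1 := eta / (2 * (C + 1))).
    assert (He1 : 0 < e1) by (apply Rdiv_lt_0_compat; lra).
    destruct (f5 e1 He1) as [d1 [Hd1 F]].
    set (d2 := eta / (4 * (C + 1) * (M + 1) * (M + 1))).
    assert (Hd2 : 0 < d2)
      by (apply Rdiv_lt_0_compat; [lra|repeat apply Rmult_lt_0_compat; lra]).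
    set (de := Rmin (Rmin d1 d2) l2).
    assert (Hde : 0 < de) by (apply Rmin_pos; [now apply Rmin_pos|exact Hl2]).
    assert (H1 : de <= d1) by (eapply Rle_trans; apply Rmin_l).
    assert (H2 : de <= d2) by (eapply Rle_trans; [apply Rmin_l|apply Rmin_r]).
    assert (H3 : de <= l2) by apply Rmin_r.
    assert (H4 : de <= l) by (eapply Rle_trans; [exact H3|apply Rmin_l]).
    clearbody de.
    exists de; split; [exact Hde|]; intros t z z' Hz Hz'.
    specialize (F t z z' ltac:(lra) ltac:(lra)).
    assert (Hr : dist4 z0 z0 <= l) by (rewrite dist4_refl; lra).
    assert (L1 := L t z z0 ltac:(lra) Hr).
    assert (L2 := L t z' z0 ltac:(lra) Hr).
    assert (L3 := L t z z' ltac:(lra) ltac:(lra)).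
    assert (Hq := Hphi (f z t) (f z' t) (f z0 t) (Hfp z t ltac:(lra))
      (Hfp z' t ltac:(lra)) (HD0 t)).
    assert (Hq' := Hphi' (f z0 t) (HD0 t)).
    pose proof (dist4_pos z z') as Hv; set (v := dist4 z z') in *.
    match goal with |- Rabs ?x <= _ => replace x with
      ((phi (f z t) - phi (f z' t) - phi' (f z0 t) * (f z t - f z' t))
       + phi' (f z0 t) * (f z t - f z' t - s4 (fun o => df o t * (z o - z' o))))
      by (unfold s4, s3; ring) end.
    abs_tri; rewrite Rabs_mult.
    assert (T1 := Rmult_le_compat _ _ _ _ (Rabs_pos _) (Rabs_pos _) Hq' F).
    fold v in T1.
    assert (T2 : C * (e1 * v) <= eta / 2 * v).
    { replace (eta / 2 * v) with ((C + 1) * (e1 * v)) by (unfold e1; field; lra).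
      apply Rmult_le_compat_r; [apply Rmult_le_pos; lra|lra]. }
    assert (T3 : C * (Rabs (f z t - f z0 t) + Rabs (f z' t - f z0 t))
        * Rabs (f z t - f z' t)
      <= (C + 1) * (2 * ((M + 1) * d2)) * ((M + 1) * v)).
    { assert ((M + 1) * dist4 z z0 <= (M + 1) * d2) by (apply Rmult_le_compat_l; lra).
      assert ((M + 1) * dist4 z' z0 <= (M + 1) * d2) by (apply Rmult_le_compat_l; lra).
      apply Rmult_le_compat; [|apply Rabs_pos| |easy].
      - apply Rmult_le_pos; [easy|].
        apply Rplus_le_le_0_compat; apply Rabs_pos.
      - apply Rmult_le_compat; [easy| |lra|lra].
        apply Rplus_le_le_0_compat; apply Rabs_pos. }
    replace ((C + 1) * (2 * ((M + 1) * d2)) * ((M + 1) * v)) with (eta / 2 * v) in T3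
      by (unfold d2; field; lra).
    lra.
  - exists (Rmin cf' l2); split; [apply Rmin_pos; lra|].
    intros Z HZ Hd t; apply (continuous_comp (fun t => f (Z t) t) phi).
    + apply CF; [exact HZ|]; intros s; eapply Rle_trans; [apply Hd|apply Rmin_l].
    + apply Hc, Hfp; eapply Rle_trans; [apply Hd|apply Rmin_r].
Qed.

Lemma smooth_sqr f : smooth f -> smooth (fun z t => f z t * f z t).
Proof.
  intros Hs; pose proof Hs as [d [M Hf]].
  pose proof (C1_M_pos _ _ _ Hf) as HM.
  apply (smooth_comp (fun x => x * x) (fun x => 2 * x)
    (fun x => Rabs x <= M + 1) 1 (2 * M + 2)); [lra| | | | | |exact Hs].
  - intros x y w Hx Hy Hw.
    replace (x * x - y * y - 2 * w * (x - y)) with (((x - w) + (y - w)) * (x - y)) by ring.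
    rewrite Rabs_mult; apply Rmult_le_compat_r; [apply Rabs_pos|].
    abs_tri.
    pose proof (Rabs_pos (x - w)); pose proof (Rabs_pos (y - w)); nra.
  - intros x Hx; rewrite Rabs_mult, (Rabs_pos_eq 2) by lra; lra.
  - intros; cont.
  - intros; cont.
  - intros t x Hx; pose proof (C1_bound _ _ _ _ Hf t).
    replace x with ((x - f z0 t) + f z0 t) by ring.
    abs_tri; lra.
Qed.

Lemma smooth_ext f g :
  (forall z t, f z t = g z t) -> smooth f -> smooth g.
Proof.
  intros E [d [M [f1 f2 f3 f4 f5 [de [Hde f6]]]]]; exists d, M; split; auto.
  - intros z t; now rewrite <- !E.
  - intros t; now rewrite <- E.
  - intros eta He; destruct (f5 eta He) as [d5 [H5 F5]].
    exists d5; split; [exact H5|]; intros t z z'; rewrite <- !E; apply F5.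
  - exists de; split; [exact Hde|]; intros Z HZ Hd t.
    apply (continuous_ext (fun t => f (Z t) t)); [intros; apply E|now apply f6].
Qed.

Lemma smooth_opp f : smooth f -> smooth (fun z t => - f z t).
Proof.
  intros H; apply (smooth_ext (fun z t => -1 * f z t)); [intros; ring|].
  now apply smooth_scal.
Qed.

Lemma smooth_minus f g :
  smooth f -> smooth g -> smooth (fun z t => f z t - g z t).
Proof. intros Hf Hg; apply smooth_plus; [exact Hf|now apply smooth_opp]. Qed.

(** Polarization reduces products to squares, which are compositions with a function of one
    variable. *)
Lemma smooth_mult f g :
  smooth f -> smooth g -> smooth (fun z t => f z t * g z t).
Proof.
  intros Hf Hg.
  apply (smooth_ext (fun z t => / 4 * ((f z t + g z t) * (f z t + g z t)
    - (f z t - g z t) * (f z t - g z t)))); [intros; field|].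
  apply smooth_scal, smooth_minus.
  - apply (smooth_sqr (fun z t => f z t + g z t)); now apply smooth_plus.
  - apply (smooth_sqr (fun z t => f z t - g z t)); now apply smooth_minus.
Qed.

Lemma smooth_inv f p :
  0 < p -> (forall t, p <= f z0 t) -> smooth f -> smooth (fun z t => / f z t).
Proof.
  intros Hp Hf Hs; set (q := p / 2).
  assert (Hq : 0 < q) by (unfold q; lra).
  assert (Hq2 : 0 < / q) by now apply Rinv_0_lt_compat.
  assert (Hb : forall x, q <= x -> 0 < / x <= / q).
  { intros x Hx; split; [apply Rinv_0_lt_compat; lra|now apply Rinv_le_contravar]. }
  apply (smooth_comp Rinv (fun x => - / x ^ 2) (fun x => q <= x) q (/ q ^ 3 + / q ^ 2));
    try assumption.
  - (* 1/x - 1/y + (x-y)/w^2 = (x-y) (x (y-w) + w (x-w)) / (x y w^2) *)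
    intros x y w Hx Hy Hw.
    replace (/ x - / y - - / w ^ 2 * (x - y)) with
      ((/ w * / w * / y * (y - w) + / w * / x * / y * (x - w)) * (x - y))
      by (field; lra).
    rewrite Rabs_mult; apply Rmult_le_compat_r; [apply Rabs_pos|].
    destruct (Hb x Hx), (Hb y Hy), (Hb w Hw).
    abs_tri; rewrite !Rabs_mult.
    rewrite !(Rabs_pos_eq (/ _)) by lra.
    assert (B3 : forall a b c, 0 < a <= / q -> 0 < b <= / q -> 0 < c <= / q ->
      a * b * c <= / q ^ 3 + / q ^ 2).
    { intros a b c Ha Hb' Hc; apply Rle_trans with (/ q * / q * / q).
      - apply prod3_le; lra.
      - assert (0 < / q ^ 2) by pos.
        replace (/ q * / q * / q) with (/ q ^ 3) by (field; lra); lra. }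
    rewrite Rmult_plus_distr_l, Rplus_comm.
    apply Rplus_le_compat; apply Rmult_le_compat_r; try apply Rabs_pos; now apply B3.
  - intros x Hx; destruct (Hb x Hx).
    rewrite Rabs_Ropp, Rabs_pos_eq by (left; apply Rinv_0_lt_compat, pow_lt; lra).
    assert (/ x ^ 2 <= / q ^ 2).
    { apply Rinv_le_contravar; [now apply pow_lt|apply pow_incr; lra]. }
    assert (0 < / q ^ 3) by now apply Rinv_0_lt_compat, pow_lt.
    lra.
  - intros x Hx; apply continuous_Rinv; lra.
  - intros x Hx; cont; apply pow_nonzero; lra.
  - intros t x Hx; specialize (Hf t).
    apply Rabs_le_between in Hx; unfold q in *; lra.
Qed.

Lemma smooth_sqrt f p :
  0 < p -> (forall t, p <= f z0 t) -> smooth f ->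
  smooth (fun z t => sqrt (f z t)).
Proof.
  intros Hp Hf Hs; set (q := p / 2).
  assert (Hq : 0 < q) by (unfold q; lra).
  set (r := sqrt q).
  assert (Hr : 0 < r) by now apply sqrt_lt_R0.
  assert (Hb : forall x, q <= x -> r <= sqrt x /\ sqrt x * sqrt x = x).
  { intros x Hx; split; [now apply sqrt_le_1_alt|apply sqrt_sqrt; lra]. }
  apply (smooth_comp sqrt (fun x => / (2 * sqrt x)) (fun x => q <= x) q (/ r ^ 3 + / r));
    try assumption.
  - (* with X = sqrt x, etc., the left side is
       (x-y) ((w-x)/(W+X) + (w-y)/(W+Y)) / (2 W (X+Y)) *)
    intros x y w Hx Hy Hw.
    destruct (Hb x Hx) as [X1 X2], (Hb y Hy) as [Y1 Y2], (Hb w Hw) as [W1 W2].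
    set (X := sqrt x) in *; set (Y := sqrt y) in *; set (W := sqrt w) in *.
    replace (X - Y - / (2 * W) * (x - y)) with
      (((/ (2 * W) * / (X + Y) * / (W + X)) * (w - x)
        + (/ (2 * W) * / (X + Y) * / (W + Y)) * (w - y)) * (x - y))
      by (rewrite <- X2, <- Y2, <- W2; field; lra).
    clearbody X Y W.
    rewrite Rabs_mult; apply Rmult_le_compat_r; [apply Rabs_pos|].
    abs_tri; rewrite !Rabs_mult.
    rewrite (Rabs_minus_sym w x), (Rabs_minus_sym w y).
    assert (HI : forall u, r <= u -> 0 < / u <= / r).
    { intros u Hu; split; [apply Rinv_0_lt_compat; lra|].
      apply Rinv_le_contravar; lra. }
    destruct (HI (2 * W) ltac:(lra)), (HI (X + Y) ltac:(lra)),
      (HI (W + X) ltac:(lra)), (HI (W + Y) ltac:(lra)).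
    rewrite !(Rabs_pos_eq (/ _)) by lra.
    assert (B3 : forall a b c, 0 < a <= / r -> 0 < b <= / r -> 0 < c <= / r ->
      a * b * c <= / r ^ 3 + / r).
    { intros a b c Ha Hb' Hc; apply Rle_trans with (/ r * / r * / r).
      - apply prod3_le; lra.
      - assert (0 < / r) by pos.
        replace (/ r * / r * / r) with (/ r ^ 3) by (field; lra); lra. }
    rewrite Rmult_plus_distr_l.
    apply Rplus_le_compat; apply Rmult_le_compat_r; try apply Rabs_pos; now apply B3.
  - intros x Hx; destruct (Hb x Hx) as [X1 _].
    rewrite Rabs_pos_eq by (left; apply Rinv_0_lt_compat; lra).
    assert (/ (2 * sqrt x) <= / r) by (apply Rinv_le_contravar; lra).
    assert (0 < / r ^ 3) by now apply Rinv_0_lt_compat, pow_lt.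
    lra.
  - intros x _; apply continuous_sqrt.
  - intros x Hx; destruct (Hb x Hx) as [X1 _]; cont; lra.
  - intros t x Hx; specialize (Hf t).
    apply Rabs_le_between in Hx; unfold q in *; lra.
Qed.

Lemma smooth_div f g p :
  0 < p -> (forall t, p <= g z0 t) -> smooth f -> smooth g ->
  smooth (fun z t => f z t / g z t).
Proof.
  intros Hp Hpg Hf Hg; apply (smooth_mult f (fun z t => / g z t)); [exact Hf|].
  now apply (smooth_inv g p).
Qed.

Lemma smooth_pow f n : smooth f -> smooth (fun z t => f z t ^ n).
Proof.
  intros H; induction n as [|n IH]; simpl; [apply smooth_const|].
  now apply smooth_mult.
Qed.

End Closure.

(** * The contraction that produces periodic solutions of the slow equations *)

Definition ext (y : ax -> R) (e : R) : point :=
  fun o => match o with Some i => y i | None => e end.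

Definition kron (i j : ax) : R :=
  match i, j with XA, XA | XB, XB | XC, XC => 1 | _, _ => 0 end.

Definition bump (z : point) (j : ax) (h : R) : point :=
  fun o => match o with Some i => z (Some i) + kron i j * h | None => z None end.

Lemma ax_delta (Q : ax -> R -> Prop) :
  (forall i, exists d, 0 < d /\ Q i d) ->
  (forall i d d', d' <= d -> Q i d -> Q i d') ->
  exists d, 0 < d /\ forall i, Q i d.
Proof.
  intros H Hm.
  destruct (H XA) as [a [Ha QA]], (H XB) as [b [Hb QB]], (H XC) as [c [Hc QC]].
  exists (Rmin a (Rmin b c)); split; [repeat apply Rmin_pos; easy|].
  intros [].
  - apply (Hm _ a); [apply Rmin_l|easy].
  - apply (Hm _ b); [eapply Rle_trans; [apply Rmin_r|apply Rmin_l]|easy].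
  - apply (Hm _ c); [eapply Rle_trans; [apply Rmin_r|apply Rmin_r]|easy].
Qed.

Lemma s3_linear_bound (a v : ax -> R) (b : R) :
  (forall i, Rabs (v i) <= b) ->
  Rabs (s3 (fun i => a i * v i)) <= s3 (fun i => Rabs (a i)) * b.
Proof.
  intros H; unfold s3.
  abs_tri.
  eapply Rle_trans; [apply Rplus_le_compat_r, Rabs_triang|].
  rewrite !Rabs_mult.
  assert (Hb : forall i, Rabs (a i) * Rabs (v i) <= Rabs (a i) * b)
    by (intros i; apply Rmult_le_compat_l; [apply Rabs_pos|apply H]).
  pose proof (Hb XA); pose proof (Hb XB); pose proof (Hb XC); lra.
Qed.

Section Averaging.

Variables (z0 : point) (F : ax -> point -> R -> R)
  (d : ax -> option ax -> R -> R) (M : R).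
Hypothesis HF : forall i, C1at z0 (F i) (d i) M.
Hypothesis Hz0 : z0 None = 0.
Hypothesis Hmean : forall i, RInt (F i z0) 0 (2 * PI) = 0.

Let T := 2 * PI.

Lemma T_pos : 0 < T.
Proof. unfold T; pose proof PI_RGT_0; lra. Qed.

Lemma M_pos : 0 <= M.
Proof. exact (C1_M_pos _ _ _ _ (HF XA)). Qed.

Lemma F_z0_cont i t : continuous (F i z0) t.
Proof.
  destruct (C1_cont _ _ _ _ (HF i)) as [de [Hde H]].
  apply (H (fun _ => z0)); [intros; apply cont_const|].
  intros; rewrite dist4_refl; lra.
Qed.

Lemma dist4_bump j h : dist4 (bump z0 j h) z0 = Rabs h.
Proof.
  unfold dist4, s4, s3, bump, kron; destruct j.
  all: rewrite Rminus_diag, ?Rmult_0_l, ?Rplus_0_r, !Rminus_diag, Rabs_R0.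
  all: replace (_ + 1 * h - _) with h by ring; ring.
Qed.

(** Strictness is uniform in t, so the error e / (2 T) |h| of the integrand adds up to e / 2 |h|
    over a period. *)
Lemma RInt_jacobian i j :
  is_derive (fun h => RInt (F i (bump z0 j h)) 0 T) 0 (RInt (d i (Some j)) 0 T).
Proof.
  pose proof T_pos as HT.
  apply is_derive_Reals; intros e He.
  destruct (C1_strict _ _ _ _ (HF i) (e / (2 * T))) as [d1 [Hd1 H1]];
    [apply Rdiv_lt_0_compat; lra|].
  destruct (C1_cont _ _ _ _ (HF i)) as [d2 [Hd2 H2]].
  assert (Hm : 0 < Rmin d1 d2) by now apply Rmin_pos.
  exists (mkposreal _ Hm); intros h Hh0 Hh; simpl in Hh.
  assert (Hh1 : Rabs h <= d1)
    by (left; eapply Rlt_le_trans; [exact Hh|apply Rmin_l]).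
  assert (Hh2 : Rabs h <= d2)
    by (left; eapply Rlt_le_trans; [exact Hh|apply Rmin_r]).
  rewrite Rplus_0_l.
  (* [bump z0 j 0] agrees with [z0] only coordinatewise; the strict estimate at distance 0 shows
     that [F i] does not distinguish them. *)
  assert (E0 : RInt (F i (bump z0 j 0)) 0 T = RInt (F i z0) 0 T).
  { assert (Hb : dist4 (bump z0 j 0) z0 = 0) by (rewrite dist4_bump, Rabs_R0; easy).
    apply RInt_ext_R; intros t.
    assert (Hs := H1 t (bump z0 j 0) z0 ltac:(lra) ltac:(rewrite dist4_refl; lra)).
    rewrite Hb, Rmult_0_r in Hs.
    assert (E : forall o, bump z0 j 0 o = z0 o)
      by (intros [i'|]; simpl; [ring|easy]).
    unfold s4, s3 in Hs; rewrite !E in Hs.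
    replace (_ - _ - _) with (F i (bump z0 j 0) t - F i z0 t) in Hs by ring.
    pose proof (Rabs_pos (F i (bump z0 j 0) t - F i z0 t)) as Hp.
    assert (E1 : Rabs (F i (bump z0 j 0) t - F i z0 t) = 0) by lra.
    apply Rabs_eq_0 in E1; lra. }
  rewrite E0.
  assert (Hc : forall t, continuous (F i (bump z0 j h)) t).
  { apply (H2 (fun _ => bump z0 j h)); [intros; apply cont_const|].
    intros; rewrite dist4_bump; exact Hh2. }
  assert (Hd : forall t, continuous (d i (Some j)) t)
    by apply (C1_d_cont _ _ _ _ (HF i)).
  set (g := fun t => 1 * F i (bump z0 j h) t + -1 * F i z0 t + - h * d i (Some j) t).
  assert (Eg : RInt g 0 T
    = RInt (F i (bump z0 j h)) 0 T - RInt (F i z0) 0 T - h * RInt (d i (Some j)) 0 T).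
  { unfold g; rewrite (RInt_lin3 (F i (bump z0 j h)) (F i z0) (d i (Some j)));
      [toR; ring|exact Hc|apply F_z0_cont|exact Hd]. }
  assert (Hg : Rabs (RInt g 0 T) <= (T - 0) * (e / (2 * T) * Rabs h)).
  { apply RInt_abs_le; [lra| |].
    - intros t; unfold g; cont; [apply Hc|apply F_z0_cont|apply Hd].
    - intros t.
      assert (Hs := H1 t (bump z0 j h) z0 ltac:(rewrite dist4_bump; lra)
        ltac:(rewrite dist4_refl; lra)).
      rewrite dist4_bump in Hs.
      eapply Rle_trans; [|exact Hs]; right; f_equal.
      unfold g, s4, s3, bump, kron; destruct j; ring. }
  rewrite Eg in Hg.
  match goal with |- Rabs ?x < _ => replace x with
    ((RInt (F i (bump z0 j h)) 0 T - RInt (F i z0) 0 T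
      - h * RInt (d i (Some j)) 0 T) / h) by (field; exact Hh0) end.
  unfold Rdiv; rewrite Rabs_mult, Rabs_inv.
  assert (Hah : 0 < Rabs h) by now apply Rabs_pos_lt.
  apply (Rmult_lt_reg_r (Rabs h)); [easy|].
  rewrite Rmult_assoc, Rinv_l, Rmult_1_r by lra.
  replace ((T - 0) * (e / (2 * T) * Rabs h)) with (e / 2 * Rabs h) in Hg
    by (field; lra).
  nra.
Qed.

Section Scheme.

(** [P] inverts the Jacobian of the mean and [A] bounds its row sums; [del] is the radius of the
    ball of unknowns, [delta] that of the neighborhood where [F] is controlled, and [eta] the
    strictness there. *)
Variables (P : ax -> ax -> R) (A eps mu del eta delta : R).

Let J i j := RInt (d i (Some j)) 0 T.
Let kap := eps / mu.

Hypothesis HPJ : forall i k, s3 (fun j => P i j * J j k) = kron i k.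
Hypothesis HA : forall i, s3 (fun j => Rabs (P i j)) <= A.
Hypothesis Heps : 0 < eps.
Hypothesis Hmu : 0 < mu.
Hypothesis Heta : 0 < eta.
Hypothesis Hdel : 0 < del.
Hypothesis Hed : eps <= del.
Hypothesis Hkap : kap <= 1.
Hypothesis Hdd : 7 * del <= delta.
Hypothesis HL : forall i t z z', dist4 z z0 <= delta -> dist4 z' z0 <= delta ->
  Rabs (F i z t - F i z' t) <= (M + 1) * dist4 z z'.
Hypothesis HS : forall i t z z', dist4 z z0 <= delta -> dist4 z' z0 <= delta ->
  Rabs (F i z t - F i z' t - s4 (fun o => d i o t * (z o - z' o)))
    <= eta * dist4 z z'.
Hypothesis HC : forall i (Z : R -> point),
  (forall o t, continuous (fun t => Z t o) t) ->
  (forall t, dist4 (Z t) z0 <= delta) ->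
  forall t, continuous (fun t => F i (Z t) t) t.

(* An unknown U encodes the initial value c i = U (i, None) and the rescaled
   oscillating part V i t = U (i, Some t); the curve is c + kap V. *)
Let unk : Type := ((ax * option R) -> R)%type.

Let curve (U : unk) (t : R) : point :=
  ext (fun i => U (i, None) + kap * U (i, Some t)) eps.

Let rhs (U : unk) (i : ax) (t : R) : R := F i (curve U t) t.

Let mean (U : unk) (i : ax) : R := RInt (rhs U i) 0 T.

(** A Newton step with frozen inverse Jacobian for c, and the primitive without its linear drift for
    V. At a fixed point [P] annihilates the mean, so the mean vanishes, the drift disappears and kap
    V is eps times the primitive. *)
Let Phi (U : unk) : unk := fun x =>
  match x with
  | (i, None) => U (i, None) - s3 (fun j => P i j * mean U j)
  | (i, Some t) => mu * (RInt (rhs U i) 0 t - t / T * mean U i)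
  end.

Let start : unk := fun x =>
  match x with (i, None) => z0 (Some i) | (_, Some _) => 0 end.

Let good (U : unk) : Prop := forall i,
  Rabs (U (i, None) - z0 (Some i)) <= del /\
  (forall t, continuous (fun t => U (i, Some t)) t) /\
  (forall t, Rabs (U (i, Some t)) <= del) /\
  (forall t, U (i, Some (t + T)) = U (i, Some t)).

(** The bounds for c and V are separate because the final estimate proves the c-part to be of order
    eps while the V-part is only known to be at most [del]. *)
Let close (U U' : unk) (dc dV : R) : Prop :=
  (forall i, Rabs (U (i, None) - U' (i, None)) <= dc) /\
  (forall i t, Rabs (U (i, Some t) - U' (i, Some t)) <= dV).

Lemma kap_pos : 0 < kap.
Proof. unfold kap; now apply Rdiv_lt_0_compat. Qed.

(** Each slow coordinate is off by at most del + kap del <= 2 del, and eps <= del: this is the 7 in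
    7 del <= delta. *)
Lemma good_dist U t : good U -> dist4 (curve U t) z0 <= delta.
Proof.
  intros H; pose proof kap_pos as Hk.
  unfold dist4, s4, s3, curve, ext; rewrite Hz0, Rminus_0_r, (Rabs_pos_eq eps) by lra.
  assert (Hi : forall i,
    Rabs (U (i, None) + kap * U (i, Some t) - z0 (Some i)) <= 2 * del).
  { intros i; destruct (H i) as [H1 [_ [H3 _]]]; specialize (H3 t).
    replace (_ - _) with ((U (i, None) - z0 (Some i)) + kap * U (i, Some t)) by ring.
    abs_tri.
    rewrite Rabs_mult, (Rabs_pos_eq kap) by lra.
    assert (kap * Rabs (U (i, Some t)) <= 1 * del)
      by (apply Rmult_le_compat; [lra|apply Rabs_pos|lra|lra]).
    lra. }
  pose proof (Hi XA); pose proof (Hi XB); pose proof (Hi XC); lra.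
Qed.

Lemma rhs_cont U i t : good U -> continuous (rhs U i) t.
Proof.
  intros H; apply (HC i (curve U)); [|intros; now apply good_dist].
  intros [j|] s; unfold curve, ext; [|apply cont_const].
  destruct (H j) as [_ [H2 _]].
  apply (cont_plus (fun _ => U (j, None))); [apply cont_const|].
  apply (cont_mult (fun _ => kap)); [apply cont_const|apply H2].
Qed.

Lemma rhs_periodic U i t : good U -> rhs U i (t + T) = rhs U i t.
Proof.
  intros H; unfold rhs.
  replace (F i (curve U (t + T)) (t + T)) with (F i (curve U (t + T)) t)
    by (symmetry; apply (C1_periodic _ _ _ _ (HF i))).
  (* The two points agree only coordinatewise; the Lipschitz bound at distance 0 identifies the
     values of [F i]. *)
  assert (Hs := HL i t (curve U (t + T)) (curve U t)
    (good_dist U _ H) (good_dist U _ H)).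
  replace (dist4 (curve U (t + T)) (curve U t)) with 0 in Hs.
  - rewrite Rmult_0_r in Hs.
    pose proof (Rabs_pos (F i (curve U (t + T)) t - F i (curve U t) t)).
    assert (E : Rabs (F i (curve U (t + T)) t - F i (curve U t) t) = 0) by lra.
    apply Rabs_eq_0 in E; lra.
  - unfold dist4, s4, s3, curve, ext.
    assert (E : forall j, U (j, Some (t + T)) = U (j, Some t))
      by (intros j; apply (H j)).
    rewrite !E, !Rminus_diag, Rabs_R0; ring.
Qed.

Lemma Phi_periodic U i t : good U ->
  Phi U (i, Some (t + T)) = Phi U (i, Some t).
Proof.
  intros H; unfold Phi; f_equal; apply oscillation_periodic;
    [exact T_pos|intros; now apply rhs_cont|intros; now apply rhs_periodic].
Qed.

Lemma curve_dist U U' dc dV t :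
  close U U' dc dV ->
  dist4 (curve U t) (curve U' t) <= 3 * (dc + kap * dV).
Proof.
  intros [H1 H2]; pose proof kap_pos as Hk.
  unfold dist4, s4, s3, curve, ext; rewrite Rminus_diag, Rabs_R0.
  assert (Hi : forall i, Rabs (U (i, None) + kap * U (i, Some t)
    - (U' (i, None) + kap * U' (i, Some t))) <= dc + kap * dV).
  { intros i.
    replace (_ - _) with ((U (i, None) - U' (i, None))
      + kap * (U (i, Some t) - U' (i, Some t))) by ring.
    abs_tri.
    rewrite Rabs_mult, (Rabs_pos_eq kap) by lra.
    apply Rplus_le_compat; [apply H1|].
    apply Rmult_le_compat_l; [lra|apply H2]. }
  pose proof (Hi XA); pose proof (Hi XB); pose proof (Hi XC); lra.
Qed.

(** Since P J is the identity, the difference of Newton steps is P applied to J Dc minus the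
    difference of the means. There the linear c-part cancels, leaving the V-part of the
    linearization, of size kap dV, and the strictness error, of size [eta]. *)
Lemma Phi_c_estimate U U' dc dV i : good U -> good U' ->
  close U U' dc dV ->
  Rabs (Phi U (i, None) - Phi U' (i, None))
    <= A * (T * (3 * M * (kap * dV) + eta * (3 * (dc + kap * dV)))).
Proof.
  intros HU HU' Hcl; pose proof Hcl as [H1 H2].
  pose proof T_pos as HT; pose proof kap_pos as Hk.
  pose proof M_pos as HM.
  set (Dc := fun k => U (k, None) - U' (k, None)).
  set (B := T * (3 * M * (kap * dV) + eta * (3 * (dc + kap * dV)))).
  assert (Hj : forall j, Rabs (s3 (fun k => J j k * Dc k) - (mean U j - mean U' j)) <= B).
  { intros j.
    set (g := fun t => 1 * (d j (Some XA) t * Dc XA + d j (Some XB) t * Dc XB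
      + d j (Some XC) t * Dc XC) + -1 * rhs U j t + 1 * rhs U' j t).
    assert (Hd : forall o t, continuous (d j o) t)
      by (intros o t; apply (C1_d_cont _ _ _ _ (HF j))).
    assert (Hr : forall t, continuous (rhs U j) t) by (intros; now apply rhs_cont).
    assert (Hr' : forall t, continuous (rhs U' j) t) by (intros; now apply rhs_cont).
    replace (s3 (fun k => J j k * Dc k) - (mean U j - mean U' j)) with (RInt g 0 T).
    2:{ unfold g; rewrite (RInt_lin3 (fun t => d j (Some XA) t * Dc XA
          + d j (Some XB) t * Dc XB + d j (Some XC) t * Dc XC) (rhs U j) (rhs U' j));
          [|intros; cont; apply Hd|exact Hr|exact Hr'].
        rewrite (RInt_ext_R _ (fun t => Dc XA * d j (Some XA) t
          + Dc XB * d j (Some XB) t + Dc XC * d j (Some XC) t)) by (intros; ring).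
        rewrite (RInt_lin3 (d j (Some XA)) (d j (Some XB)) (d j (Some XC))) by apply Hd.
        unfold mean, s3, J; toR; ring. }
    replace B with ((T - 0) * (3 * M * (kap * dV) + eta * (3 * (dc + kap * dV))))
      by (unfold B; ring).
    apply RInt_abs_le; [lra| |].
    - intros t; unfold g; cont; try apply Hd; [apply Hr|apply Hr'].
    - intros t.
      pose proof (HS j t (curve U t) (curve U' t) (good_dist U t HU)
        (good_dist U' t HU')) as Hs.
      pose proof (curve_dist U U' dc dV t Hcl) as Hcd.
      assert (Hs2 : Rabs (F j (curve U t) t - F j (curve U' t) t
        - s4 (fun o => d j o t * (curve U t o - curve U' t o)))
        <= eta * (3 * (dc + kap * dV))).
      { eapply Rle_trans; [exact Hs|]; apply Rmult_le_compat_l; lra. }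
      set (DV := fun k => U (k, Some t) - U' (k, Some t)).
      assert (HV : Rabs (kap * s3 (fun k => d j (Some k) t * DV k))
        <= 3 * M * (kap * dV)).
      { rewrite Rabs_mult, (Rabs_pos_eq kap) by lra.
        replace (3 * M * (kap * dV)) with (kap * (3 * M * dV)) by ring.
        mul_mono.
        eapply Rle_trans.
        - apply (s3_linear_bound (fun k => d j (Some k) t) DV dV).
          intros k; apply H2.
        - apply Rmult_le_compat_r.
          + eapply Rle_trans; [apply Rabs_pos|apply (H2 XA t)].
          + unfold s3; pose proof (C1_d_bound _ _ _ _ (HF j)) as Hb.
            pose proof (Hb (Some XA) t); pose proof (Hb (Some XB) t).
            pose proof (Hb (Some XC) t); lra. }
      replace (g t) with
        (- (kap * s3 (fun k => d j (Some k) t * DV k))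
         + - (F j (curve U t) t - F j (curve U' t) t
            - s4 (fun o => d j o t * (curve U t o - curve U' t o))))
        by (unfold g, rhs, s4, s3, DV, Dc, curve, ext; ring).
      abs_tri; rewrite !Rabs_Ropp; lra. }
  replace (Phi U (i, None) - Phi U' (i, None)) with
    (s3 (fun j => P i j * (s3 (fun k => J j k * Dc k) - (mean U j - mean U' j)))).
  - eapply Rle_trans; [apply (s3_linear_bound (P i)); exact Hj|].
    apply Rmult_le_compat_r; [|apply HA].
    eapply Rle_trans; [apply Rabs_pos|apply (Hj XA)].
  - unfold Phi.
    assert (E : U (i, None) - U' (i, None)
      = s3 (fun k => s3 (fun j => P i j * J j k) * Dc k)).
    { unfold s3 at 1; rewrite !HPJ; unfold Dc, kron; destruct i; ring. }
    transitivity (s3 (fun k => s3 (fun j => P i j * J j k) * Dc k)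
      - s3 (fun j => P i j * (mean U j - mean U' j))).
    + unfold s3; ring.
    + rewrite <- E; unfold s3; ring.
Qed.

Lemma Phi_V_bound U i t b : good U ->
  (forall t, Rabs (rhs U i t) <= b) ->
  Rabs (Phi U (i, Some t)) <= mu * (2 * T * b).
Proof.
  intros HU Hb; unfold Phi; rewrite Rabs_mult, (Rabs_pos_eq mu) by lra.
  mul_mono; apply oscillation_bound;
    [exact T_pos|intros; now apply rhs_cont|intros; now apply rhs_periodic|exact Hb].
Qed.

(** The oscillation operator is linear, so its bound applies to the difference of the right-hand
    sides; smallness comes from the factor [mu]. *)
Lemma Phi_V_estimate U U' dc dV i t : good U -> good U' ->
  close U U' dc dV ->
  Rabs (Phi U (i, Some t) - Phi U' (i, Some t))
    <= mu * (2 * T * ((M + 1) * (3 * (dc + kap * dV)))).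
Proof.
  intros HU HU' Hcl; pose proof M_pos as HM.
  assert (Hr : forall t, continuous (rhs U i) t) by (intros; now apply rhs_cont).
  assert (Hr' : forall t, continuous (rhs U' i) t) by (intros; now apply rhs_cont).
  set (f := fun t => rhs U i t - rhs U' i t).
  assert (E : Phi U (i, Some t) - Phi U' (i, Some t)
    = mu * (RInt f 0 t - t / T * RInt f 0 T)).
  { unfold f; rewrite !RInt_minus_R by assumption; unfold Phi, mean; ring. }
  rewrite E, Rabs_mult, (Rabs_pos_eq mu) by lra.
  mul_mono; apply oscillation_bound; [exact T_pos| | |].
  - intros x; now apply cont_minus.
  - intros x; unfold f; now rewrite !rhs_periodic.
  - intros x; eapply Rle_trans; [apply HL; now apply good_dist|].
    apply Rmult_le_compat_l; [lra|now apply curve_dist].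
Qed.

Lemma start_good : good start.
Proof.
  intros i; unfold start; rewrite Rminus_diag, Rabs_R0.
  repeat split; [lra|intros; apply cont_const|intros; lra].
Qed.

Lemma rhs_start i t : Rabs (rhs start i t - F i z0 t) <= (M + 1) * eps.
Proof.
  unfold rhs; eapply Rle_trans.
  - apply HL; [apply good_dist, start_good|rewrite dist4_refl; lra].
  - right; f_equal; unfold dist4, s4, s3, curve, ext, start.
    rewrite Hz0, Rminus_0_r, (Rabs_pos_eq eps) by lra.
    rewrite !Rmult_0_r, !Rplus_0_r, !Rminus_diag, Rabs_R0; ring.
Qed.

Lemma Phi_start_c i :
  Rabs (Phi start (i, None) - start (i, None)) <= A * (T * ((M + 1) * eps)).
Proof.
  pose proof T_pos as HT; pose proof M_pos as HM.
  assert (Hm : forall j, Rabs (mean start j) <= T * ((M + 1) * eps)).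
  { intros j.
    replace (mean start j) with (RInt (fun t => rhs start j t - F j z0 t) 0 T).
    - eapply Rle_trans; [apply RInt_abs_le; [lra| |apply rhs_start]|right; ring].
      intros t; apply (cont_minus (rhs start j));
        [apply rhs_cont, start_good|apply F_z0_cont].
    - rewrite RInt_minus_R; [|intros; apply rhs_cont, start_good|apply F_z0_cont].
      unfold T at 2; rewrite Hmean; unfold mean; toR; ring. }
  unfold Phi.
  replace (_ - _) with (- s3 (fun j => P i j * mean start j)) by ring.
  rewrite Rabs_Ropp.
  eapply Rle_trans; [apply (s3_linear_bound (P i)); exact Hm|].
  apply Rmult_le_compat_r; [|apply HA].
  apply Rmult_le_pos; [lra|apply Rmult_le_pos; lra].
Qed.

Lemma Phi_start_V i t :
  Rabs (Phi start (i, Some t)) <= mu * (2 * T * (M + (M + 1) * eps)).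
Proof.
  apply Phi_V_bound; [apply start_good|]; intros s.
  replace (rhs start i s) with (F i z0 s + (rhs start i s - F i z0 s)) by ring.
  abs_tri.
  apply Rplus_le_compat; [apply (C1_bound _ _ _ _ (HF i))|apply rhs_start].
Qed.

(** The first two conditions make the c-component contract by 1/4, the fourth makes the V-component
    contract by 1/2. The third and fifth say that [start] moves by at most del / 2, so the ball of
    radius [del] is mapped into itself. *)
Hypothesis Hsmall1 : A * (T * (6 * eta)) <= 1 / 8.
Hypothesis Hsmall2 : A * (T * (3 * M * kap)) <= 1 / 8.
Hypothesis Hsmall3 : A * (T * ((M + 1) * eps)) <= del / 2.
Hypothesis Hsmall4 : mu * (2 * T * ((M + 1) * 6)) <= 1 / 2.
Hypothesis Hsmall5 : mu * (2 * T * (M + (M + 1) * eps)) <= del / 2.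

Lemma A_pos : 0 <= A.
Proof.
  eapply Rle_trans; [|apply (HA XA)]; unfold s3.
  repeat apply Rplus_le_le_0_compat; apply Rabs_pos.
Qed.

Lemma Phi_contraction U U' b : good U -> good U' ->
  (forall x, Rabs (U x - U' x) <= b) ->
  forall x, Rabs (Phi U x - Phi U' x) <= 1 / 2 * b.
Proof.
  intros HU HU' H [i [t|]]; pose proof T_pos as HT; pose proof M_pos as HM;
    pose proof kap_pos as Hk; pose proof A_pos as HA0.
  all: assert (Hb : 0 <= b)
    by (eapply Rle_trans; [apply Rabs_pos|apply (H (i, None))]).
  - eapply Rle_trans; [apply (Phi_V_estimate U U' b b); [exact HU|exact HU'|split; auto]|].
    apply Rle_trans with (mu * (2 * T * ((M + 1) * 6)) * b);
      [|apply Rmult_le_compat_r; lra].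
    replace (mu * (2 * T * ((M + 1) * 6)) * b)
      with (mu * (2 * T * ((M + 1) * (3 * (b + 1 * b))))) by ring.
    mul_mono; mul_mono.
    mul_mono; mul_mono.
    apply Rplus_le_compat_l, Rmult_le_compat_r; lra.
  - eapply Rle_trans; [apply (Phi_c_estimate U U' b b); [exact HU|exact HU'|split; auto]|].
    assert (T1 : A * (T * (3 * M * kap)) * b <= 1 / 8 * b)
      by (apply Rmult_le_compat_r; lra).
    assert (T2 : A * (T * (6 * eta)) * b <= 1 / 8 * b)
      by (apply Rmult_le_compat_r; lra).
    assert (T3 : A * (T * (eta * (3 * (b + kap * b)))) <= A * (T * (6 * eta)) * b).
    { replace (A * (T * (6 * eta)) * b) with (A * (T * (eta * (3 * (b + 1 * b))))) by ring.
      mul_mono; mul_mono.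
      mul_mono; mul_mono.
      apply Rplus_le_compat_l, Rmult_le_compat_r; lra. }
    replace (A * (T * (3 * M * (kap * b) + eta * (3 * (b + kap * b))))) with
      (A * (T * (3 * M * kap)) * b + A * (T * (eta * (3 * (b + kap * b))))) by ring.
    lra.
Qed.

Lemma Phi_start x : Rabs (Phi start x - start x) <= del / 2.
Proof.
  destruct x as [i [t|]].
  - simpl start; rewrite Rminus_0_r.
    eapply Rle_trans; [apply Phi_start_V|exact Hsmall5].
  - eapply Rle_trans; [apply Phi_start_c|exact Hsmall3].
Qed.

Lemma Phi_good U : good U -> good (Phi U).
Proof.
  intros HU.
  assert (Hx : forall x, Rabs (Phi U x - start x) <= del).
  { intros x; replace (Phi U x - start x) with
      ((Phi U x - Phi start x) + (Phi start x - start x)) by ring.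
    abs_tri.
    pose proof (Phi_start x).
    assert (Rabs (Phi U x - Phi start x) <= 1 / 2 * del); [|lra].
    apply Phi_contraction; [exact HU|exact start_good|].
    intros [i [t|]]; simpl start.
    - rewrite Rminus_0_r; apply (HU i).
    - apply (HU i). }
  intros i; repeat split.
  - apply (Hx (i, None)).
  - intros t; unfold Phi.
    apply (cont_mult (fun _ => mu)); [apply cont_const|].
    apply (cont_minus (fun t => RInt (rhs U i) 0 t) (fun t => t / T * mean U i)).
    + eapply cont_of_derive, is_derive_RInt_cont; intros; now apply rhs_cont.
    + cont; pose proof T_pos; lra.
  - intros t; specialize (Hx (i, Some t)); simpl start in Hx.
    now rewrite Rminus_0_r in Hx.
  - intros t; now apply Phi_periodic.
Qed.

Lemma good_closed (u : nat -> unk) U : (forall n, good (u n)) ->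
  (forall e, 0 < e -> exists N, forall n x,
     (N <= n)%nat -> Rabs (u n x - U x) <= e) -> good U.
Proof.
  intros Hu Hlim i.
  assert (Hle : forall x b B, (forall n, Rabs (u n x - b) <= B) -> Rabs (U x - b) <= B).
  { intros x b B Hn; apply Rle_plus_epsilon; intros e He.
    destruct (Hlim e He) as [N HN]; specialize (HN N x (le_n N)); specialize (Hn N).
    rewrite Rabs_minus_sym in HN.
    replace (U x - b) with ((U x - u N x) + (u N x - b)) by ring.
    abs_tri; lra. }
  repeat split.
  - apply Hle; intros n; apply (Hu n i).
  - apply (continuous_uniform_limit (fun n t => u n (i, Some t))).
    + intros n; apply (Hu n i).
    + intros e He; destruct (Hlim e He) as [N HN]; exists N; intros n x Hn.
      now apply HN.
  - intros t; rewrite <- (Rminus_0_r (U _)); apply Hle; intros n.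
    rewrite Rminus_0_r; apply (Hu n i).
  - intros t; apply cond_eq; intros e He.
    destruct (Hlim (e / 4) ltac:(lra)) as [N HN].
    pose proof (HN N (i, Some (t + T)) (le_n N)) as H1.
    pose proof (HN N (i, Some t) (le_n N)) as H2.
    destruct (Hu N i) as [_ [_ [_ Hp]]]; rewrite Hp in H1.
    rewrite Rabs_minus_sym in H1.
    replace (U (i, Some (t + T)) - U (i, Some t)) with
      ((U (i, Some (t + T)) - u N (i, Some t)) + (u N (i, Some t) - U (i, Some t)))
      by ring.
    eapply Rle_lt_trans; [apply Rabs_triang|]; lra.
Qed.

Hypothesis HPker : forall v, (forall i, s3 (fun j => P i j * v j) = 0) ->
  forall i, v i = 0.

Lemma scheme_solution :
  exists y : ax -> R -> R,
    (forall i t, y i (t + T) = y i t) /\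
    (forall i t, is_derive (y i) t (eps * F i (ext (fun j => y j t) eps) t)) /\
    (forall i t, Rabs (y i t - z0 (Some i))
       <= (8 * (A * (T * (3 * M * (/ mu * del) + eta * (3 * (/ mu * del)))))
           + 8 * (A * (T * (M + 1))) + / mu * del) * eps).
Proof.
  pose proof T_pos as HT; pose proof M_pos as HM; pose proof kap_pos as Hk.
  pose proof A_pos as HA0.
  destruct (banach_fixed_point _ good Phi start (1 / 2) (del / 2)) as [U [HU HfU]].
  - lra.
  - exact start_good.
  - exact Phi_good.
  - intros U U' b HU HU' Hb; now apply Phi_contraction.
  - exact Phi_start.
  - exact good_closed.
  - assert (Hmz : forall i, mean U i = 0).
    { apply HPker; intros i.
      pose proof (HfU (i, None)) as E; unfold Phi in E; lra. }
    set (y := fun i t => U (i, None) + kap * U (i, Some t)).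
    assert (Hy : forall i t, y i t = U (i, None) + eps * RInt (rhs U i) 0 t).
    { intros i t; unfold y; f_equal.
      rewrite <- (HfU (i, Some t)); unfold Phi; rewrite Hmz.
      unfold kap; field; lra. }
    exists y; split; [|split].
    + intros i t; unfold y; now rewrite (proj2 (proj2 (proj2 (HU i)))).
    + intros i t.
      apply (is_derive_ext (fun t => U (i, None) + eps * RInt (rhs U i) 0 t));
        [intros s; now rewrite Hy|].
      replace (eps * F i (ext (fun j => y j t) eps) t) with (0 + eps * rhs U i t)
        by (unfold rhs, curve, y; ring).
      apply (is_derive_plus (fun _ => U (i, None))); [apply (is_derive_const (U (i, None)))|].
      apply (is_derive_scal (fun t => RInt (rhs U i) 0 t)), is_derive_RInt_cont.
      intros; now apply rhs_cont.
    (* Membership in the ball gives only the distance [del]. Comparing U with [Phi start] gives dc /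
       16 + Q eps for each slow coordinate of c; summing three of them absorbs dc and leaves order
       eps. *)
    + set (Q := A * (T * (3 * M * (/ mu * del) + eta * (3 * (/ mu * del))))
        + A * (T * (M + 1))).
      assert (HV : forall i t, Rabs (U (i, Some t)) <= del) by (intros i; apply (HU i)).
      set (dc := s3 (fun i => Rabs (U (i, None) - z0 (Some i)))).
      assert (Hdc : forall i, Rabs (U (i, None) - z0 (Some i)) <= dc).
      { intros i; unfold dc, s3.
        pose proof (Rabs_pos (U (XA, None) - z0 (Some XA))).
        pose proof (Rabs_pos (U (XB, None) - z0 (Some XB))).
        pose proof (Rabs_pos (U (XC, None) - z0 (Some XC))).
        destruct i; lra. }
      assert (Hdc0 : 0 <= dc) by (eapply Rle_trans; [apply Rabs_pos|apply (Hdc XA)]).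
      assert (Hi : forall i, Rabs (U (i, None) - z0 (Some i)) <= dc / 16 + Q * eps).
      { intros i.
        replace (U (i, None) - z0 (Some i)) with
          ((Phi U (i, None) - Phi start (i, None))
           + (Phi start (i, None) - start (i, None)))
          by (rewrite HfU; simpl start; ring).
        abs_tri.
        pose proof (Phi_start_c i) as T2.
        assert (T3 : forall i t, Rabs (U (i, Some t) - start (i, Some t)) <= del)
          by (intros; simpl start; rewrite Rminus_0_r; apply HV).
        assert (T1 := Phi_c_estimate U start dc del i HU start_good (conj Hdc T3)).
        assert (T4 : A * (T * (6 * eta)) * (dc / 2) <= 1 / 8 * (dc / 2))
          by (apply Rmult_le_compat_r; lra).
        replace (A * (T * (3 * M * (kap * del) + eta * (3 * (dc + kap * del)))))
          with (A * (T * (6 * eta)) * (dc / 2)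
            + A * (T * (3 * M * (/ mu * del) + eta * (3 * (/ mu * del)))) * eps) in T1
          by (unfold kap; field; lra).
        unfold Q; lra. }
      assert (Hdc2 : dc <= 8 * Q * eps).
      { assert (HS3 : dc <= 3 * (dc / 16 + Q * eps)).
        { unfold dc at 1, s3; pose proof (Hi XA); pose proof (Hi XB);
            pose proof (Hi XC); lra. }
        lra. }
      intros i t; unfold y.
      replace (_ - _) with ((U (i, None) - z0 (Some i)) + kap * U (i, Some t)) by ring.
      abs_tri.
      rewrite Rabs_mult, (Rabs_pos_eq kap) by lra.
      specialize (Hdc i).
      assert (kap * Rabs (U (i, Some t)) <= / mu * del * eps).
      { unfold kap; replace (/ mu * del * eps) with (eps / mu * del) by (field; lra).
        apply Rmult_le_compat_l; [fold kap; lra|apply HV]. }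
      unfold Q in Hdc2; lra.
Qed.

End Scheme.

End Averaging.

(** The constants are chosen in the order eta (from the size of [P]), delta (from eta), del, mu, and
    finally eps. [J] is given as the derivative of the mean, which [RInt_jacobian] identifies with
    the integral of the uniform partial derivatives. *)
Theorem averaging (z0 : point) (F : ax -> point -> R -> R) (J P : ax -> ax -> R) :
  z0 None = 0 ->
  (forall i, smooth z0 (F i)) ->
  (forall i, RInt (F i z0) 0 (2 * PI) = 0) ->
  (forall i j,
     is_derive (fun h => RInt (F i (bump z0 j h)) 0 (2 * PI)) 0 (J i j)) ->
  (forall i k, s3 (fun j => P i j * J j k) = kron i k) ->
  (forall v, (forall i, s3 (fun j => P i j * v j) = 0) -> forall i, v i = 0) ->
  exists C eps0, 0 < C /\ 0 < eps0 /\ forall eps, 0 < eps < eps0 ->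
    exists y : ax -> R -> R,
      (forall i t, y i (t + 2 * PI) = y i t) /\
      (forall i t, is_derive (y i) t (eps * F i (ext (fun j => y j t) eps) t)) /\
      (forall i t, Rabs (y i t - z0 (Some i)) <= C * eps).
Proof.
  intros Hz0 Hs Hmean HJ HPJ HPker.
  assert (HF : exists d M, forall i, C1at z0 (F i) (d i) M).
  { destruct (Hs XA) as [da [Ma HA]], (Hs XB) as [db [Mb HB]],
      (Hs XC) as [dc [Mc HC]].
    pose proof (C1_M_pos _ _ _ _ HA); pose proof (C1_M_pos _ _ _ _ HB).
    pose proof (C1_M_pos _ _ _ _ HC).
    exists (fun i => match i with XA => da | XB => db | XC => dc end), (Ma + Mb + Mc).
    intros []; [apply (C1_weaken _ _ _ _ _ HA)|apply (C1_weaken _ _ _ _ _ HB)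
      |apply (C1_weaken _ _ _ _ _ HC)]; lra. }
  destruct HF as [d [M HF]].
  assert (HPJ' : forall i k,
    s3 (fun j => P i j * RInt (d j (Some k)) 0 (2 * PI)) = kron i k).
  { intros i k; rewrite <- HPJ; unfold s3.
    assert (E : forall j, RInt (d j (Some k)) 0 (2 * PI) = J j k).
    { intros j; pose proof (RInt_jacobian z0 F d M HF j k) as H1.
      rewrite <- (is_derive_unique _ _ _ H1); apply is_derive_unique, HJ. }
    now rewrite !E. }
  pose proof (C1_M_pos _ _ _ _ (HF XA)) as HM.
  pose proof PI_RGT_0 as HPI.
  set (T := 2 * PI) in *; assert (HT : 0 < T) by (unfold T; lra).
  set (A := 1 + s3 (fun i => s3 (fun j => Rabs (P i j)))).
  assert (Hrow : forall i, 0 <= s3 (fun j => Rabs (P i j))).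
  { intros i; unfold s3; repeat apply Rplus_le_le_0_compat; apply Rabs_pos. }
  assert (HA : forall i, s3 (fun j => Rabs (P i j)) <= A).
  { intros i; pose proof (Hrow XA); pose proof (Hrow XB); pose proof (Hrow XC).
    unfold A; unfold s3 at 2; destruct i; lra. }
  assert (HA1 : 1 <= A).
  { pose proof (Hrow XA); pose proof (Hrow XB); pose proof (Hrow XC).
    unfold A; unfold s3 at 1; lra. }
  clearbody A.
  (* Chosen so that A T 6 eta is exactly 1/8. *)
  set (eta := / (48 * (A * T))).
  assert (HAT : 0 < A * T) by (apply Rmult_lt_0_compat; lra).
  assert (Heta : 0 < eta) by (apply Rinv_0_lt_compat; lra).
  assert (Hdelta : exists delta, 0 < delta /\ forall i,
    (forall t z z', dist4 z z0 <= delta -> dist4 z' z0 <= delta ->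
       Rabs (F i z t - F i z' t) <= (M + 1) * dist4 z z') /\
    (forall t z z', dist4 z z0 <= delta -> dist4 z' z0 <= delta ->
       Rabs (F i z t - F i z' t - s4 (fun o => d i o t * (z o - z' o)))
         <= eta * dist4 z z') /\
    (forall Z : R -> point, (forall o t, continuous (fun t => Z t o) t) ->
       (forall t, dist4 (Z t) z0 <= delta) ->
       forall t, continuous (fun t => F i (Z t) t) t)).
  { apply ax_delta.
    - intros i; destruct (C1_lipschitz _ _ _ _ (HF i)) as [d1 [H1 L]].
      destruct (C1_strict _ _ _ _ (HF i) eta Heta) as [d2 [H2 S]].
      destruct (C1_cont _ _ _ _ (HF i)) as [d3 [H3 C]].
      exists (Rmin d1 (Rmin d2 d3)); split; [repeat apply Rmin_pos; easy|].
      set (e := Rmin d1 (Rmin d2 d3)).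
      assert (e <= d1) by rmin; assert (e <= d2) by rmin; assert (e <= d3) by rmin.
      split; [|split].
      + intros t z z' Hz Hz'; apply L; lra.
      + intros t z z' Hz Hz'; apply S; lra.
      + intros Z HZ Hd; apply C; [exact HZ|]; intros t; specialize (Hd t); lra.
    - intros i d1 d2 Hle [L [S C]]; split; [|split].
      + intros t z z' Hz Hz'; apply L; lra.
      + intros t z z' Hz Hz'; apply S; lra.
      + intros Z HZ Hd; apply C; [exact HZ|]; intros t; specialize (Hd t); lra. }
  destruct Hdelta as [delta [Hdelta HD]].
  set (del := Rmin 1 (delta / 7)).
  assert (Hdel : 0 < del) by (apply Rmin_pos; lra).
  assert (Hdel1 : del <= 1) by apply Rmin_l.
  assert (Hdel2 : 7 * del <= delta)
    by (pose proof (Rmin_r 1 (delta / 7)) as Hr; fold del in Hr; lra).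
  clearbody del.
  assert (HTM : 0 < T * (M + 1)) by (apply Rmult_lt_0_compat; lra).
  (* 24 makes the V-component a contraction by 1/2; 8 keeps the first iterate of V within del / 2,
     using eps <= del <= 1. *)
  set (mu := Rmin (/ (24 * (T * (M + 1)))) (del * / (8 * (T * (M + 1))))).
  assert (Hmu : 0 < mu).
  { apply Rmin_pos; [|apply Rmult_lt_0_compat; [lra|]]; apply Rinv_0_lt_compat; lra. }
  assert (Hmu1 : mu * (24 * (T * (M + 1))) <= 1).
  { apply Rle_trans with (/ (24 * (T * (M + 1))) * (24 * (T * (M + 1)))).
    - apply Rmult_le_compat_r; [lra|apply Rmin_l].
    - right; field; lra. }
  assert (Hmu2 : mu * (8 * (T * (M + 1))) <= del).
  { apply Rle_trans with (del * / (8 * (T * (M + 1))) * (8 * (T * (M + 1)))).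
    - apply Rmult_le_compat_r; [lra|apply Rmin_r].
    - right; field; lra. }
  clearbody mu.
  assert (HATM : 0 < A * T * (M + 1)) by (apply Rmult_lt_0_compat; lra).
  set (e1 := mu * / (24 * (A * T * (M + 1)))).
  assert (He1 : 0 < e1) by (apply Rmult_lt_0_compat; [lra|apply Rinv_0_lt_compat; lra]).
  set (e2 := del * / (2 * (A * T * (M + 1)))).
  assert (He2 : 0 < e2) by (apply Rmult_lt_0_compat; [lra|apply Rinv_0_lt_compat; lra]).
  set (C := 8 * (A * (T * (3 * M * (/ mu * del) + eta * (3 * (/ mu * del)))))
           + 8 * (A * (T * (M + 1))) + / mu * del).
  assert (HC : 0 < C).
  { assert (H1 : 0 < / mu * del)
      by (apply Rmult_lt_0_compat; [now apply Rinv_0_lt_compat|lra]).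
    assert (0 <= A * (T * (3 * M * (/ mu * del) + eta * (3 * (/ mu * del))))).
    { apply Rmult_le_pos; [lra|]; apply Rmult_le_pos; [lra|].
      apply Rplus_le_le_0_compat; apply Rmult_le_pos; lra. }
    unfold C; lra. }
  exists C, (Rmin mu (Rmin del (Rmin e1 e2))); split; [exact HC|split].
  { repeat apply Rmin_pos; easy. }
  intros eps [Heps Hlt].
  assert (L1 : eps <= mu) by (left; eapply Rlt_le_trans; [exact Hlt|rmin]).
  assert (L2 : eps <= del) by (left; eapply Rlt_le_trans; [exact Hlt|rmin]).
  assert (L3 : eps <= e1) by (left; eapply Rlt_le_trans; [exact Hlt|rmin]).
  assert (L4 : eps <= e2) by (left; eapply Rlt_le_trans; [exact Hlt|rmin]).
  assert (L3' : eps / mu * (24 * (A * T * (M + 1))) <= 1).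
  { apply Rle_trans with (e1 / mu * (24 * (A * T * (M + 1)))).
    - apply Rmult_le_compat_r; [lra|].
      apply Rmult_le_compat_r; [left; now apply Rinv_0_lt_compat|exact L3].
    - right; unfold e1; field; lra. }
  assert (L4' : eps * (2 * (A * T * (M + 1))) <= del).
  { apply Rle_trans with (e2 * (2 * (A * T * (M + 1)))).
    - apply Rmult_le_compat_r; lra.
    - right; unfold e2; field; lra. }
  assert (Hk0 : 0 < eps / mu) by now apply Rdiv_lt_0_compat.
  unfold C; eapply (scheme_solution z0 F d M HF Hz0 Hmean P A eps mu del eta delta);
    try assumption.
  - apply Rle_div_l; lra.
  - intros i; apply (HD i).
  - intros i; apply (HD i).
  - intros i; apply (HD i).
  - right; fold T; unfold eta; field; lra.
  - fold T.
    apply Rle_trans with (eps / mu * (24 * (A * T * (M + 1))) / 8); [|lra].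
    replace (A * (T * (3 * M * (eps / mu)))) with (eps / mu * (3 * (A * T * M)))
      by ring.
    replace (eps / mu * (24 * (A * T * (M + 1))) / 8)
      with (eps / mu * (3 * (A * T * (M + 1)))) by (field; lra).
    mul_mono; nra.
  - fold T; lra.
  - fold T; lra.
  - fold T.
    apply Rle_trans with (mu * (2 * T * (2 * (M + 1)))); [|lra].
    mul_mono; mul_mono.
    assert ((M + 1) * eps <= (M + 1) * 1) by (apply Rmult_le_compat_l; lra).
    lra.
Qed.

(** * Derivatives and norms of curves in the state space *)

Lemma is_derive_pair {U V : NormedModule R_AbsRing} (f : R -> U) (g : R -> V)
    (x : R) (lf : U) (lg : V) :
  is_derive f x lf -> is_derive g x lg ->
  is_derive (fun t => (f t, g t)) x (lf, lg).
Proof.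
  intros Hf Hg; unfold is_derive.
  apply (filterdiff_ext_lin _ (fun y : R => (scal y lf, scal y lg))); [|easy].
  apply (filterdiff_comp'_2 f g (fun u v => (u, v)) x (fun y => scal y lf)
    (fun y => scal y lg) (fun u v => (u, v)) Hf Hg).
  apply (filterdiff_ext_lin _ (fun t : U * V => t)); [|now intros []].
  apply (filterdiff_ext (fun t : U * V => t)); [now intros []|].
  apply filterdiff_id.
Qed.

Lemma norm_pair_le {U V : NormedModule R_AbsRing} (u : U) (v : V) :
  norm (u, v) <= norm u + norm v.
Proof.
  unfold norm at 1; simpl; unfold prod_norm; simpl.
  pose proof (norm_ge_0 u); pose proof (norm_ge_0 v).
  rewrite <- (sqrt_pow2 (norm u + norm v)) by lra.
  apply sqrt_le_1_alt; nra.
Qed.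

Lemma norm_state_le (p q : state) (e : R) :
  Rabs (fst (fst (fst p)) - fst (fst (fst q))) <= e ->
  Rabs (snd (fst (fst p)) - snd (fst (fst q))) <= e ->
  Rabs (snd (fst p) - snd (fst q)) <= e ->
  Rabs (snd p - snd q) <= e -> norm (minus p q) <= 4 * e.
Proof.
  destruct p as [[[a b] c] d], q as [[[a' b'] c'] d']; simpl.
  intros Ha Hb Hc Hd.
  change (minus (a, b, c, d) (a', b', c', d')) with
    (minus a a', minus b b', minus c c', minus d d').
  eapply Rle_trans; [apply norm_pair_le|].
  eapply Rle_trans; [apply Rplus_le_compat_r, norm_pair_le|].
  eapply Rle_trans; [apply Rplus_le_compat_r, Rplus_le_compat_r, norm_pair_le|].
  unfold norm, minus, plus, opp; simpl; unfold abs; simpl.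
  unfold Rminus in *; lra.
Qed.

(** * The system in the coordinates (A, B, chi, psi) *)

Section Coordinates.

Variables sigma beta s : R.

Definition zA (z : point) : R := z (Some XA).
Definition zB (z : point) : R := z (Some XB).
Definition zX (z : point) : R := z (Some XC).

Definition rad (z : point) : R := sqrt ((zA z + zB z) / 2).

Definition wf (z : point) (t : R) : R :=
  sqrt (zB z - (zA z + zB z) / 2 * sin t ^ 2).

Definition xif (z : point) (t : R) : R := 2 * rad z * cos t.

Definition zetaf (z : point) (t : R) : R := zB z - (zA z + zB z) * sin t ^ 2.

Definition etaf (z : point) (t : R) : R := -2 * rad z * sin t * wf z t.

(* dA/dtau = eps * rateA, dB/dtau = eps * rateB, dchi/dtau = eps * rateX and
   dpsi/dtau = speed along the perturbed flow. *)
Definition rateA (z : point) (t : R) : R :=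
  - sigma * xif z t ^ 2 + s * xif z t * zX z + beta * zetaf z t + beta * sigma.

Definition rateB (z : point) (t : R) : R :=
  - (zB z + (beta - 1) * (zetaf z t ^ 2 / zB z) + sigma * beta * (zetaf z t / zB z)).

Definition rateX (z : point) (t : R) : R := - (xif z t + sigma * zX z).

Definition speed (z : point) (t : R) : R :=
  wf z t + z None *
    (cos t * sin t * ((beta * (zetaf z t + sigma) - 2 * wf z t ^ 2) / (2 * zB z) + sigma)
     - s * zX z * sin t / (2 * rad z)).

(** Dividing by the speed makes psi the independent variable, so the period is 2 PI for every
    eps. *)
Definition field_avg (i : ax) (z : point) (t : R) : R :=
  match i with
  | XA => rateA z t / speed z t
  | XB => rateB z t / speed z t
  | XC => rateX z t / speed z t
  end.

Section Smooth.

Variable z0 : point.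
Hypothesis Hz0 : Rabs (zA z0) < zB z0.
Hypothesis He0 : z0 None = 0.

Lemma z0_bounds : 0 < zB z0 /\ 0 < (zA z0 + zB z0) / 2 /\ 0 < (zB z0 - zA z0) / 2.
Proof. pose proof (proj1 (Rabs_lt_iff _ _) Hz0); lra. Qed.

Lemma smooth_sin : smooth z0 (fun _ t => sin t).
Proof.
  apply (smooth_time z0 sin 1).
  - intros; apply cont_sin.
  - intros t; rewrite <- (sin_period t 1); f_equal; simpl; ring.
  - intros t; apply Rabs_le; pose proof (SIN_bound t); lra.
Qed.

Lemma smooth_cos : smooth z0 (fun _ t => cos t).
Proof.
  apply (smooth_time z0 cos 1).
  - intros; apply cont_cos.
  - intros t; rewrite <- (cos_period t 1); f_equal; simpl; ring.
  - intros t; apply Rabs_le; pose proof (COS_bound t); lra.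
Qed.

Ltac sm := repeat first
  [ apply smooth_sin | apply smooth_cos | apply smooth_coord | apply smooth_const
  | assumption
  | lazymatch goal with
    | |- smooth _ (fun z t => @?f z t + @?g z t) => apply (smooth_plus z0 f g)
    | |- smooth _ (fun z t => @?f z t - @?g z t) => apply (smooth_minus z0 f g)
    | |- smooth _ (fun z t => @?f z t * @?g z t) => apply (smooth_mult z0 f g)
    | |- smooth _ (fun z t => - @?f z t) => apply (smooth_opp z0 f)
    | |- smooth _ (fun z t => @?f z t ^ ?n) => apply (smooth_pow z0 f n)
    | |- smooth _ (fun z t => @?f z t / ?c) =>
        apply (smooth_mult z0 f (fun _ _ => / c))
    end ].

Lemma smooth_rad : smooth z0 (fun z _ => rad z).
Proof.
  unfold rad; apply (smooth_sqrt z0 (fun z _ => (zA z + zB z) / 2) ((zA z0 + zB z0) / 2)).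
  - apply z0_bounds.
  - intros; lra.
  - sm.
Qed.

(** The minimum is reached at sin^2 = 1 and is positive: for |A| < B the angle psi never stops
    turning, so division by the speed is safe near [z0]. *)
Lemma wf_radicand_ge t : (zB z0 - zA z0) / 2 <= zB z0 - (zA z0 + zB z0) / 2 * sin t ^ 2.
Proof.
  destruct z0_bounds as [H1 [H2 H3]]; pose proof (sin2_bound t).
  assert ((zA z0 + zB z0) / 2 * sin t ^ 2 <= (zA z0 + zB z0) / 2 * 1)
    by (apply Rmult_le_compat_l; lra).
  lra.
Qed.

Lemma smooth_wf : smooth z0 wf.
Proof.
  unfold wf; apply (smooth_sqrt z0 (fun z t => zB z - (zA z + zB z) / 2 * sin t ^ 2)
    ((zB z0 - zA z0) / 2)).
  - apply z0_bounds.
  - intros t; apply wf_radicand_ge.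
  - sm.
Qed.

Lemma smooth_xif : smooth z0 xif.
Proof. pose proof smooth_rad; unfold xif; sm. Qed.

Lemma smooth_zetaf : smooth z0 zetaf.
Proof. unfold zetaf; sm. Qed.

Lemma smooth_etaf : smooth z0 etaf.
Proof. pose proof smooth_rad; pose proof smooth_wf; unfold etaf; sm. Qed.

Lemma smooth_speed : smooth z0 speed.
Proof.
  destruct z0_bounds as [H1 [H2 H3]].
  pose proof smooth_rad; pose proof smooth_wf; pose proof smooth_zetaf.
  unfold speed.
  assert (S1 : smooth z0 (fun z t =>
    (beta * (zetaf z t + sigma) - 2 * wf z t ^ 2) / (2 * zB z))).
  { apply (smooth_div z0 (fun z t => beta * (zetaf z t + sigma) - 2 * wf z t ^ 2)
      (fun z t => 2 * zB z) (2 * zB z0)); [lra|intros; lra|sm|sm]. }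
  assert (S2 : smooth z0 (fun z t => s * zX z * sin t / (2 * rad z))).
  { apply (smooth_div z0 (fun z t => s * zX z * sin t)
      (fun z t => 2 * rad z) (2 * rad z0)); [|intros; lra|sm|sm].
    apply Rmult_lt_0_compat; [lra|now apply sqrt_lt_R0]. }
  sm.
Qed.

Lemma speed_z0_ge t : sqrt ((zB z0 - zA z0) / 2) <= speed z0 t.
Proof.
  unfold speed; rewrite He0, Rmult_0_l, Rplus_0_r.
  apply sqrt_le_1_alt, wf_radicand_ge.
Qed.

Lemma smooth_field_avg i : smooth z0 (field_avg i).
Proof.
  destruct z0_bounds as [H1 [H2 H3]].
  pose proof smooth_xif; pose proof smooth_zetaf.
  assert (Hp : 0 < sqrt ((zB z0 - zA z0) / 2)) by now apply sqrt_lt_R0.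
  destruct i; unfold field_avg.
  - apply (smooth_div z0 rateA speed _ Hp speed_z0_ge); [|apply smooth_speed].
    unfold rateA; sm.
  - apply (smooth_div z0 rateB speed _ Hp speed_z0_ge); [|apply smooth_speed].
    unfold rateB.
    assert (S1 : smooth z0 (fun z t => zetaf z t ^ 2 / zB z)).
    { apply (smooth_div z0 (fun z t => zetaf z t ^ 2) (fun z _ => zB z) (zB z0));
        [lra|intros; lra|sm|sm]. }
    assert (S2 : smooth z0 (fun z t => zetaf z t / zB z)).
    { apply (smooth_div z0 zetaf (fun z _ => zB z) (zB z0));
        [lra|intros; lra|sm|sm]. }
    sm.
  - apply (smooth_div z0 rateX speed _ Hp speed_z0_ge); [|apply smooth_speed].
    unfold rateX; sm.
Qed.

End Smooth.

Section Mean.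

Variable z : point.
Hypothesis Hz : Rabs (zA z) < zB z.
Hypothesis He : z None = 0.

Let m := mm (zA z) (zB z).
Let B := zB z.

Lemma zsum_m : zA z + zB z = 2 * m * B.
Proof. pose proof (mm_bounds _ _ Hz); unfold m, B, mm; field; lra. Qed.

Lemma speed_unperturbed t : speed z t = sqrt B * Dl m t.
Proof.
  destruct (mm_bounds _ _ Hz) as [HB Hm].
  unfold speed; rewrite He, Rmult_0_l, Rplus_0_r; unfold wf, Dl.
  rewrite zsum_m, <- sqrt_mult_alt by (fold B in HB; lra).
  f_equal; fold B; field.
Qed.

Lemma zetaf_m t : zetaf z t = B * (1 - 2 * m * sin t ^ 2).
Proof. unfold zetaf; rewrite zsum_m; fold B; ring. Qed.

Lemma xif_sqr t : xif z t ^ 2 = 4 * m * B * cos t ^ 2.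
Proof.
  destruct (mm_bounds _ _ Hz) as [HB Hm]; fold m in Hm; fold B in HB.
  unfold xif, rad; rewrite zsum_m.
  replace (2 * m * B / 2) with (m * B) by field.
  rewrite !Rpow_mult_distr, pow2_sqrt by (apply Rmult_le_pos; lra); ring.
Qed.

Lemma mean_field_A : RInt (field_avg XA z) 0 (2 * PI) = Mtc sigma beta m B.
Proof.
  destruct (mm_bounds _ _ Hz) as [HB Hm]; fold m in Hm; fold B in HB.
  rewrite <- (RInt_energy sigma beta (s * (2 * rad z) * zX z)) by lra.
  apply RInt_ext_R; intros t; unfold field_avg, rateA.
  rewrite xif_sqr, zetaf_m, speed_unperturbed; unfold xif, Rdiv.
  f_equal; ring.
Qed.

Lemma mean_field_B : RInt (field_avg XB z) 0 (2 * PI) = M3c sigma beta m B.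
Proof.
  destruct (mm_bounds _ _ Hz) as [HB Hm]; fold m in Hm; fold B in HB.
  rewrite <- (Ropp_involutive (M3c _ _ _ _)), <- RInt_Casimir by lra.
  rewrite <- (Rmult_1_l (RInt (fun t => _ * / _) _ _)), Ropp_mult_distr_l.
  rewrite <- RInt_scal_R.
  - apply RInt_ext_R; intros t; unfold field_avg, rateB.
    rewrite zetaf_m, speed_unperturbed; fold B; field.
    repeat split; first [now apply sqrt_neq|apply Dl_neq; lra|lra].
  - intros t; contD.
    apply Rmult_integral_contrapositive_currified; [now apply sqrt_neq|apply Dl_neq; lra].
Qed.

Lemma mean_field_X :
  RInt (field_avg XC z) 0 (2 * PI) = - (sigma * zX z * Tc m B).
Proof.
  destruct (mm_bounds _ _ Hz) as [HB Hm]; fold m in Hm; fold B in HB.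
  unfold Tc; rewrite <- (RInt_chi sigma (2 * rad z)) by lra.
  rewrite <- (Rmult_1_l (RInt (fun t => _ * / _) _ _)), Ropp_mult_distr_l.
  rewrite <- RInt_scal_R.
  - apply RInt_ext_R; intros t; unfold field_avg, rateX.
    rewrite speed_unperturbed; unfold xif, Rdiv; ring.
  - intros t; contD.
    apply Rmult_integral_contrapositive_currified; [now apply sqrt_neq|apply Dl_neq; lra].
Qed.

End Mean.

End Coordinates.

(** * From the slow variables and the angle back to the flow *)

Definition mkpoint (a b c e : R) : point :=
  ext (fun i => match i with XA => a | XB => b | XC => c end) e.

Definition orbit_state (z : point) (t : R) : state :=
  (xif z t, etaf z t, zetaf z t, zX z).

Section Flow.

Variables (sigma beta s eps : R) (a b c p : R -> R) (tau : R).

Let Z (u : R) : point := mkpoint (a u) (b u) (c u) eps.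

Hypothesis Hab : Rabs (a tau) < b tau.
Hypothesis Da : is_derive a tau (eps * rateA sigma beta s (Z tau) (p tau)).
Hypothesis Db : is_derive b tau (eps * rateB sigma beta (Z tau) (p tau)).
Hypothesis Dc : is_derive c tau (eps * rateX sigma (Z tau) (p tau)).
Hypothesis Dp : is_derive p tau (speed sigma beta s (Z tau) (p tau)).

Let r := rad (Z tau).
Let w := wf (Z tau) (p tau).
Let S := sin (p tau).
Let C := cos (p tau).

(** r, w, S and C serve as algebraic coordinates in which A and B are polynomials; after this the
    verification of the flow involves no square root and no trigonometry beyond C^2 = 1 - S^2. *)
Lemma flow_facts :
  0 < r /\ 0 < w /\ 0 < b tau /\ a tau = 2 * r ^ 2 - b tau /\
  b tau = w ^ 2 + r ^ 2 * S ^ 2 /\ C ^ 2 = 1 - S ^ 2.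
Proof.
  pose proof (proj1 (Rabs_lt_iff _ _) Hab) as H.
  assert (H1 : 0 < (a tau + b tau) / 2) by lra.
  assert (H2 : 0 < b tau - (a tau + b tau) / 2 * S ^ 2).
  { pose proof (sin2_bound (p tau)) as Hs; fold S in Hs.
    assert ((a tau + b tau) / 2 * S ^ 2 <= (a tau + b tau) / 2 * 1)
      by (apply Rmult_le_compat_l; lra).
    lra. }
  assert (Hr : r ^ 2 = (a tau + b tau) / 2)
    by (unfold r, rad; rewrite pow2_sqrt; [easy|apply Rlt_le; exact H1]).
  assert (Hw : w ^ 2 = b tau - (a tau + b tau) / 2 * S ^ 2)
    by (unfold w, wf; rewrite pow2_sqrt; [easy|apply Rlt_le; exact H2]).
  repeat split; try lra.
  - apply sqrt_lt_R0; exact H1.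
  - apply sqrt_lt_R0; exact H2.
  - rewrite Hw, Hr; ring.
  - apply cos2_sin2.
Qed.

Lemma is_derive_rad :
  is_derive (fun u => rad (Z u)) tau
    (eps * (rateA sigma beta s (Z tau) (p tau) + rateB sigma beta (Z tau) (p tau))
     / (4 * r)).
Proof.
  destruct flow_facts as [Hr _]; pose proof (proj1 (Rabs_lt_iff _ _) Hab) as H.
  set (da := rateA _ _ _ _ _) in *; set (db := rateB _ _ _ _) in *.
  change (is_derive (fun u => sqrt ((a u + b u) / 2)) tau
    (eps * (da + db) / (4 * r))).
  auto_derive.
  - repeat split; [now eexists; exact Da|now eexists; exact Db|lra].
  - rewrite (is_derive_unique (fun x : R => a x) _ _ Da),
      (is_derive_unique (fun x : R => b x) _ _ Db).
    change (sqrt ((a tau + b tau) * / 2)) with r; field; lra.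
Qed.

Lemma is_derive_wf :
  is_derive (fun u => wf (Z u) (p u)) tau
    (eps * (rateB sigma beta (Z tau) (p tau)
      - (rateA sigma beta s (Z tau) (p tau) + rateB sigma beta (Z tau) (p tau)) / 2
        * S ^ 2) / (2 * w)
     - r ^ 2 * S * C * speed sigma beta s (Z tau) (p tau) / w).
Proof.
  destruct flow_facts as [Hr [Hw [Hb [Ea [Eb _]]]]].
  set (da := rateA _ _ _ _ _) in *; set (db := rateB _ _ _ _) in *.
  set (dp := speed _ _ _ _ _) in *.
  change (is_derive (fun u => sqrt (b u - (a u + b u) / 2 * sin (p u) ^ 2)) tau
    (eps * (db - (da + db) / 2 * S ^ 2) / (2 * w) - r ^ 2 * S * C * dp / w)).
  assert (Hrad : sqrt (b tau - (a tau + b tau) * / 2 * (S * (S * 1))) = w).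
  { unfold w, wf; f_equal; unfold zA, zB, Z, mkpoint, ext, S; field. }
  auto_derive.
  - repeat split; try (eexists; eassumption).
    fold S; rewrite Ea, Eb.
    replace (w ^ 2 + r ^ 2 * S ^ 2 + - ((2 * r ^ 2 - (w ^ 2 + r ^ 2 * S ^ 2)
      + (w ^ 2 + r ^ 2 * S ^ 2)) * / 2 * (S * (S * 1)))) with (w ^ 2) by field.
    now apply pow_lt.
  - rewrite (is_derive_unique (fun x : R => a x) _ _ Da),
      (is_derive_unique (fun x : R => b x) _ _ Db),
      (is_derive_unique (fun x : R => p x) _ _ Dp).
    fold S C; unfold Rminus in Hrad; rewrite Hrad.
    replace (a tau) with (2 * r ^ 2 - b tau) by lra.
    field; lra.
Qed.

Lemma flow_solution :
  is_derive (fun u => orbit_state (Z u) (p u)) tau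
    (lorenz_stenflo sigma beta s eps (orbit_state (Z tau) (p tau))).
Proof.
  destruct flow_facts as [Hr [Hw [Hb [Ea [Eb Ec]]]]].
  pose proof is_derive_rad as Dr; pose proof is_derive_wf as Dw.
  set (da := rateA _ _ _ _ _) in *; set (db := rateB _ _ _ _) in *.
  set (dp := speed _ _ _ _ _) in *.
  assert (Edp : dp = w + eps * (C * S * ((beta * (zetaf (Z tau) (p tau) + sigma)
    - 2 * w ^ 2) / (2 * b tau) + sigma) - s * c tau * S / (2 * r))) by reflexivity.
  assert (Ezeta : zetaf (Z tau) (p tau) = w ^ 2 - r ^ 2 * S ^ 2).
  { transitivity (b tau - (a tau + b tau) * S ^ 2); [reflexivity|].
    rewrite Ea; rewrite Eb; ring. }
  assert (Exi : xif (Z tau) (p tau) = 2 * r * C) by reflexivity.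
  assert (Eeta : etaf (Z tau) (p tau) = -2 * r * S * w) by reflexivity.
  assert (Eda : da = - sigma * (4 * r ^ 2 * (1 - S ^ 2)) + s * (2 * r * C) * c tau
    + beta * (w ^ 2 - r ^ 2 * S ^ 2) + beta * sigma).
  { unfold da, rateA; rewrite Ezeta, Exi, <- Ec; change (zX (Z tau)) with (c tau); ring. }
  assert (Edb : db = - (b tau + (beta - 1) * ((w ^ 2 - r ^ 2 * S ^ 2) ^ 2 / b tau)
    + sigma * beta * ((w ^ 2 - r ^ 2 * S ^ 2) / b tau))).
  { unfold db, rateB; rewrite Ezeta; reflexivity. }
  rewrite Ezeta in Edp.
  (* The equations for eta and zeta contain the speed only through this product; rewriting C^2 as 1
     - S^2 here leaves identities that [field] can check. *)
  assert (ECdp : C * dp = C * w + eps * ((1 - S ^ 2) * S *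
    ((beta * (w ^ 2 - r ^ 2 * S ^ 2 + sigma) - 2 * w ^ 2) / (2 * b tau) + sigma)
    - s * c tau * S * C / (2 * r))).
  { rewrite Edp, <- Ec; field; lra. }
  assert (D1 : is_derive (fun u => xif (Z u) (p u)) tau
    (-2 * r * S * w - eps * (sigma * (2 * r * C) - s * c tau))).
  { change (is_derive (fun u => 2 * rad (Z u) * cos (p u)) tau
      (-2 * r * S * w - eps * (sigma * (2 * r * C) - s * c tau))).
    evar_last.
    - apply (is_derive_mult (fun u => 2 * rad (Z u)) (fun u => cos (p u)));
        [apply (is_derive_scal (fun u => rad (Z u))), Dr
        |apply (is_derive_comp cos p); [apply is_derive_cos|exact Dp]
        |intros; apply Rmult_comm].
    - unfold plus, mult, scal; simpl; unfold mult; simpl.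
      fold r S C.
      (* Added to eps (2 sigma r C - s chi), the right side becomes divisible by S^2. Dividing by 2
         r S to solve the xi equation for psi' therefore leaves no singularity at S = 0: this is the
         origin of the formula for [speed]. *)
      assert (E1 : eps * (da + db) / (4 * r) * 2 * C
        = eps * (s * c tau * (1 - S ^ 2) - 2 * sigma * r * C * (1 - S ^ 2)
          + C * r * S ^ 2 * (beta * (w ^ 2 - r ^ 2 * S ^ 2 + sigma) - 2 * w ^ 2) / b tau)).
      { rewrite Eda, Edb, <- Ec, Eb; field; repeat split; intros Hx; lra. }
      transitivity (eps * (da + db) / (4 * r) * 2 * C + 2 * r * (dp * - S)); [ring|].
      rewrite E1, Edp; field; lra. }
  assert (D2 : is_derive (fun u => etaf (Z u) (p u)) tau
    (- (2 * r * C) * (w ^ 2 - r ^ 2 * S ^ 2) - eps * (-2 * r * S * w))).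
  { change (is_derive (fun u => -2 * rad (Z u) * sin (p u) * wf (Z u) (p u)) tau
      (- (2 * r * C) * (w ^ 2 - r ^ 2 * S ^ 2) - eps * (-2 * r * S * w))).
    evar_last.
    - apply (is_derive_mult (fun u => -2 * rad (Z u) * sin (p u)) (fun u => wf (Z u) (p u)));
        [apply (is_derive_mult (fun u => -2 * rad (Z u)) (fun u => sin (p u)));
          [apply (is_derive_scal (fun u => rad (Z u))), Dr
          |apply (is_derive_comp sin p); [apply is_derive_sin|exact Dp]
          |intros; apply Rmult_comm]
        |exact Dw|intros; apply Rmult_comm].
    - unfold plus, mult, scal; simpl; unfold mult; simpl.
      fold r w S C.
      transitivity (- eps * (da + db) / (2 * r) * S * w - 2 * r * w * (C * dp)
        - r * S * (eps * (db - (da + db) / 2 * S ^ 2)) / w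
        + 2 * r ^ 3 * S ^ 2 * (C * dp) / w); [field; lra|].
      rewrite ECdp, Eda, Edb, Eb; field; repeat split; intros Hx; lra. }
  assert (D3 : is_derive (fun u => zetaf (Z u) (p u)) tau
    (2 * r * C * (-2 * r * S * w) - eps * beta * (w ^ 2 - r ^ 2 * S ^ 2 + sigma))).
  { change (is_derive (fun u => b u - (a u + b u) * sin (p u) ^ 2) tau
      (2 * r * C * (-2 * r * S * w) - eps * beta * (w ^ 2 - r ^ 2 * S ^ 2 + sigma))).
    auto_derive; [repeat split; eexists; eassumption|].
    rewrite (is_derive_unique (fun x : R => a x) _ _ Da),
      (is_derive_unique (fun x : R => b x) _ _ Db),
      (is_derive_unique (fun x : R => p x) _ _ Dp).
    fold S C.
    transitivity (eps * db - eps * (da + db) * S ^ 2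
      - (a tau + b tau) * 2 * S * (C * dp)); [ring|].
    rewrite ECdp, Eda, Edb, Ea, Eb; field; repeat split; intros Hx; lra. }
  unfold orbit_state, lorenz_stenflo; rewrite Ezeta, Exi, Eeta.
  repeat apply is_derive_pair; try assumption.
  replace (- eps * (2 * r * C + sigma * zX (Z tau)))
    with (eps * rateX sigma (Z tau) (p tau)) by (unfold rateX; rewrite Exi; ring).
  exact Dc.
Qed.

End Flow.

(** chi splits off, leaving a 2x2 block and a scalar. Injectivity of [P] is recorded because the
    fixed point yields that [P] annihilates the mean. *)
Lemma block_inverse (J : ax -> ax -> R) :
  J XA XC = 0 -> J XB XC = 0 -> J XC XA = 0 -> J XC XB = 0 -> J XC XC <> 0 ->
  J XA XA * J XB XB - J XA XB * J XB XA <> 0 ->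
  exists P : ax -> ax -> R,
    (forall i k, s3 (fun j => P i j * J j k) = kron i k) /\
    (forall v, (forall i, s3 (fun j => P i j * v j) = 0) -> forall i, v i = 0).
Proof.
  intros H1 H2 H3 H4 H5 Hd.
  set (d := J XA XA * J XB XB - J XA XB * J XB XA) in *.
  exists (fun i j => match i, j with
    | XA, XA => J XB XB / d | XA, XB => - J XA XB / d
    | XB, XA => - J XB XA / d | XB, XB => J XA XA / d
    | XC, XC => / J XC XC | _, _ => 0 end).
  split.
  - unfold s3, kron; intros [] []; rewrite ?H1, ?H2, ?H3, ?H4;
      unfold d in *; field; assumption.
  - intros v Hv.
    pose proof (Hv XA) as EA; pose proof (Hv XB) as EB; pose proof (Hv XC) as EC.
    unfold s3 in EA, EB, EC.
    assert (FA : J XB XB * v XA - J XA XB * v XB = 0).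
    { apply (Rmult_eq_reg_r (/ d)); [|now apply Rinv_neq_0_compat].
      unfold Rdiv in *; lra. }
    assert (FB : - J XB XA * v XA + J XA XA * v XB = 0).
    { apply (Rmult_eq_reg_r (/ d)); [|now apply Rinv_neq_0_compat].
      unfold Rdiv in *; lra. }
    assert (Hcancel : forall x, d * x = 0 -> x = 0).
    { intros x Hx; apply Rmult_integral in Hx; tauto. }
    intros [].
    + apply Hcancel.
      transitivity (J XA XA * (J XB XB * v XA - J XA XB * v XB)
        + J XA XB * (- J XB XA * v XA + J XA XA * v XB)); [unfold d; ring|].
      rewrite FA, FB; ring.
    + apply Hcancel.
      transitivity (J XB XA * (J XB XB * v XA - J XA XB * v XB)
        + J XB XB * (- J XB XA * v XA + J XA XA * v XB)); [unfold d; ring|].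
      rewrite FA, FB; ring.
    + assert (E : / J XC XC * v XC = 0) by lra.
      apply Rmult_integral in E; destruct E as [E|E]; [|easy].
      now apply Rinv_neq_0_compat in H5.
Qed.

(** * Persistence of the periodic orbit *)

Section Persistence.

Variables sigma beta s A B : R.
Hypothesis Hsigma : 0 < sigma.
Hypothesis Hbeta : 0 < beta.
Hypothesis Hlambda : (sigma + 1) / (beta + 2) > 2 / 3.
Hypothesis HAB : Rabs A < B.
Hypothesis E1 : Mtc sigma beta (mm A B) B = 0.
Hypothesis E3 : M3c sigma beta (mm A B) B = 0.

Let z0 : point := mkpoint A B 0 0.
Let m := mm A B.

(** Bumping coordinate [j] moves (m, B) along the curve (mt j, bt j), with velocity (m' j, kron XB
    j) at h = 0, so the derivative lemmas along curves give the Jacobian. *)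
Let mt (j : ax) (h : R) := mm (A + kron XA j * h) (B + kron XB j * h).
Let bt (j : ax) (h : R) := B + kron XB j * h.
Let m' (j : ax) := kron XA j / (2 * B) - kron XB j * A / (2 * B ^ 2).

Lemma is_derive_mt j : is_derive (mt j) 0 (m' j).
Proof.
  destruct (mm_bounds A B HAB) as [HB Hm].
  unfold mt, mm, m'; generalize (kron XA j) (kron XB j); intros a b.
  auto_derive; [lra|field; lra].
Qed.

Lemma is_derive_bt j : is_derive (bt j) 0 (kron XB j).
Proof.
  unfold bt; generalize (kron XB j); intros b; auto_derive; [easy|ring].
Qed.

Lemma bump_admissible j :
  locally 0 (fun h => Rabs (zA (bump z0 j h)) < zB (bump z0 j h)).
Proof.
  pose proof (proj1 (Rabs_lt_iff _ _) HAB) as H.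
  assert (L : locally 0 (fun h => - (B + A) / 2 < h < (B + A) / 2 /\
    - (B - A) / 2 < h < (B - A) / 2))
    by (apply filter_and; apply locally_between; lra).
  revert L; apply filter_imp; intros h Hh; apply Rabs_lt_iff.
  unfold zA, zB, bump, z0, mkpoint, ext, kron; destruct j; cbv iota beta; lra.
Qed.

Definition avg_jacobian (i j : ax) : R :=
  match i with
  | XA => dMt sigma beta m B (m' j) (kron XB j)
  | XB => dM3 sigma beta m B (m' j) (kron XB j)
  | XC => - (sigma * kron XC j * Tc m B)
  end.

Lemma avg_jacobian_correct i j :
  is_derive (fun h => RInt (field_avg sigma beta s i (bump z0 j h)) 0 (2 * PI)) 0
    (avg_jacobian i j).
Proof.
  destruct (mm_bounds A B HAB) as [HB Hm].
  pose proof (is_derive_mt j) as Dm; pose proof (is_derive_bt j) as Db.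
  assert (Em0 : mt j 0 = m) by (unfold mt, m; f_equal; ring).
  assert (Eb0 : bt j 0 = B) by (unfold bt; ring).
  assert (Hm0 : 0 < mt j 0 < 1) by now rewrite Em0.
  assert (Hb0 : 0 < bt j 0) by now rewrite Eb0.
  assert (F1 : Mtc sigma beta (mt j 0) (bt j 0) = 0) by now rewrite Em0, Eb0.
  assert (F3 : M3c sigma beta (mt j 0) (bt j 0) = 0) by now rewrite Em0, Eb0.
  pose proof (is_derive_Mtc_curve sigma beta _ _ _ _ _ Dm Db Hm0 Hb0 F1) as D1.
  pose proof (is_derive_M3c_curve sigma beta _ _ _ _ _ Dm Db Hm0 Hb0 F3) as D3.
  pose proof (Derive_correct _ _ (ex_derive_Tc_curve _ _ _ _ _ Dm Db Hm0 Hb0)) as DT.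
  set (T' := Derive _ _) in DT.
  rewrite Em0, Eb0 in D1, D3.
  unfold avg_jacobian; destruct i.
  - eapply is_derive_ext_loc; [|exact D1].
    generalize (bump_admissible j); apply filter_imp; intros h Hh.
    symmetry; now apply mean_field_A.
  - eapply is_derive_ext_loc; [|exact D3].
    generalize (bump_admissible j); apply filter_imp; intros h Hh.
    symmetry; now apply mean_field_B.
  - apply (is_derive_ext_loc (fun h => - (sigma * kron XC j) * (h * Tc (mt j h) (bt j h)))).
    + generalize (bump_admissible j); apply filter_imp; intros h Hh.
      rewrite mean_field_X by easy.
      change (zX (bump z0 j h)) with (0 + kron XC j * h).
      change (zA (bump z0 j h)) with (A + kron XA j * h).
      change (zB (bump z0 j h)) with (B + kron XB j * h).
      unfold mt, bt; toR; ring.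
    + replace (- (sigma * kron XC j * Tc m B)) with
        (- (sigma * kron XC j) * (1 * Tc (mt j 0) (bt j 0) + 0 * T'))
        by (rewrite Em0, Eb0; ring).
      apply (is_derive_scal (fun h => h * Tc (mt j h) (bt j h))).
      apply (is_derive_mult (fun h => h) (fun h => Tc (mt j h) (bt j h)));
        [apply (is_derive_id 0)|exact DT|intros; apply Rmult_comm].
Qed.

Lemma averaged_periodic :
  exists C eps0, 0 < C /\ 0 < eps0 /\ forall eps, 0 < eps < eps0 ->
    exists y : ax -> R -> R,
      (forall i t, y i (t + 2 * PI) = y i t) /\
      (forall i t, is_derive (y i) t
        (eps * field_avg sigma beta s i (ext (fun j => y j t) eps) t)) /\
      (forall i t, Rabs (y i t - z0 (Some i)) <= C * eps).
Proof.
  destruct (mm_bounds A B HAB) as [HB Hm].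
  pose proof (Tc_pos m B Hm HB) as HT.
  destruct (block_inverse avg_jacobian) as [P [HP HPk]].
  - unfold avg_jacobian, dMt, m', kron; field; split; [lra|now apply sqrt_neq].
  - unfold avg_jacobian, dM3, m', kron; field; split; [lra|now apply sqrt_neq].
  - unfold avg_jacobian, kron; ring.
  - unfold avg_jacobian, kron; ring.
  - unfold avg_jacobian, kron.
    assert (0 < sigma * Tc m B) by now apply Rmult_lt_0_compat.
    lra.
  - unfold avg_jacobian.
    apply (dMt_dM3_independent sigma beta Hsigma Hbeta Hlambda m B); try assumption.
    (* The velocities in the (m, B) plane are (1 / (2 B), 0) for A and one with second entry 1 for
       B; their cross product is 1 / (2 B). *)
    unfold m', kron.
    replace (_ - _) with (/ (2 * B)) by (field; lra).
    apply Rinv_neq_0_compat; lra.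
  - apply (averaging z0 (field_avg sigma beta s) avg_jacobian P); try assumption.
    + reflexivity.
    + intros i; now apply smooth_field_avg.
    + intros [].
      * rewrite mean_field_A; easy.
      * rewrite mean_field_B; easy.
      * rewrite mean_field_X by easy; change (zX z0) with 0; toR; ring.
    + exact avg_jacobian_correct.
Qed.

(** The time at which the unperturbed orbit has amplitude [t] is F(t) / sqrt B, so psi parametrizes
    that orbit too and the two orbits can be compared at equal angle. *)
Lemma L1_as_orbit_state t :
  L1 A B 0 (ellipticF t (k1 A B) / sqrt B) = orbit_state z0 t.
Proof.
  destruct (mm_bounds A B HAB) as [HB Hm].
  pose proof (sqrt_neq B HB) as Hs; pose proof (k1_sqr A B HAB) as Hk.
  assert (Ham : am (sqrt B * (ellipticF t (k1 A B) / sqrt B)) (k1 A B) = t).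
  { replace (sqrt B * (ellipticF t (k1 A B) / sqrt B)) with (ellipticF t (k1 A B))
      by (field; exact Hs).
    now apply am_inverse, k1_sqr_lt. }
  assert (Er : rad z0 = k1 A B * sqrt B).
  { unfold rad, k1; rewrite <- sqrt_mult_alt by (unfold mm in Hm; lra).
    f_equal; change (zA z0) with A; change (zB z0) with B; field; lra. }
  assert (Ew : wf z0 t = sqrt B * Dl (mm A B) t).
  { rewrite <- (speed_unperturbed sigma beta s z0) by easy.
    unfold speed; change (z0 None) with 0; ring. }
  unfold L1, orbit_state; repeat f_equal.
  - unfold xi1, cn, xif; rewrite Ham, Er; ring.
  - unfold eta1, dn, sn, etaf; rewrite Ham, Er, Ew, Hk.
    fold (Dl (mm A B) t).
    replace B with (sqrt B * sqrt B) at 2 by (apply sqrt_sqrt; lra); ring.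
  - rewrite zetaf_m by easy; unfold zeta1, sn; rewrite Ham, Hk; reflexivity.
Qed.

Lemma smooth_near f : smooth z0 f ->
  exists L delta, 0 < L /\ 0 < delta /\
    (forall t, Rabs (f z0 t) <= L) /\
    (forall z t, dist4 z z0 <= delta -> Rabs (f z t - f z0 t) <= L * dist4 z z0) /\
    (forall Z : R -> point, (forall o t, continuous (fun t => Z t o) t) ->
       (forall t, dist4 (Z t) z0 <= delta) ->
       forall t, continuous (fun t => f (Z t) t) t).
Proof.
  intros [d [M Hf]].
  pose proof (C1_M_pos _ _ _ _ Hf) as HM.
  destruct (C1_lipschitz _ _ _ _ Hf) as [d1 [Hd1 H1]].
  destruct (C1_cont _ _ _ _ Hf) as [d2 [Hd2 H2]].
  exists (M + 1), (Rmin d1 d2); split; [lra|].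
  split; [now apply Rmin_pos|split; [|split]].
  - intros t; pose proof (C1_bound _ _ _ _ Hf t); lra.
  - intros z t Hz; apply H1; [eapply Rle_trans; [exact Hz|apply Rmin_l]|].
    rewrite dist4_refl; lra.
  - intros Z HZ Hd; apply H2; [exact HZ|]; intros t.
    eapply Rle_trans; [apply Hd|apply Rmin_r].
Qed.

Lemma periodic_orbit_persists :
  exists C eps0 : R, 0 < C /\ 0 < eps0 /\
    forall eps : R, 0 < eps < eps0 ->
    exists x : R -> state,
      is_periodic_orbit (lorenz_stenflo sigma beta s eps) x /\
      orbit_within (C * eps) x (L1 A B 0).
Proof.
  destruct (mm_bounds A B HAB) as [HB Hm].
  pose proof (proj1 (Rabs_lt_iff _ _) HAB) as HAB'.
  pose proof PI_RGT_0 as HPI.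
  destruct averaged_periodic as [C1 [e1 [HC1 [He1 Hy]]]].
  destruct (smooth_near xif) as [Lx [dx [HLx [Hdx [_ [Nx _]]]]]];
    [now apply smooth_xif|].
  destruct (smooth_near etaf) as [Le [de [HLe [Hde [_ [Ne _]]]]]];
    [now apply smooth_etaf|].
  destruct (smooth_near zetaf) as [Lz [dz [HLz [Hdz [_ [Nz _]]]]]];
    [now apply smooth_zetaf|].
  destruct (smooth_near (speed sigma beta s)) as [Ls [ds [HLs [Hds [Bs [Ns Cs]]]]]];
    [now apply smooth_speed|].
  set (h0 := sqrt ((B - A) / 2)).
  assert (Hh0 : 0 < h0) by (apply sqrt_lt_R0; lra).
  assert (Hs0 : forall t, h0 <= speed sigma beta s z0 t)
    by (intros t; now apply (speed_z0_ge sigma beta s z0)).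
  (* [dist4] adds three slow errors, each at most C1 eps, and eps itself. *)
  set (C2 := 3 * C1 + 1).
  set (K := C2 + C1).
  assert (HK : 0 < K) by (unfold K, C2; lra).
  (* The first four bounds enter the Lipschitz neighborhoods, h0 / (2 Ls) keeps the speed above h0 /
     2, and the last two keep |A| < B along the perturbed curve. *)
  assert (Hmin : exists q, 0 < q /\ q <= dx /\ q <= de /\ q <= dz /\ q <= ds /\
    q <= h0 / (2 * Ls) /\ q <= (B - A) / 4 /\ q <= (B + A) / 4).
  { exists (Rmin dx (Rmin de (Rmin dz (Rmin ds (Rmin (h0 / (2 * Ls))
      (Rmin ((B - A) / 4) ((B + A) / 4))))))).
    assert (0 < h0 / (2 * Ls)) by (apply Rdiv_lt_0_compat; lra).
    split; [repeat apply Rmin_pos; lra|].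
    repeat split; rmin. }
  destruct Hmin as [q [Hq [Q1 [Q2 [Q3 [Q4 [Q5 [Q6 Q7]]]]]]]].
  exists (4 * ((Lx + Le + Lz + 1) * C2)), (Rmin e1 (q / K)).
  split; [unfold C2; apply Rmult_lt_0_compat; [lra|apply Rmult_lt_0_compat; lra]|].
  split; [apply Rmin_pos; [easy|now apply Rdiv_lt_0_compat]|].
  intros eps [Heps Heps1].
  assert (Hee : eps < e1) by (eapply Rlt_le_trans; [exact Heps1|apply Rmin_l]).
  assert (HeK : K * eps <= q).
  { apply Rle_trans with (K * (q / K)); [|right; field; lra].
    mul_mono.
    left; eapply Rlt_le_trans; [exact Heps1|apply Rmin_r]. }
  assert (HC2e : C2 * eps <= q)
    by (unfold K in HeK; assert (0 < C1 * eps) by (apply Rmult_lt_0_compat; lra); lra).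
  assert (HC1e : C1 * eps <= q).
  { unfold K in HeK; assert (0 < C2 * eps)
      by (unfold C2; apply Rmult_lt_0_compat; lra); lra. }
  destruct (Hy eps (conj Heps Hee)) as [y [Yper [Yder Yclose]]].
  set (Z := fun t => mkpoint (y XA t) (y XB t) (y XC t) eps).
  assert (HZ : forall t, dist4 (Z t) z0 <= C2 * eps).
  { intros t; unfold dist4, s4, s3.
    change (Rabs (y XA t - z0 (Some XA)) + Rabs (y XB t - z0 (Some XB))
      + Rabs (y XC t - z0 (Some XC)) + Rabs (eps - 0) <= C2 * eps).
    replace (eps - 0) with eps by ring; rewrite (Rabs_pos_eq eps) by lra.
    pose proof (Yclose XA t); pose proof (Yclose XB t); pose proof (Yclose XC t).
    unfold C2; lra. }
  assert (HZcont : forall o t, continuous (fun t => Z t o) t).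
  { intros [[]|] t; [| | |apply cont_const]; eapply cont_of_derive, Yder. }
  set (hs := fun t => speed sigma beta s (Z t) t).
  assert (Hhs : forall t, h0 / 2 <= hs t <= Ls + h0 / 2).
  { intros t; specialize (Ns (Z t) t ltac:(specialize (HZ t); lra)).
    fold (hs t) in Ns.
    assert (Hb : Ls * dist4 (Z t) z0 <= h0 / 2).
    { apply Rle_trans with (Ls * (h0 / (2 * Ls))); [|right; field; lra].
      mul_mono; specialize (HZ t); lra. }
    assert (Hb2 : Rabs (hs t - speed sigma beta s z0 t) <= h0 / 2) by lra.
    apply Rabs_le_between in Hb2.
    specialize (Hs0 t); specialize (Bs t); apply Rabs_le_between in Bs; lra. }
  assert (Hhscont : forall t, continuous hs t).
  { exact (Cs Z HZcont (fun t => Rle_trans _ _ _ (HZ t) (Rle_trans _ _ _ HC2e Q4))). }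
  assert (HZper : forall t, Z (t + 2 * PI) = Z t)
    by (intros t; unfold Z; now rewrite !Yper).
  assert (Hhsper : forall t, hs (t + 2 * PI) = hs t).
  { intros t; unfold hs; rewrite HZper.
    destruct (smooth_speed sigma beta s z0 HAB) as [ds' [Ms' HS]].
    apply (C1_periodic _ _ _ _ HS). }
  assert (Hinvcont : forall t, continuous (fun t => / hs t) t).
  { intros t; apply cont_inv; [apply Hhscont|specialize (Hhs t); lra]. }
  set (time := fun t => RInt (fun t => / hs t) 0 t).
  assert (Dtime : forall t, is_derive time t (/ hs t))
    by (intros t; exact (is_derive_RInt_cont (fun t => / hs t) 0 t Hinvcont)).
  (* An upper bound on the speed bounds dtau/dpsi below, so the angle is defined for all times. *)
  assert (Hlow : forall t, / (Ls + h0 / 2) <= / hs t).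
  { intros t; specialize (Hhs t); apply Rinv_le_contravar; lra. }
  destruct (global_inverse time (fun t => / hs t) (/ (Ls + h0 / 2)))
    as [p [Htp [Hpt Dp]]].
  { apply Rinv_0_lt_compat; lra. }
  { exact Dtime. }
  { exact Hlow. }
  assert (Dp' : forall u, is_derive p u (hs (p u)))
    by (intros u; rewrite <- (Rinv_inv (hs (p u))); apply Dp).
  assert (Dy : forall i u, is_derive (fun u => y i (p u)) u
    (hs (p u) * (eps * field_avg sigma beta s i (Z (p u)) (p u)))).
  { intros i u; apply (is_derive_comp (y i) p); [|apply Dp'].
    replace (field_avg sigma beta s i (Z (p u)) (p u)) with
      (field_avg sigma beta s i (ext (fun j => y j (p u)) eps) (p u))
      by (destruct i; reflexivity).
    apply Yder. }
  assert (Hadm : forall t, Rabs (y XA t) < y XB t).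
  { intros t; pose proof (Yclose XA t) as HA; pose proof (Yclose XB t) as HBb.
    change (z0 (Some XA)) with A in HA; change (z0 (Some XB)) with B in HBb.
    apply Rabs_le_between in HA; apply Rabs_le_between in HBb.
    apply Rabs_lt_iff; lra. }
  set (x := fun u => orbit_state (Z (p u)) (p u)).
  (* The speed along the curve is 2 PI-periodic, so one turn of psi takes the same time from every
     starting angle; that time is the period. *)
  assert (Hshift : forall u, p (u + time (2 * PI)) = p u + 2 * PI).
  { intros u; rewrite <- (Hpt (p u + 2 * PI)); f_equal; unfold time at 2.
    rewrite RInt_periodic_shift; [|exact Hinvcont|intros; now rewrite Hhsper].
    fold (time (2 * PI)) (time (p u)); rewrite Htp; toR; ring. }
  exists x; split; [split; [|split]|].
  - intros u; unfold x.
    assert (Hne : hs (p u) <> 0) by (specialize (Hhs (p u)); lra).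
    apply (flow_solution sigma beta s eps (fun u => y XA (p u)) (fun u => y XB (p u))
      (fun u => y XC (p u)) p u).
    + apply Hadm.
    + evar_last; [apply (Dy XA)|]; unfold field_avg; fold (Z (p u)); fold (hs (p u)).
      field; exact Hne.
    + evar_last; [apply (Dy XB)|]; unfold field_avg; fold (Z (p u)); fold (hs (p u)).
      field; exact Hne.
    + evar_last; [apply (Dy XC)|]; unfold field_avg; fold (Z (p u)); fold (hs (p u)).
      field; exact Hne.
    + apply Dp'.
  - exists (time (2 * PI)); split.
    + assert (E0 : time 0 = 0) by (unfold time; rewrite RInt_point; reflexivity).
      rewrite <- E0 at 1.
      apply (incr_of_derive_pos time (fun t => / hs t)); [lra|auto|].
      intros t _; specialize (Hhs t); apply Rinv_0_lt_compat; lra.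
    + intros u; unfold x; rewrite Hshift, HZper.
      unfold orbit_state, etaf, xif, zetaf, wf.
      replace (p u + 2 * PI) with (p u + 2 * INR 1 * PI) by (simpl; ring).
      now rewrite sin_period, cos_period.
  (* xi = 2 r cos psi is positive at psi = 0 and negative at psi = PI, which excludes an
     equilibrium. *)
  - exists (time 0), (time PI); intros Ex.
    apply (f_equal (fun q : state => fst (fst (fst q)))) in Ex.
    unfold x, orbit_state in Ex; rewrite !Hpt in Ex; simpl in Ex.
    unfold xif in Ex; rewrite cos_0, cos_PI in Ex.
    assert (Hr : forall t, 0 < rad (Z t)).
    { intros t; pose proof (proj1 (Rabs_lt_iff _ _) (Hadm t)).
      apply sqrt_lt_R0; change (0 < (y XA t + y XB t) / 2); lra. }
    pose proof (Hr 0); pose proof (Hr PI); lra.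
  (* The comparison point on [L1] has the same angle psi rather than the same time, so the two
     periods may differ without any accumulated drift. *)
  - intros u; exists (ellipticF (p u) (k1 A B) / sqrt B).
    rewrite L1_as_orbit_state; unfold x.
    replace (4 * ((Lx + Le + Lz + 1) * C2) * eps)
      with (4 * ((Lx + Le + Lz + 1) * (C2 * eps))) by ring.
    specialize (HZ (p u)).
    pose proof (dist4_pos (Z (p u)) z0) as Hd0.
    assert (Hw : forall L b, 0 < L -> L <= Lx + Le + Lz + 1 ->
      Rabs b <= L * dist4 (Z (p u)) z0 ->
      Rabs b <= (Lx + Le + Lz + 1) * (C2 * eps)).
    { intros L b HL HLL Hb; eapply Rle_trans; [exact Hb|].
      apply Rmult_le_compat; lra. }
    apply norm_state_le; simpl.
    + apply (Hw Lx); [lra|lra|apply Nx; lra].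
    + apply (Hw Le); [lra|lra|apply Ne; lra].
    + apply (Hw Lz); [lra|lra|apply Nz; lra].
    + apply (Hw 1); [lra|lra|rewrite Rmult_1_l].
      apply (dist4_coord (Z (p u)) z0 (Some XC)).
Qed.

End Persistence.

Theorem mainTheorem5 (sigma beta s : R)
  (hsigma : 0 < sigma) (hbeta : 0 < beta)
  (hlambda : (sigma + 1) / (beta + 2) > 2 / 3) :
  (* (i) *)
  (forall A B : R, Rabs A < B ->
     (forall s' chi0 : R,
        Mt1 sigma beta s' A B chi0 = lorenz_Mt1 sigma beta A B) /\
     M3 sigma beta A B = lorenz_M3 sigma beta A B /\
     (forall chi0 : R, M4 sigma A B chi0 = 0 <-> chi0 = 0) /\
     (forall chi0 : R,
        melnikov sigma beta s A B chi0 = (0, 0, 0) <->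
        chi0 = 0 /\ Mt1 sigma beta s A B chi0 = 0 /\ M3 sigma beta A B = 0)) /\
  (* (ii) *)
  (forall A B chi0 : R, Rabs A < B ->
     melnikov sigma beta s A B chi0 = (0, 0, 0) ->
     jacobian_nondegenerate (melnikov_IB sigma beta s) (action A B) B chi0) /\
  (* persistence of the periodic orbit *)
  (exists A B : R,
     (Rabs A < B /\ Mt1 sigma beta s A B 0 = 0 /\ M3 sigma beta A B = 0) /\
     (forall A' B' : R,
        Rabs A' < B' -> Mt1 sigma beta s A' B' 0 = 0 ->
        M3 sigma beta A' B' = 0 -> A' = A /\ B' = B) /\
     (exists C eps0 : R, 0 < C /\ 0 < eps0 /\
        forall eps : R, 0 < eps < eps0 ->
        exists x : R -> state,
          is_periodic_orbit (lorenz_stenflo sigma beta s eps) x /\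
          orbit_within (C * eps) x (L1 A B 0))).
Proof.
  split; [|split].
  - intros A B H; split; [|split; [|split]].
    + intros s' chi0; now rewrite Mt1_eq, lorenz_Mt1_eq.
    + reflexivity.
    + intros chi0; now apply M4_zero_iff.
    + intros chi0; now apply melnikov_zero_iff.
  - intros A B chi0 H E; now apply melnikov_jacobian_nondegenerate.
  - destruct (zero_exists_unique sigma beta hsigma hbeta hlambda)
      as [A [B [[H [E1 E3]] Huniq]]].
    exists A, B; split; [|split].
    + rewrite Mt1_eq, M3_eq by exact H; easy.
    + intros A' B' H' E1' E3'; rewrite Mt1_eq in E1' by exact H'.
      rewrite M3_eq in E3' by exact H'; now apply Huniq.
    + now apply periodic_orbit_persists.
Qed.
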